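(* Let $K\subset\mathbb{R}^2$ be a convex disc whose boundary is of class $C^2_+$, and let $r>r_M$. For each positive integer $n$ let $K_n^r=\mathrm{conv}_r(X_n)$ be the uniform random disc-polygon in $K$ generated by $n$ independent uniform random points of $K$. Then there is a constant $\gamma>0$, depending only on $K$ and $r$, such that for all $n\ge 1$ $$\mathrm{Var}\,(f_0(K_n^r))\le \gamma\, n^{1/3}\qquad\text{and}\qquad \mathrm{Var}\,(A(K_n^r))\le \gamma\, n^{-5/3}.$$
   Context: A convex disc is a compact convex subset of $\mathbb{R}^2$ with non-empty interior. Its boundary $\partial K$ is of class $C^2_+$ if it is twice continuously differentiable and the curvature $\kappa(x)$ is strictly positive at every $x\in\partial K$. Put $\kappa_m=\min_{x\in\partial K}\kappa(x)$ and $r_M=1/\kappa_m$. For $X\subset K$ and $r\ge r_M$, the closed $r$-hyperconvex hull $\mathrm{conv}_r(X)$ is the intersection of all closed circular discs of radius $r$ that contain $X$; it is contained in $K$. Let $X_n=\{x_1,\dots,x_n\}$ be a sample of $n$ independent random points chosen from $K$ according to the uniform probability distribution, and let $K_n^r=\mathrm{conv}_r(X_n)$. $A(\cdot)$ denotes area, $f_0(K_n^r)$ denotes the number of vertices of the disc-polygon $K_n^r$ (equivalently, almost surely, the number of points $x_i$ with $x_i\notin\mathrm{conv}_r(X_n\setminus\{x_i\})$), and $\mathrm{Var}$ denotes variance. *)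

(* Defs.v *)
From HB Require Import structures.
From mathcomp Require Import all_boot all_order all_algebra finmap.
From mathcomp Require Import all_classical all_reals all_analysis.

Set Implicit Arguments.
Unset Strict Implicit.
Unset Printing Implicit Defensive.

Import Order.TTheory GRing.Theory Num.Theory.
Import numFieldNormedType.Exports.

Local Open Scope ring_scope.
Local Open Scope classical_set_scope.

(* The Euclidean plane is [R * R].  The library norm on [R * R] is the max
   norm: it induces the same topology, but Euclidean discs are defined by
   hand below. *)

Section plane.
Context {R : realType}.
Implicit Types (K P X : set (R * R)) (c p q v x : R * R) (f : R -> R).

Definition euclid_dist p q : R :=
  Num.sqrt ((p.1 - q.1) ^+ 2 + (p.2 - q.2) ^+ 2).

Definition disc (r : R) c : set (R * R) := [set x | euclid_dist c x <= r].

Definition area : set (R * R) -> \bar R :=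
  (@lebesgue_measure R \x @lebesgue_measure R)%E.

Definition boundary K : set (R * R) := closure K `\` K°.

Definition convex_disc K : Prop := [/\ compact K, convex_set K & K° !=set0].

Definition C2 f : Prop :=
  [/\ forall t, derivable f t 1,
      forall t, derivable f^`() t 1
    & continuous f^`(2)].

Definition regular_C2_curve (g : R -> R * R) : Prop :=
  [/\ C2 (fst \o g), C2 (snd \o g)
    & forall t, ((fst \o g)^`() t, (snd \o g)^`() t) != (0, 0)].

(* [g], of some period [l], runs exactly once per period through [boundary K];
   since [g] is C2 on the whole line, the curve closes up in a C2 way. *)
Definition C2_boundary_param K (g : R -> R * R) : Prop :=
  regular_C2_curve g /\
  exists l : R, [/\ 0 < l,
    forall t, g (t + l) = g t,
    forall s t, 0 <= s < l -> 0 <= t < l -> g s = g t -> s = t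
  & range g = boundary K].

(* Unsigned curvature |x' y'' - x'' y'| / (x'^2 + y'^2)^(3/2); on the boundary
   of a convex disc the signed curvature has constant sign, nonnegative for
   the counterclockwise orientation. *)
Definition curve_curvature (g : R -> R * R) (t : R) : R :=
  let x1 := (fst \o g)^`() t in let x2 := (fst \o g)^`(2) t in
  let y1 := (snd \o g)^`() t in let y2 := (snd \o g)^`(2) t in
  `| x1 * y2 - x2 * y1 | / Num.sqrt (x1 ^+ 2 + y1 ^+ 2) ^+ 3.

(* The curvature of [boundary K] at [x], computed in some C2 regular
   parametrization of [boundary K]: the value depends neither on the
   parametrization nor on the parameter chosen for [x].  It is meaningful only
   when such a parametrization exists and [x] is in [boundary K]. *)
Definition curvature K x : R :=
  let g := xget (cst x) [set g | C2_boundary_param K g] in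
  curve_curvature g (xget 0 [set t | g t = x]).

Definition C2plus_boundary K : Prop :=
  (exists g, C2_boundary_param K g) /\
  forall x, boundary K x -> 0 < curvature K x.

(* For a compact [K] with a C2 boundary the curvature is continuous on the
   compact [boundary K], so this infimum is a minimum. *)
Definition min_curvature K : R := inf (curvature K @` boundary K).

Definition r_max K : R := (min_curvature K)^-1.

(* The closed [r]-hyperconvex hull (the whole plane if no disc of radius [r]
   contains [X]). *)
Definition conv_r (r : R) X : set (R * R) :=
  \bigcap_(c in [set c | X `<=` disc r c]) disc r c.

(* The vertices of a disc-polygon [P] of radius [r], i.e. the points of [P]
   where two different circles of radius [r] meet, each of which bounds a disc
   containing [P].  At a relative interior point of an edge of [P] only the
   circle carrying the edge has this property.  A one-point set has that point
   as its only vertex. *)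
Definition vertices (r : R) P : set (R * R) :=
  [set v | P v /\ exists p q, [/\ p != q,
    P `<=` disc r p, P `<=` disc r q, euclid_dist p v = r & euclid_dist q v = r]].

(* The vertex set is finite when [P] is the hull of a finite set; [fset_set]
   of an infinite set is empty. *)
Definition f_0 (r : R) P : nat := #|` fset_set (vertices r P)|.

End plane.

Section sample.
Context {R : realType} {d : measure_display} {T : measurableType d}.

(* Mutual independence: the product rule for every finite subfamily. *)
Definition independent (P : probability T R) (n : nat)
    (X : 'I_n -> {RV P >-> (R * R)%type}) : Prop :=
  forall (J : {set 'I_n}) (B : 'I_n -> set (R * R)),
    (forall i, measurable (B i)) ->
    fine (P (\bigcap_(i in [set` J]) (X i @^-1` B i))) =
      \prod_(i in J) fine (P (X i @^-1` B i)).

Definition uniform_on (K : set (R * R)) (P : probability T R)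
    (x : {RV P >-> (R * R)%type}) : Prop :=
  forall B : set (R * R), measurable B ->
    fine (P (x @^-1` B)) = fine (area (K `&` B)) / fine (area K).

(* The random disc-polygon spanned by the points [X 0, ..., X (n-1)]. *)
Definition disc_polygon (r : R) (P : probability T R) (n : nat)
    (X : 'I_n -> {RV P >-> (R * R)%type}) (w : T) : set (R * R) :=
  conv_r r (range (fun i => X i w)).

End sample.

(* Main.v *)
Require Import Defs.
From HB Require Import structures.
From mathcomp Require Import all_boot all_order all_algebra finmap.
From mathcomp Require Import all_classical all_reals all_analysis.
From mathcomp Require Import measurable_realfun.
From mathcomp Require Import ring lra.

(** By the Efron-Stein inequality ([efron_stein]) the variance of a function of n
    independent points is at most the sum over i of the mean square of the change
    caused by the deletion of the i-th point x_i. For the hyperconvex hull this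
    change is controlled by caps, the parts of K cut off by discs of radius r.
    If the deletion of x_i affects whether x_k is a vertex, then some cap contains
    x_i and x_k and no third point of the sample; and a point of the hull is lost
    only if some cap contains it together with x_i and no other point of the
    sample.

    The caps are uncountably many; they are replaced by cells. Since r > r_M, the
    rolling theorem of Blaschke ([rolling]) puts K inside tangent discs of a
    radius R0 < r and puts tangent discs of a radius rho inside K. Hence a cap of
    height h contains a cell with sides of order sqrt h and h, and is contained in
    another one. With h of order 4^-j and a net of 2^j directions, up to a
    constant, this gives pairs of cells S, S' of probability of order 8^-j such
    that, whenever caps share a point, S is contained in the highest of them and
    S' contains them all, for the same pair ([cap_covering]). So the square of the
    change in the number of vertices is at most the number of pairs k, l and of
    cells for which x_i, x_k, x_l are in S' and all other points avoid S
    ([sqr_vertex_diff_cells]).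

    If m of the indices i, k, l are distinct, such an event has probability at
    most p^m (1 - q)^(n - m), with p = Cp / 8^j and q = q0 / 8^j. The sum over
    i, k, l is bounded independently of n and j, because (1 - q)^n absorbs
    (1 + n p)^3 ([occupancy_cube_le]). Caps of probability below 1/n are lumped
    together at the level J given by 8^J <= n < 8^(J+1), where the condition on S
    is dropped and n p is bounded. The variance is therefore at most a constant
    times the number of cells of level at most J, which is of order 2^J and hence
    of n^(1/3). For the area each event carries the square of the area of S' as
    weight; the same computation bounds it by a multiple of n^-2 per cell, which
    gives n^(1/3) n^-2 = n^(-5/3) in total.

    The functionals of the theorem are not known to be measurable. They agree
    with Borel functions of the sample unless a point falls outside K or two
    points coincide: on the points of K the hull may be defined with rational
    centres only ([conv_rE]), and the vertices are the points that are not in the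
    hull of the others ([f_0E]). Nonnegative functions that agree outside a null
    event have the same variance even if one of them is not measurable
    ([variance_ae_eq]). *)

Set Implicit Arguments.
Unset Strict Implicit.
Unset Printing Implicit Defensive.

Import Order.TTheory GRing.Theory Num.Theory.
Import numFieldNormedType.Exports.

Local Open Scope ring_scope.
Local Open Scope classical_set_scope.

(** * Means, variances and the Efron-Stein inequality *)

Section mean.
Context {R : realType} {d : measure_display} {T : measurableType d}.
Implicit Types (P : probability T R) (f g : T -> R).

Definition bounded_meas f :=
  measurable_fun setT f /\ exists M : R, forall x, `|f x| <= M.

(** The integral as a real number: only bounded functions are averaged. *)
Definition mean P f : R := fine (\int[P]_x (f x)%:E)%E.

Lemma bounded_meas_cst (c : R) : bounded_meas (cst c).
Proof. by split=> //; exists `|c| => x. Qed.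

Lemma bounded_measD f g :
  bounded_meas f -> bounded_meas g -> bounded_meas (fun x => f x + g x).
Proof.
move=> [mf [M hM]] [mg [N hN]]; split; first exact: measurable_funD.
by exists (M + N) => x; rewrite (le_trans (ler_normD _ _))// lerD.
Qed.

Lemma bounded_measM f g :
  bounded_meas f -> bounded_meas g -> bounded_meas (fun x => f x * g x).
Proof.
move=> [mf [M hM]] [mg [N hN]]; split; first exact: measurable_funM.
by exists (M * N) => x; rewrite normrM ler_pM.
Qed.

Lemma bounded_measB f g :
  bounded_meas f -> bounded_meas g -> bounded_meas (fun x => f x - g x).
Proof.
move=> [mf [M hM]] [mg [N hN]]; split; first exact: measurable_funB.
by exists (M + N) => x; rewrite (le_trans (ler_normB _ _))// lerD.
Qed.

Lemma bounded_meas_sqr f :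
  bounded_meas f -> bounded_meas (fun x => f x ^+ 2).
Proof. by move=> bf; exact: (bounded_measM bf bf). Qed.

Lemma bounded_meas_sum (I : Type) (s : seq I) (p : pred I) (F : I -> T -> R) :
  (forall i, bounded_meas (F i)) ->
  bounded_meas (fun x => \sum_(i <- s | p i) F i x).
Proof.
move=> bF; elim: s => [|i s IH].
  by under eq_fun do rewrite big_nil; exact: bounded_meas_cst.
under eq_fun do rewrite big_cons.
by case: (p i) => //; exact: bounded_measD.
Qed.

Lemma bounded_meas_indic (A : set T) :
  measurable A -> bounded_meas (\1_A : T -> R).
Proof.
move=> mA; split; first exact: measurable_indic.
by exists 1 => x; rewrite indicE ger0_norm ?ler0n// lern1 leq_b1.
Qed.

Lemma bounded_meas_integrable P f :
  bounded_meas f -> P.-integrable setT (EFin \o f).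
Proof.
move=> [mf [M hM]]; apply: measurable_bounded_integrable => //.
  by rewrite -ge0_fin_numE ?fin_num_measure.
by exists M; split => [|x Mx y _ /=]; [exact: num_real|rewrite (le_trans (hM y))// ltW].
Qed.

Lemma meanE P f : bounded_meas f -> (mean P f)%:E = (\int[P]_x (f x)%:E)%E.
Proof.
by move=> bf; rewrite fineK//; exact/integrable_fin_num/bounded_meas_integrable.
Qed.

Lemma mean_cst P (c : R) : mean P (fun=> c) = c.
Proof.
by rewrite /mean integral_cst//= probability_setT mule1.
Qed.

Lemma meanD P f g : bounded_meas f -> bounded_meas g ->
  mean P (fun x => f x + g x) = mean P f + mean P g.
Proof.
move=> bf bg; apply: EFin_inj; rewrite EFinD !meanE//; last exact: bounded_measD.
by rewrite -integralD_EFin//; exact: bounded_meas_integrable.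
Qed.

Lemma meanB P f g : bounded_meas f -> bounded_meas g ->
  mean P (fun x => f x - g x) = mean P f - mean P g.
Proof.
move=> bf bg; apply: EFin_inj; rewrite EFinB !meanE//; last exact: bounded_measB.
by rewrite -integralB_EFin//; exact: bounded_meas_integrable.
Qed.

Lemma meanZ P c f : bounded_meas f -> mean P (fun x => c * f x) = c * mean P f.
Proof.
move=> bf; apply: EFin_inj; rewrite EFinM !meanE//.
  by rewrite -integralZl//; exact: bounded_meas_integrable.
by apply: bounded_measM => //; exact: bounded_meas_cst.
Qed.

Lemma mean_sum P (I : Type) (s : seq I) (p : pred I) (F : I -> T -> R) :
  (forall i, bounded_meas (F i)) ->
  mean P (fun x => \sum_(i <- s | p i) F i x) = \sum_(i <- s | p i) mean P (F i).
Proof.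
move=> bF; elim: s => [|i s IH].
  by under eq_fun do rewrite big_nil; rewrite big_nil mean_cst.
under eq_fun do rewrite big_cons; rewrite big_cons.
by case: (p i) => //; rewrite meanD ?IH//; exact: bounded_meas_sum.
Qed.

Lemma mean_le P f g : bounded_meas f -> bounded_meas g ->
  (forall x, f x <= g x) -> mean P f <= mean P g.
Proof.
move=> bf bg fg; rewrite -lee_fin !meanE//; apply: le_integral => //.
- exact: bounded_meas_integrable.
- exact: bounded_meas_integrable.
- by move=> x _; rewrite lee_fin.
Qed.

Lemma mean_ge0 P f : (forall x, 0 <= f x) -> 0 <= mean P f.
Proof.
by move=> f0; rewrite /mean fine_ge0// integral_ge0// => x _; rewrite lee_fin.
Qed.

Lemma mean_indic P (A : set T) : measurable A -> mean P (\1_A) = fine (P A).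
Proof. by move=> mA; rewrite /mean integral_indic// setIT. Qed.

Definition var P f : R := mean P (fun x => (f x - mean P f) ^+ 2).

Lemma mean_sqr_shift P f c : bounded_meas f ->
  mean P (fun x => (f x - c) ^+ 2) = var P f + (mean P f - c) ^+ 2.
Proof.
move=> bf; rewrite /var; set m := mean P f.
have bc (k : R) : bounded_meas (fun=> k) by exact: bounded_meas_cst.
have bsq : bounded_meas (fun x => (f x - m) ^+ 2).
  by apply: bounded_meas_sqr; exact: bounded_measB.
have -> : (fun x => (f x - c) ^+ 2) = (fun x => ((f x - m) ^+ 2 +
     2 * (m - c) * (f x - m)) + (m - c) ^+ 2).
  by apply/funext => x; ring.
rewrite meanD//; last first.
  by apply: bounded_measD => //; apply: bounded_measM => //; exact: bounded_measB.
rewrite mean_cst meanD//; last first.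
  by apply: bounded_measM => //; exact: bounded_measB.
rewrite meanZ; last exact: bounded_measB.
by rewrite meanB// mean_cst subrr mulr0 addr0.
Qed.

Lemma var_ge0 P f : 0 <= var P f.
Proof. by apply: mean_ge0 => x; exact: sqr_ge0. Qed.

Lemma var_le_mean_sqr P f c : bounded_meas f ->
  var P f <= mean P (fun x => (f x - c) ^+ 2).
Proof. by move=> bf; rewrite mean_sqr_shift// lerDl sqr_ge0. Qed.

Lemma sqr_mean_le P f : bounded_meas f ->
  mean P f ^+ 2 <= mean P (fun x => f x ^+ 2).
Proof.
move=> bf; have := mean_sqr_shift P 0 bf; rewrite subr0.
by under eq_fun do rewrite subr0; move=> ->; rewrite lerDr var_ge0.
Qed.

End mean.

Lemma bounded_meas_comp {R : realType} d1 d2 (T1 : measurableType d1)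
    (T2 : measurableType d2) (phi : T1 -> T2) (f : T2 -> R) :
  measurable_fun setT phi -> bounded_meas f -> bounded_meas (f \o phi).
Proof.
move=> mphi [mf [M hM]]; split; first exact: measurableT_comp.
by exists M => x; exact: hM.
Qed.

Section product.
Context {R : realType} {d1 d2 : measure_display}.
Context {T1 : measurableType d1} {T2 : measurableType d2}.
Variables (P1 : probability T1 R) (P2 : probability T2 R).
Implicit Type f : T1 * T2 -> R.

Let normr_mean d (T : measurableType d) (P : probability T R) (f : T -> R) M :
  bounded_meas f -> (forall x, `|f x| <= M) -> `|mean P f| <= M.
Proof.
move=> bf hM; rewrite ler_norml; apply/andP; split.
  rewrite -(mean_cst P (- M)); apply: mean_le => //; first exact: bounded_meas_cst.
  by move=> x; have := hM x; rewrite ler_norml => /andP[].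
rewrite -[leRHS](mean_cst P); apply: mean_le => //; first exact: bounded_meas_cst.
by move=> x; have := hM x; rewrite ler_norml => /andP[].
Qed.

Lemma bounded_meas_section1 f x : bounded_meas f -> bounded_meas (fun y => f (x, y)).
Proof.
move=> [mf [M hM]]; split; last by exists M => y; exact: hM.
by apply: (measurableT_comp mf); exact: measurable_pair1.
Qed.

Lemma bounded_meas_section2 f y : bounded_meas f -> bounded_meas (fun x => f (x, y)).
Proof.
move=> [mf [M hM]]; split; last by exists M => x; exact: hM.
by apply: (measurableT_comp mf); exact: measurable_pair2.
Qed.

Lemma bounded_meas_mean1 f : bounded_meas f ->
  bounded_meas (fun x => mean P2 (fun y => f (x, y))).
Proof.
move=> bf; split.
  apply/measurable_EFinP; rewrite [X in measurable_fun _ X](_ : _ = fubini_F P2 (EFin \o f)).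
    by apply: (@measurable_fubini_F _ _ _ _ _ P1); exact: bounded_meas_integrable.
  by apply/funext => x /=; rewrite meanE//; exact: bounded_meas_section1.
case: bf => mf [M hM]; exists M => x; apply: normr_mean; last by move=> y; exact: hM.
by apply: bounded_meas_section1; split => //; exists M.
Qed.

Lemma bounded_meas_mean2 f : bounded_meas f ->
  bounded_meas (fun y => mean P1 (fun x => f (x, y))).
Proof.
move=> bf; split.
  apply/measurable_EFinP; rewrite [X in measurable_fun _ X](_ : _ = fubini_G P1 (EFin \o f)).
    by apply: (@measurable_fubini_G _ _ _ _ _ _ P2); exact: bounded_meas_integrable.
  by apply/funext => y /=; rewrite meanE//; exact: bounded_meas_section2.
case: bf => mf [M hM]; exists M => x; apply: normr_mean; last by move=> y; exact: hM.
by apply: bounded_meas_section2; split => //; exists M.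
Qed.

Lemma mean_prod1 f : bounded_meas f ->
  mean (P1 \x P2)%E f = mean P1 (fun x => mean P2 (fun y => f (x, y))).
Proof.
move=> bf; apply: EFin_inj; rewrite [RHS]meanE; last exact: bounded_meas_mean1.
rewrite meanE// -(@integral12_prod_meas1 _ _ _ _ _ P1 P2 (EFin \o f)).
  by apply: eq_integral => x _; rewrite meanE//; exact: bounded_meas_section1.
exact: bounded_meas_integrable.
Qed.

Lemma mean_prod2 f : bounded_meas f ->
  mean (P1 \x P2)%E f = mean P2 (fun y => mean P1 (fun x => f (x, y))).
Proof.
move=> bf; apply: EFin_inj; rewrite [RHS]meanE; last exact: bounded_meas_mean2.
rewrite meanE// -(@integral21_prod_meas1 _ _ _ _ _ P1 P2 (EFin \o f)).
  by apply: eq_integral => x _; rewrite meanE//; exact: bounded_meas_section2.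
exact: bounded_meas_integrable.
Qed.

(** Write h for the average of f over the second coordinate. The variance
    splits orthogonally into the mean square of f - h and the variance of h;
    the second part is that of the average over y of f(x, y) - E f(_, y), so by
    Jensen it is at most the average over y of the variances in x. *)
Lemma var_prod_le f : bounded_meas f ->
  var (P1 \x P2)%E f <= mean P1 (fun x => var P2 (fun y => f (x, y)))
                     + mean P2 (fun y => var P1 (fun x => f (x, y))).
Proof.
move=> bf; set m := mean (P1 \x P2)%E f.
set h := fun x => mean P2 (fun y => f (x, y)).
set M := fun y => mean P1 (fun x => f (x, y)).
have bh : bounded_meas h by exact: bounded_meas_mean1.
have bM : bounded_meas M by exact: bounded_meas_mean2.
have bc d (T : measurableType d) (k : R) : bounded_meas (fun _ : T => k).
  exact: bounded_meas_cst.
have bfM : bounded_meas (fun z => f z - M z.2).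
  apply: bounded_measB => //.
  by apply: (@bounded_meas_comp _ _ _ _ _ (@snd T1 T2) M).
have bfh : bounded_meas (fun z => f z - h z.1).
  apply: bounded_measB => //.
  by apply: (@bounded_meas_comp _ _ _ _ _ (@fst T1 T2) h).
have bfm : bounded_meas (fun z => (f z - m) ^+ 2).
  by apply: bounded_meas_sqr; exact: bounded_measB.
have bvar1 : bounded_meas (fun x => var P2 (fun y => f (x, y))).
  exact: (bounded_meas_mean1 (bounded_meas_sqr bfh)).
rewrite /var -/m mean_prod1//.
under eq_fun do rewrite (mean_sqr_shift _ _ (bounded_meas_section1 _ bf)).
rewrite meanD//; last by apply: bounded_meas_sqr; exact: bounded_measB.
rewrite lerD2l.
have := mean_prod2 (bounded_meas_sqr bfM); rewrite /= => <-.
rewrite mean_prod1; last exact: bounded_meas_sqr.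
apply: mean_le; first by apply: bounded_meas_sqr; exact: bounded_measB.
  exact: (bounded_meas_mean1 (bounded_meas_sqr bfM)).
move=> x /=; rewrite (_ : _ - m = mean P2 (fun y => f (x, y) - M y)).
  apply: sqr_mean_le; apply: bounded_measB => //; exact: bounded_meas_section1.
rewrite meanB//; last exact: bounded_meas_section1.
by congr (_ - _); rewrite /m mean_prod2.
Qed.

Lemma bounded_meas_var1 f : bounded_meas f ->
  bounded_meas (fun x => var P2 (fun y => f (x, y))).
Proof.
move=> bf; have bh := bounded_meas_mean1 bf.
apply: (bounded_meas_mean1 (f := fun z => (f z - mean P2 (fun y => f (z.1, y))) ^+ 2)).
apply: bounded_meas_sqr; apply: bounded_measB => //.
exact: (bounded_meas_comp (@measurable_fst _ _ T1 T2) bh).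
Qed.

Lemma bounded_meas_var2 f : bounded_meas f ->
  bounded_meas (fun y => var P1 (fun x => f (x, y))).
Proof.
move=> bf; have bh := bounded_meas_mean2 bf.
apply: (bounded_meas_mean2 (f := fun z => (f z - mean P1 (fun x => f (x, z.2))) ^+ 2)).
apply: bounded_meas_sqr; apply: bounded_measB => //.
exact: (bounded_meas_comp (@measurable_snd _ _ T1 T2) bh).
Qed.

(** The variance in x is at most the mean square deviation from any constant,
    and this constant may depend on y. *)
Lemma efron_stein_step f (g : T2 -> R) : bounded_meas f -> bounded_meas g ->
  var (P1 \x P2)%E f <= mean (P1 \x P2)%E (fun z => (f z - g z.2) ^+ 2)
                     + mean P1 (fun x => var P2 (fun y => f (x, y))).
Proof.
move=> bf bg.
have bfg : bounded_meas (fun z : T1 * T2 => (f z - g z.2) ^+ 2).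
  apply: bounded_meas_sqr; apply: bounded_measB => //.
  exact: (bounded_meas_comp (@measurable_snd _ _ T1 T2) bg).
apply: (le_trans (var_prod_le bf)); rewrite addrC lerD2r mean_prod2//.
apply: mean_le; [exact: bounded_meas_var2|exact: (bounded_meas_mean2 bfg)|].
move=> y /=; apply: var_le_mean_sqr; exact: bounded_meas_section2.
Qed.

End product.

Lemma mean_distribution {R : realType} d d' (T : measurableType d)
    (T' : measurableType d') (P : probability T R) (X : {RV P >-> T'}) (f : T' -> R) :
  bounded_meas f -> mean (distribution P X) f = mean P (f \o X).
Proof.
move=> bf; rewrite /mean [in LHS](_ : (fun x => _) = EFin \o f)// integral_distribution//.
  by apply/measurable_EFinP; case: bf.
exact: (bounded_meas_integrable P (bounded_meas_comp (@measurable_funPT _ _ _ _ X) bf)).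
Qed.

Section cylinders.
Context {R : realType} (n : nat).
Local Notation E := (R * R)%type.
Implicit Type B : 'I_n -> set E.

Definition cylinders : set (set (n.-tuple E)) :=
  [set C | exists B, (forall i, measurable (B i)) /\
                     C = [set t | forall i, B i (tnth t i)]].

Lemma measurable_cylinder B : (forall i, measurable (B i)) ->
  measurable [set t : n.-tuple E | forall i, B i (tnth t i)].
Proof.
move=> mB; rewrite (_ : [set _ | _] = \bigcap_(i in [set: 'I_n]) ((@tnth n E)^~ i @^-1` B i)).
  apply: fin_bigcap_measurable => // i _.
  by rewrite -[X in measurable X]setTI; exact: measurable_tnth.
by apply/seteqP; split=> [t h i _|t h i]; exact: h.
Qed.

Lemma measurable_cylinders : @measurable _ (n.-tuple E) = <<s cylinders >>.
Proof.
apply/seteqP; split.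
  apply: smallest_sub; first exact: smallest_sigma_algebra.
  rewrite -bigcup_seq => C [i _ [A mA <-]]; rewrite setTI.
  apply: sub_sigma_algebra; exists (fun j => if j == i then A else setT); split.
    by move=> j; case: ifP.
  apply/seteqP; split=> [t At j|t]; first by have [->|//] := eqVneq j i.
  by move=> /(_ i); rewrite eqxx.
apply: smallest_sub; first exact: sigma_algebra_measurable.
by move=> _ [B [mB ->]]; exact: measurable_cylinder.
Qed.

Lemma cylinders_setI : setI_closed cylinders.
Proof.
move=> _ _ [B [mB ->]] [C [mC ->]]; exists (fun i => B i `&` C i); split.
  by move=> i; exact: measurableI.
apply/seteqP; split=> [t [h1 h2] i|t h]; first by split.
by split=> i; have [] := h i.
Qed.

End cylinders.

Section sample.
Context {R : realType} {d : measure_display} {T : measurableType d}.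
Local Notation E := (R * R)%type.
Variable P : probability T R.

Definition sample n (X : 'I_n -> {RV P >-> E}) (w : T) : n.-tuple E :=
  [tuple X i w | i < n].

Lemma measurable_sample n (X : 'I_n -> {RV P >-> E}) :
  measurable_fun setT (sample X).
Proof.
apply/measurable_fun_tnthP => i; rewrite (_ : _ \o _ = X i)//.
by apply/funext => w; rewrite /= tnth_mktuple.
Qed.

HB.instance Definition _ n (X : 'I_n -> {RV P >-> E}) :=
  isMeasurableFun.Build _ _ _ _ (sample X) (measurable_sample X).

(** Independence tested on the full index set only, where a factor setT frees a
    coordinate: the form that an induction on the family can use. *)
Definition product_rule n (X : 'I_n -> {RV P >-> E}) :=
  forall B : 'I_n -> set E, (forall i, measurable (B i)) ->
    fine (P [set w | forall i, B i (X i w)]) = \prod_i fine (P (X i @^-1` B i)).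

Lemma independent_product_rule n (X : 'I_n -> {RV P >-> E}) :
  independent X -> product_rule X.
Proof.
move=> iX B mB; have := iX [set: 'I_n]%SET B mB; under eq_bigl do rewrite finset.inE; move=> <-.
congr (fine (P _)); apply/seteqP; split=> [w h i _|w h i]; first exact: h.
by apply: h; rewrite /= finset.in_setT.
Qed.

Definition tail n (X : 'I_n.+1 -> {RV P >-> E}) : 'I_n -> {RV P >-> E} :=
  fun i => X (lift ord0 i).

Section head_tail.
Variables (n : nat) (X : 'I_n.+1 -> {RV P >-> E}).
Hypothesis pX : product_rule X.

Let head_tail A (B : 'I_n -> set E) : measurable A -> (forall i, measurable (B i)) ->
  fine (P (X ord0 @^-1` A `&` [set w | forall i, B i (tail X i w)])) =
  fine (P (X ord0 @^-1` A)) * \prod_i fine (P (tail X i @^-1` B i)).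
Proof.
move=> mA mB; pose B' i := if unlift ord0 i is Some j then B j else A.
have /pX : forall i, measurable (B' i).
  by move=> i; rewrite /B'; case: unliftP.
have B0 : B' ord0 = A by rewrite /B' unlift_none.
have Bl i : B' (lift ord0 i) = B i by rewrite /B' liftK.
have -> : \prod_(i < n.+1) fine (P (X i @^-1` B' i)) =
    fine (P (X ord0 @^-1` A)) * \prod_i fine (P (tail X i @^-1` B i)).
  by rewrite big_ord_recl B0; congr (_ * _); apply: eq_bigr => i _; rewrite Bl.
move=> <-; congr (fine (P _)); apply/seteqP; split=> w /=.
  by move=> [Aw Bw] i; rewrite /B'; case: unliftP => [j ->|->//]; exact: Bw.
by move=> h; split => [|i]; [have := h ord0|have := h (lift ord0 i)];
   rewrite /B' ?unlift_none ?liftK.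
Qed.

Lemma product_rule_tail : product_rule (tail X).
Proof.
move=> B mB; have := head_tail measurableT mB.
by rewrite preimage_setT setTI probability_setT mul1r.
Qed.

(** As functions of B both sides are finite measures; they agree on the
    cylinders, which form a generating pi-system. *)
Lemma head_tail_independent A B : measurable A -> measurable B ->
  (P (X ord0 @^-1` A `&` sample (tail X) @^-1` B) =
   P (X ord0 @^-1` A) * P (sample (tail X) @^-1` B))%E.
Proof.
move=> mA mB.
have mA0 : measurable (X ord0 @^-1` A).
  by rewrite -[X in measurable X]setTI; exact: (measurable_funPT (X ord0)).
have fP : P (X ord0 @^-1` A) \is a fin_num by exact: fin_num_measure.
have p0 : (0 <= fine (P (X ord0 @^-1` A)))%R by exact: fine_ge0.
pose restr : {measure set n.-tuple E -> \bar R} :=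
  pushforward (mrestr P mA0) (sample (tail X)).
pose m1 := restr (measurable_sample (tail X)).
pose m2 : {measure set n.-tuple E -> \bar R} :=
  mscale (NngNum p0) (distribution P (sample (tail X))).
suff : m1 B = m2 B.
  by rewrite /m1 /restr /m2 /= /pushforward /mrestr /mscale /= /distribution /pushforward
    fineK// setIC.
apply: (measure_unique (@cylinders R n) (fun=> setT)) => //.
- exact: measurable_cylinders.
- exact: cylinders_setI.
- move=> _; exists (fun=> setT); split => //; apply/seteqP; split => //.
- by rewrite bigcup_const.
- move=> _ [C [mC ->]].
  rewrite /m1 /restr /m2 /= /pushforward /mrestr /mscale /= /distribution /pushforward fineK//.
  have eC : sample (tail X) @^-1` [set t | forall i, C i (tnth t i)] =
            [set w | forall i, C i (tail X i w)].
    by apply/seteqP; split => w h i; have := h i; rewrite tnth_mktuple.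
  have mC' : measurable (sample (tail X) @^-1` [set t | forall i, C i (tnth t i)]).
    rewrite -[X in measurable X]setTI; apply: measurable_sample => //.
    exact: measurable_cylinder.
  rewrite setIC -[LHS]fineK; last by apply: fin_num_measure; exact: measurableI.
  rewrite -[X in (_ * X)%E]fineK; last exact: fin_num_measure.
  rewrite -[X in (X * _)%E]fineK// -EFinM eC head_tail//.
  by rewrite product_rule_tail.
- move=> _; apply: (@le_lt_trans _ _ 1%E); last by rewrite ltry.
  by rewrite /m1 /restr /= /pushforward /mrestr preimage_setT setTI probability_le1.
Qed.

(** Independence makes the joint law of head and tail the product of their
    laws. *)
Lemma mean_head_tail (F : n.+1.-tuple E -> R) : bounded_meas F ->
  mean (distribution P (X ord0) \x distribution P (sample (tail X)))%E
    (fun z => F [tuple of z.1 :: z.2]) = mean P (F \o sample X).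
Proof.
move=> bF.
pose Y (w : T) : E * n.-tuple E := (X ord0 w, sample (tail X) w).
have mY : measurable_fun setT Y.
  by apply/measurable_fun_pairP; split; [exact: (measurable_funPT (X ord0))|exact: measurable_sample].
pose Yf : {RV P >-> (E * n.-tuple E)%type} := HB.pack Y (isMeasurableFun.Build _ _ _ _ Y mY).
have mc : measurable_fun setT (fun z : E * n.-tuple E => [tuple of z.1 :: z.2]).
  exact: (@measurable_cons _ _ (E * n.-tuple E)%type E fst n snd).
have bG := bounded_meas_comp mc bF.
have -> : F \o sample X = (F \o (fun z : E * n.-tuple E => [tuple of z.1 :: z.2])) \o Yf.
  apply/funext => w /=; congr F; apply: eq_from_tnth => i.
  rewrite tnth_mktuple; case: (unliftP ord0 i) => [j ->|->//].
  by rewrite tnthS tnth_mktuple.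
rewrite -mean_distribution//; congr fine.
apply: eq_measure_integral => A mA _.
apply: product_measure_unique => // C D mC mD.
by rewrite -head_tail_independent.
Qed.

End head_tail.

(** Induction on n: [efron_stein_step] charges the first coordinate to its own
    term, with g obtained from G 0 by fixing that coordinate arbitrarily, and
    leaves the average of the variances in the other coordinates. *)
Lemma efron_stein n (X : 'I_n -> {RV P >-> E}) (F : n.-tuple E -> R)
    (G : 'I_n -> n.-tuple E -> R) :
  product_rule X -> bounded_meas F -> (forall i, bounded_meas (G i)) ->
  (forall i t t', (forall j, j != i -> tnth t j = tnth t' j) -> G i t = G i t') ->
  var P (F \o sample X) <=
    \sum_i mean P (fun w => (F (sample X w) - G i (sample X w)) ^+ 2).
Proof.
elim: n => [|n IH] in X F G *.
  move=> _ bF _ _; rewrite big_ord0.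
  apply: (le_trans (var_le_mean_sqr P (F [tuple]) (bounded_meas_comp (measurable_sample X) bF))).
  rewrite -[leRHS](mean_cst P 0) le_eqVlt; apply/orP; left; apply/eqP.
  by congr mean; apply/funext => w /=; rewrite tuple0 subrr expr0n.
move=> pX bF bG Gi.
pose mu : probability E R := distribution P (X ord0).
pose Q : probability (n.-tuple E) R := distribution P (sample (tail X)).
pose cons_ (z : E * n.-tuple E) := [tuple of z.1 :: z.2].
have mc : measurable_fun setT cons_.
  exact: (@measurable_cons _ _ (E * n.-tuple E)%type E fst n snd).
have head_tail H : bounded_meas H ->
    mean P (fun w => H (sample X w)) = mean (mu \x Q)%E (H \o cons_).
  by move=> bH; rewrite -(mean_head_tail pX bH).
have bFc := bounded_meas_comp mc bF.
have bFG i : bounded_meas (fun t => (F t - G i t) ^+ 2).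
  by apply: bounded_meas_sqr; exact: bounded_measB.
have bFm (m : R) : bounded_meas (fun t => (F t - m) ^+ 2).
  by apply: bounded_meas_sqr; apply: bounded_measB => //; exact: bounded_meas_cst.
have -> : var P (F \o sample X) = var (mu \x Q)%E (F \o cons_).
  by rewrite /var (head_tail F bF) (head_tail _ (bFm _)).
pose o : E := (0, 0); pose g y := G ord0 (cons_ (o, y)).
have Gg z : G ord0 (cons_ z) = g z.2.
  apply: Gi => j; case: (unliftP ord0 j) => [k ->|->]; last by rewrite eqxx.
  by rewrite !tnthS.
have bg : bounded_meas g := bounded_meas_section1 o (bounded_meas_comp mc (bG ord0)).
apply: (le_trans (efron_stein_step _ _ bFc bg)).
rewrite big_ord_recl; apply: lerD.
  rewrite (head_tail _ (bFG ord0)) le_eqVlt; apply/orP; left; apply/eqP.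
  by congr mean; apply/funext => z /=; rewrite Gg.
under eq_bigr => i _ do rewrite (head_tail _ (bFG (lift ord0 i)))
  (mean_prod1 _ _ (bounded_meas_comp mc (bFG (lift ord0 i)))).
have bFGm i := bounded_meas_mean1 mu Q (bounded_meas_comp mc (bFG (lift ord0 i))).
rewrite -mean_sum//; apply: mean_le.
- exact: (bounded_meas_var1 mu Q bFc).
- exact: bounded_meas_sum.
move=> x.
pose Fx t := F (cons_ (x, t)); pose Gx i t := G (lift ord0 i) (cons_ (x, t)).
have bFx : bounded_meas Fx := bounded_meas_section1 x bFc.
have bGx i : bounded_meas (Gx i) :=
  bounded_meas_section1 x (bounded_meas_comp mc (bG (lift ord0 i))).
have bFGx i : bounded_meas (fun t => (Fx t - Gx i t) ^+ 2).
  by apply: bounded_meas_sqr; exact: bounded_measB.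
have bFxm (m : R) : bounded_meas (fun t => (Fx t - m) ^+ 2).
  by apply: bounded_meas_sqr; apply: bounded_measB => //; exact: bounded_meas_cst.
have := IH (tail X) Fx Gx (product_rule_tail pX) bFx bGx.
have -> : var P (Fx \o sample (tail X)) = var Q Fx.
  by rewrite /var (mean_distribution _ bFx) (mean_distribution _ (bFxm _)).
under eq_bigr => i _ do rewrite -(mean_distribution (sample (tail X)) (bFGx i)).
apply=> i t t' tt'; apply: Gi => j.
case: (unliftP ord0 j) => [k ->|->//] ki; rewrite !tnthS; apply: tt'.
by apply: contra ki => /eqP ->.
Qed.

End sample.

Section almost_everywhere.
Import HBNNSimple.
Context {R : realType} {d : measure_display} {T : measurableType d}.
Variables (P : probability T R) (N : set T).
Hypotheses (mN : measurable N) (PN : P N = 0%E).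
Local Open Scope ereal_scope.

(** Whether f is measurable or not, its integral is the supremum of those of
    the simple functions below it, and a simple function below f is almost
    everywhere below g. *)
Lemma ge0_integral_ae_eq (f g : T -> \bar R) :
  (forall x, 0 <= f x) -> (forall x, 0 <= g x) -> measurable_fun setT g ->
  (forall x, ~ N x -> f x = g x) -> \int[P]_x f x = \int[P]_x g x.
Proof.
move=> f0 g0 mg fg; apply/eqP; rewrite eq_le; apply/andP; split.
  rewrite ge0_integralTE//; apply: ge_ereal_sup => _ [h /= hf <-].
  rewrite -integralT_nnsfun; apply: ae_ge0_le_integral => //.
  - by move=> x _; rewrite lee_fin.
  - exact/measurable_EFinP.
  - exists N; split => // x /=; apply: contra_notP => /fg <- _; exact: hf.
(* cut off on N, g has the same integral and everywhere lies below f *)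
pose g' := g \_ (~` N).
have mg' : measurable_fun setT g'.
  apply/(measurable_restrictT g) => //; first exact: measurableC.
  exact: measurable_funTS.
have g'0 x : 0 <= g' x by rewrite /g' patchE; case: ifP.
rewrite (_ : \int[P]_x g x = \int[P]_x g' x); last first.
  apply: ge0_ae_eq_integral => //; exists N; split => // x /=.
  by apply: contra_notP => Nx _; rewrite /g' patchE mem_set.
rewrite !ge0_integralTE//; apply: le_ereal_sup => _ [h /= hf <-].
exists h => //= x; apply: (le_trans (hf x)).
rewrite /g' patchE; case: ifPn => [|_]; last exact: f0.
by rewrite inE => /fg ->.
Qed.

(** The functionals of the random hull are only known to agree with Borel
    functions of the sample outside a null event. Nonnegativity lets
    [ge0_integral_ae_eq] transfer the mean and the variance. *)
Lemma variance_ae_eq (f g : T -> R) : (forall x, (0 <= f x)%R) ->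
  (forall x, (0 <= g x)%R) -> bounded_meas g ->
  (forall x, ~ N x -> f x = g x) -> 'V_P[f] = (var P g)%:E.
Proof.
move=> f0 g0 bg fg.
have mEg : measurable_fun setT (EFin \o g) by apply/measurable_EFinP; case: bg.
have Efg : \int[P]_x (f x)%:E = (mean P g)%:E.
  rewrite meanE//; apply: ge0_integral_ae_eq => //.
  by move=> x /fg ->.
have bv : bounded_meas (fun x => (g x - mean P g) ^+ 2)%R.
  by apply: bounded_meas_sqr; apply: bounded_measB => //; exact: bounded_meas_cst.
rewrite /variance unlock /var meanE// unlock.
apply: ge0_integral_ae_eq => //.
- by move=> x; rewrite lee_fin -expr2 sqr_ge0.
- by move=> x; rewrite lee_fin sqr_ge0.
- by apply/measurable_EFinP; case: bv.
- by move=> x Nx; rewrite Efg expr2 -(fg _ Nx).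
Qed.

End almost_everywhere.

(** * Plane geometry of support points *)

Section plane_geometry.
Context {R : realType}.
Local Notation E := (R * R)%type.
Implicit Types (p q u v x y z : E) (K : set E).

(** The scalar product of the displacement from q to p with u: depths below a
    supporting line are of this form. *)
Definition ip p q u : R := (p.1 - q.1) * u.1 + (p.2 - q.2) * u.2.

Definition d2 p q : R := (p.1 - q.1) ^+ 2 + (p.2 - q.2) ^+ 2.

Definition move x (t : R) u : E := (x.1 + t * u.1, x.2 + t * u.2).

Definition unit_vector u := u.1 ^+ 2 + u.2 ^+ 2 = 1.

(** An outer normal comes paired with its point: that a boundary point has
    exactly one is a consequence of smoothness, established in [support_normal]
    and [curve_support]. *)
Definition support K x u :=
  [/\ K x, unit_vector u & forall y, K y -> ip y x u <= 0].

Lemma d2_ge0 p q : 0 <= d2 p q.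
Proof. by rewrite addr_ge0 ?sqr_ge0. Qed.

Lemma d2C p q : d2 p q = d2 q p.
Proof. by rewrite /d2; ring. Qed.

Lemma d2_eq0 p q : d2 p q = 0 -> p = q.
Proof.
rewrite /d2 => h; have := sqr_ge0 (p.1 - q.1); have := sqr_ge0 (p.2 - q.2) => h1 h2.
have /eqP : (p.1 - q.1) ^+ 2 = 0 by lra.
have /eqP : (p.2 - q.2) ^+ 2 = 0 by lra.
by rewrite !sqrf_eq0 !subr_eq0 => /eqP e2 /eqP e1; case: p q e1 e2 {h h1 h2} => a b [c d] /= -> ->.
Qed.

Lemma ip_sqr_le p q u : ip p q u ^+ 2 <= d2 p q * (u.1 ^+ 2 + u.2 ^+ 2).
Proof.
rewrite /ip /d2 -subr_ge0.
rewrite (_ : _ - _ = ((p.1 - q.1) * u.2 - (p.2 - q.2) * u.1) ^+ 2) ?sqr_ge0//.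
by ring.
Qed.

Lemma ip_le p q u (a b : R) : 0 <= a -> 0 <= b ->
  d2 p q <= a ^+ 2 -> u.1 ^+ 2 + u.2 ^+ 2 <= b ^+ 2 -> `|ip p q u| <= a * b.
Proof.
move=> a0 b0 ha hb; rewrite -(@ler_pXn2r _ 2%N) ?nnegrE ?mulr_ge0//.
rewrite real_normK ?num_real// (le_trans (ip_sqr_le _ _ _))// exprMn.
by apply: ler_pM => //; [exact: d2_ge0|rewrite addr_ge0 ?sqr_ge0].
Qed.

Lemma d2_triangle p q x (a b : R) : 0 <= a -> 0 <= b ->
  d2 p q <= a ^+ 2 -> d2 q x <= b ^+ 2 -> d2 p x <= (a + b) ^+ 2.
Proof.
move=> a0 b0 ha hb.
have := @ip_le p q (q.1 - x.1, q.2 - x.2) a b a0 b0 ha hb.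
rewrite ler_norml => /andP[_].
have -> : d2 p x = d2 p q + d2 q x + 2 * ip p q (q.1 - x.1, q.2 - x.2).
  by rewrite /d2 /ip /=; ring.
by move: ha hb; rewrite sqrrD; lra.
Qed.

Lemma unit_vector_dist u v : unit_vector u -> unit_vector v ->
  d2 u v = 2 * (1 - (u.1 * v.1 + u.2 * v.2)).
Proof. by rewrite /unit_vector /d2 => hu hv; lra. Qed.

Lemma continuous_d2 p : continuous (d2 p).
Proof.
move=> y; apply: cvgD; (apply: (@cvg_comp _ _ _ _ (fun s : R => s ^+ 2)); last exact: exprn_continuous);
  apply: cvgB; by [exact: cvg_cst|exact: cvg_fst|exact: cvg_snd].
Qed.

Lemma continuous_ip p u : continuous (fun y => ip y p u).
Proof.
move=> y; apply: cvgD; apply: cvgM; try exact: cvg_cst;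
  apply: cvgB; by [exact: cvg_cst|exact: cvg_fst|exact: cvg_snd].
Qed.

Lemma convex_setE K x y (t : R) : convex_set K -> K x -> K y -> 0 <= t <= 1 ->
  K (move x t (y.1 - x.1, y.2 - x.2)).
Proof.
move=> cK Kx Ky /andP[t0 t1].
have := cK y x (@Itv01 _ t t0 t1); rewrite !inE => /(_ Ky Kx).
suff -> : move x t (y.1 - x.1, y.2 - x.2) =
  (t * y.1 + (1 - t) * x.1, t * y.2 + (1 - t) * x.2) by [].
by rewrite /move /=; congr pair; ring.
Qed.

Lemma exists_farthest K z : compact K -> K !=set0 ->
  exists2 x, K x & forall y, K y -> d2 z y <= d2 z x.
Proof.
move=> cK K0; have [x] := compact_EVT_max K0 cK (continuous_subspaceT (@continuous_d2 z)).
by rewrite inE => Kx h; exists x => // y Ky; apply: h; rewrite inE.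
Qed.

Lemma exists_support K u : compact K -> K !=set0 -> unit_vector u ->
  exists x, support K x u.
Proof.
move=> cK K0 uu.
have [x] := compact_EVT_max K0 cK (continuous_subspaceT (@continuous_ip (0, 0) u)).
rewrite inE => Kx h; exists x; split => // y Ky; have := h y.
by rewrite inE => /(_ Ky); rewrite /ip /=; lra.
Qed.

(** Metric projection: if a point y of K were strictly on the outer side of the
    line through the nearest point p orthogonal to z - p, a small move from p
    towards y would come closer to z. *)
Lemma nearest_support K z : compact K -> convex_set K -> K !=set0 -> ~ K z ->
  exists p u t, [/\ support K p u, 0 < t, z = move p t u &
    forall y, K y -> d2 z p <= d2 z y].
Proof.
move=> cK vK K0 Kz.
have [p] := compact_EVT_min K0 cK (continuous_subspaceT (@continuous_d2 z)).
rewrite inE => Kp hp; have {}hp y : K y -> d2 z p <= d2 z y.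
  by move=> Ky; apply: hp; rewrite inE.
have dp : 0 < d2 z p.
  rewrite lt0r d2_ge0 andbT; apply/eqP => /d2_eq0 zp; by rewrite zp in Kz.
pose t := Num.sqrt (d2 z p); have t0 : 0 < t by rewrite sqrtr_gt0.
have t2 : t ^+ 2 = d2 z p by rewrite sqr_sqrtr ?d2_ge0.
exists p, ((z.1 - p.1) / t, (z.2 - p.2) / t), t; split => //; last first.
  rewrite /move /=; case: (z) => z1 z2 /=.
  by congr pair; rewrite mulrC mulfVK ?gt_eqF//; ring.
split => //.
  rewrite /unit_vector /= !expr_div_n -mulrDl t2 -/(d2 z p) divff//.
  by rewrite gt_eqF.
move=> y Ky; rewrite /ip /= leNgt; apply/negP => h.
pose e := (y.1 - p.1) * (z.1 - p.1) + (y.2 - p.2) * (z.2 - p.2).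
have e0 : 0 < e.
  by move: h; rewrite !mulrA -mulrDl pmulr_lgt0// invr_gt0.
pose s := e / (e + d2 y p); have dyp := d2_ge0 y p.
have ed : 0 < e + d2 y p by lra.
have s0 : 0 < s by rewrite divr_gt0.
have s1 : s <= 1 by rewrite ler_pdivrMr//; lra.
have sd : s * d2 y p <= e.
  rewrite /s mulrAC ler_pdivrMr//; nra.
have s01 : 0 <= s <= 1 by lra.
have := hp _ (convex_setE vK Kp Ky s01).
have -> : d2 z (move p s (y.1 - p.1, y.2 - p.2)) = d2 z p - s * (2 * e - s * d2 y p).
  by rewrite /d2 /move /e /=; ring.
have : 0 < s * (2 * e - s * d2 y p) by rewrite mulr_gt0//; lra.
lra.
Qed.

Lemma interior_move K x u : K° x -> exists2 t : R, 0 < t & K (move x t u).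
Proof.
move=> /nbhs_ballP[e /= e0 he].
pose M : R := `|u.1| + `|u.2| + 1.
have M0 : 0 < M by rewrite ltr_wpDl// addr_ge0.
have t0 : 0 < e / M by rewrite divr_gt0.
have small (a b : R) : `|b| < M -> ball a e (a + e / M * b).
  move=> bM; rewrite /ball /= opprD addNKr normrN normrM gtr0_norm//.
  by rewrite mulrAC ltr_pdivrMr// ltr_pM2l.
exists (e / M) => //; apply: he; split; apply: small; rewrite /M.
  by rewrite -addrA ltrDl ltr_wpDl.
by rewrite addrAC addrC ltrDl ltr_wpDl.
Qed.

Lemma support_not_interior K x u : support K x u -> ~ K° x.
Proof.
move=> [_ uu h] /(interior_move u)[t t0 /h]; apply/negP; rewrite -ltNge.
rewrite /ip /move /=; move: uu; rewrite /unit_vector => uu.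
by have -> : (x.1 + t * u.1 - x.1) * u.1 + (x.2 + t * u.2 - x.2) * u.2 = t by nra.
Qed.

Lemma interior_disc K x : K° x ->
  exists2 e : R, 0 < e & forall y, d2 x y <= e ^+ 2 -> K y.
Proof.
move=> /nbhs_ballP[e /= e0 he]; exists (e / 2); first by rewrite divr_gt0.
move=> y; rewrite /d2 => h; apply: he.
have e2 : 0 < e / 2 by rewrite divr_gt0.
have half (a : R) : a ^+ 2 <= (e / 2) ^+ 2 -> `|a| < e.
  move=> ha; rewrite (@le_lt_trans _ _ (e / 2))//; last lra.
  by rewrite -(@ler_pXn2r _ 2%N) ?nnegrE ?real_normK ?num_real// ltW.
have := sqr_ge0 (x.1 - y.1); have := sqr_ge0 (x.2 - y.2) => h1 h2.
by split => /=; apply: half; lra.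
Qed.

(** Points of the boundary are limits of support points: project nearby points
    of the complement. *)
Lemma boundary_near_support K x (e : R) : compact K -> convex_set K ->
  K x -> ~ K° x -> 0 < e ->
  exists p u, support K p u /\ d2 x p <= e ^+ 2.
Proof.
move=> cK vK Kx Kix e0.
have [z Kz zx] : exists2 z, ~ K z & d2 x z <= (e / 2) ^+ 2.
  apply: contrapT => h; apply: Kix; apply/nbhs_ballP; exists (e / 4) => /=.
    by rewrite divr_gt0.
  move=> z [/= h1 h2]; apply: contrapT => Kz; apply: h; exists z => //.
  rewrite /d2.
  have sq (a : R) : `|a| < e / 4 -> a ^+ 2 <= (e / 4) ^+ 2.
    by move=> /ltW; rewrite -(@ler_pXn2r _ 2%N) ?nnegrE ?real_normK ?num_real//; lra.
  by have := sq _ h1; have := sq _ h2; have := sqr_ge0 e; nra.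
have [p [u [t [sp _ _ zp]]]] := nearest_support cK vK (ex_intro _ x Kx) Kz.
exists p, u; split => //; have e2 : 0 <= e / 2 by lra.
have := d2_triangle e2 e2 zx (le_trans (zp _ Kx) _).
by rewrite -splitr; apply; rewrite d2C.
Qed.

End plane_geometry.

(** * Calculus in one variable *)

Section calculus.
Context {R : realType}.
Implicit Types (f g df dg : R -> R) (t a b l : R).

Lemma is_derive_add f g t a b : is_derive t 1 f a -> is_derive t 1 g b ->
  is_derive t 1 (fun s => f s + g s) (a + b).
Proof. by move=> df dg; exact: (is_deriveD df dg). Qed.

Lemma is_derive_sub f g t a b : is_derive t 1 f a -> is_derive t 1 g b ->
  is_derive t 1 (fun s => f s - g s) (a - b).
Proof. by move=> df dg; exact: (is_deriveB df dg). Qed.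

Lemma is_derive_mul f g t a b : is_derive t 1 f a -> is_derive t 1 g b ->
  is_derive t 1 (fun s => f s * g s) (f t * b + g t * a).
Proof. by move=> df dg; exact: (is_deriveM df dg). Qed.

Lemma is_derive_const t (c : R) : is_derive t 1 (fun=> c) 0.
Proof. exact: is_derive_cst. Qed.

Lemma is_derive_scale f t a (c : R) : is_derive t 1 f a ->
  is_derive t 1 (fun s => c * f s) (c * a).
Proof.
move=> df; have := is_derive_mul (is_derive_const t c) df.
by rewrite mulr0 addr0.
Qed.

Lemma is_derive_inv f t a : f t != 0 -> is_derive t 1 f a ->
  is_derive t 1 (fun s => (f s)^-1) (- (f t) ^- 2 * a).
Proof. by move=> f0 df; exact: (is_deriveV f0 df). Qed.

Lemma is_derive_sqrt f t a : 0 < f t -> is_derive t 1 f a ->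
  is_derive t 1 (fun s => Num.sqrt (f s)) ((2 * Num.sqrt (f t))^-1 * a).
Proof. by move=> f0 df; exact: (is_derive1_comp (is_derive1_sqrt f0) df). Qed.

Lemma is_derive_all_continuous f df : (forall t : R, is_derive t 1 f (df t)) -> continuous f.
Proof.
by move=> hf t; apply: differentiable_continuous; apply/derivable1_diffP; case: (hf t).
Qed.

Lemma is_derive_global_max f df t : (forall s : R, is_derive s 1 f (df s)) ->
  (forall s, f s <= f t) -> df t = 0.
Proof.
move=> hf ft; have tI : t \in `]t - 1, t + 1[%R by rewrite in_itv/=; lra.
have [_ <-] := hf t; have le : t - 1 <= t + 1 by lra.
by case: (derive1_at_max le (fun s _ => ex_derive (is_derive := hf s)) tI (fun s _ => ft s)).
Qed.

(** Second-order test written for a derivative that factors through a positive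
    weight, since the weight itself need not be differentiable. *)
Lemma not_max_of_increasing_derivative f df k psi t (p : R) :
  (forall s : R, is_derive s 1 f (df s)) -> (forall s, df s = k s * psi s) ->
  (forall s, 0 < k s) -> psi t = 0 -> is_derive t 1 psi p -> 0 < p ->
  exists s, f t < f s.
Proof.
move=> hf dfE k0 psit [/cvg_ex [q hq] dp] p0.
have qp : q = p by rewrite -dp; apply/esym/cvg_lim.
have : \forall h \near 0^', 0 < h^-1 *: (psi (h *: 1 + t) - psi t).
  rewrite {}qp in hq; exact: (cvgr_gt _ hq).
rewrite near_withinE => /nbhs_ballP[e /= e0 he].
have psi0 h : 0 < h < e -> 0 < psi (t + h).
  move=> /andP[h0 hlt]; have := he h.
  rewrite /ball /= sub0r normrN gtr0_norm// => /(_ hlt (lt0r_neq0 h0)).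
  by rewrite psit subr0 /GRing.scale /= mulr1 addrC pmulr_rgt0// invr_gt0.
exists (t + e / 2); have te : t < t + e / 2 by lra.
have [c + cE] := MVT te (fun s _ => hf s)
  (continuous_subspaceT (is_derive_all_continuous hf)).
rewrite in_itv/= => /andP[c1 c2]; rewrite -subr_gt0 cE dfE.
have -> : c = t + (c - t) by ring.
by rewrite !mulr_gt0// ?k0// ?psi0//; lra.
Qed.

Lemma periodic_intmul (U : Type) (f : R -> U) l (z : int) t :
  (forall s, f (s + l) = f s) -> f (t + z%:~R * l) = f t.
Proof.
move=> fl; have fn n s : f (s + n%:R * l) = f s.
  by elim: n => [|n IH]; rewrite ?mul0r ?addr0// -natr1 mulrDl mul1r addrA fl.
case: z => n; first by rewrite -pmulrn fn.
by rewrite NegzE mulrNz -(fn n.+1) mulNr subrK.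
Qed.

Lemma periodic_repr l t : 0 < l -> exists z : int, 0 <= t + z%:~R * l < l.
Proof.
move=> l0; exists (- Num.floor (t / l)); have := Num.Theory.floor_le_tmp (t / l).
have := Num.Theory.floorD1_gt (t / l).
rewrite ltr_pdivrMr// intrD => h1; rewrite ler_pdivlMr// => h2.
by rewrite mulrNz mulNr; lra.
Qed.

Lemma periodic_has_max f l : 0 < l -> (forall s, f (s + l) = f s) -> continuous f ->
  exists t, forall s, f s <= f t.
Proof.
move=> l0 fl cf; have [c _ hc] := EVT_max (ltW l0) (continuous_subspaceT cf).
exists c => s; have [z zs] := periodic_repr s l0.
by rewrite -(periodic_intmul z s fl); apply: hc; rewrite in_itv/=; lra.
Qed.

Lemma nonvanishing_constant_sign f : continuous f -> (forall s, f s != 0) ->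
  exists2 sg : R, sg ^+ 2 = 1 & forall s, sg * f s = `|f s|.
Proof.
move=> cf f0.
have same s t : 0 < f s -> 0 < f t.
  move=> fs; rewrite ltNge; apply/negP => ft.
  have [st|ts] := leP s t.
    have [|c _ /eqP] := @IVT R f s t 0 st (continuous_subspaceT cf).
      by rewrite ge_min le_max ft (ltW fs) orbT.
    exact/negP.
  have [|c _ /eqP] := @IVT R f t s 0 (ltW ts) (continuous_subspaceT cf).
    by rewrite ge_min le_max ft (ltW fs) orbT.
  exact/negP.
have [h|h] := ltP 0 (f 0).
  exists 1; first by rewrite expr1n.
  by move=> s; rewrite mul1r gtr0_norm// (same 0).
exists (-1); first by rewrite sqrrN expr1n.
move=> s; rewrite mulN1r ler0_norm// leNgt; apply/negP => /(same s 0).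
by rewrite ltNge h.
Qed.

End calculus.

Lemma continuous_pair {R : realType} (f g : R -> R) : continuous f -> continuous g ->
  continuous (fun s : R => (f s, g s)).
Proof.
move=> cf cg s; apply/cvg_ballP => e e0.
have h1 := cvg_ball (cf s) e0; have h2 := cvg_ball (cg s) e0.
near=> t; split; by [near: t; exact: h1|near: t; exact: h2].
Unshelve. all: by end_near. Qed.

(** * Rolling discs along a framed curve *)

Section framed_curve.
Context {R : realType}.
Local Notation E := (R * R)%type.
(** A closed curve (c1, c2) with velocity v, acceleration a and outer unit normal
    n. The normal turns at the rate k v, where k is the curvature (Rodrigues), so
    that nothing depends on the speed of the parametrization. The hypotheses on
    R0, rho and k say that the radius of curvature lies between rho and R0. *)
Variables (K : set E) (c1 c2 v1 v2 a1 a2 n1 n2 k : R -> R) (l R0 rho : R) (z0 : E).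
Hypotheses (cK : compact K) (vK : convex_set K).
Hypotheses (hc1 : forall t : R, is_derive t 1 c1 (v1 t))
  (hc2 : forall t : R, is_derive t 1 c2 (v2 t))
  (hv1 : forall t : R, is_derive t 1 v1 (a1 t))
  (hv2 : forall t : R, is_derive t 1 v2 (a2 t))
  (hn1 : forall t : R, is_derive t 1 n1 (k t * v1 t))
  (hn2 : forall t : R, is_derive t 1 n2 (k t * v2 t)).
Hypotheses (n_unit : forall t, n1 t ^+ 2 + n2 t ^+ 2 = 1)
  (nv : forall t, n1 t * v1 t + n2 t * v2 t = 0)
  (na : forall t, n1 t * a1 t + n2 t * a2 t = - (k t * (v1 t ^+ 2 + v2 t ^+ 2)))
  (v_gt0 : forall t, 0 < v1 t ^+ 2 + v2 t ^+ 2).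
Hypotheses (l0 : 0 < l) (c1l : forall t, c1 (t + l) = c1 t)
  (c2l : forall t, c2 (t + l) = c2 t)
  (n1l : forall t, n1 (t + l) = n1 t) (n2l : forall t, n2 (t + l) = n2 t).

Let curve t : E := (c1 t, c2 t).
Let normal t : E := (n1 t, n2 t).

Hypothesis curve_inj :
  forall s t : R, 0 <= s < l -> 0 <= t < l -> curve s = curve t -> s = t.
Hypothesis curve_bdry : forall x, (K x /\ ~ K° x) <-> exists t, curve t = x.
Hypotheses (R0_gt0 : 0 < R0) (k_gt : forall t, 1 < R0 * k t).
Hypotheses (rho_gt0 : 0 < rho) (k_lt : forall t, rho * k t < 1).
Hypothesis ball_in : forall y, d2 z0 y <= rho ^+ 2 -> K y.

Let k0 t : 0 < k t.
Proof. by have := k_gt t; rewrite -(pmulr_rgt0 _ R0_gt0); lra. Qed.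

Let Kcurve t : K (curve t).
Proof. by have [] : K (curve t) /\ ~ K° (curve t) by apply/curve_bdry; exists t. Qed.

(** A vector orthogonal to the velocity is a multiple of the normal. *)
Let perp t (w1 w2 : R) : w1 * v1 t + w2 * v2 t = 0 ->
  w1 = (w1 * n1 t + w2 * n2 t) * n1 t /\ w2 = (w1 * n1 t + w2 * n2 t) * n2 t.
Proof.
move=> wv; have := nv t; have := n_unit t; have := v_gt0 t.
move: (v1 t) (v2 t) (n1 t) (n2 t) wv => p q a b wv v0 ab abv.
have h1 : (w1 * b - w2 * a) * p = 0.
  rewrite (_ : _ * p = b * (w1 * p + w2 * q) - w2 * (a * p + b * q)); last by ring.
  by rewrite wv abv !mulr0 subr0.
have h2 : (w1 * b - w2 * a) * q = 0.
  rewrite (_ : _ * q = w1 * (a * p + b * q) - a * (w1 * p + w2 * q)); last by ring.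
  by rewrite wv abv !mulr0 subr0.
have h : w1 * b - w2 * a = 0.
  have : (w1 * b - w2 * a) * (p ^+ 2 + q ^+ 2) = 0.
    by rewrite mulrDr !expr2 !mulrA h1 h2 !mul0r addr0.
  by move=> /eqP; rewrite mulf_eq0 (gt_eqF v0) orbF => /eqP.
split; apply/eqP; rewrite -subr_eq0; apply/eqP.
  apply: (etrans (y := w1 * (a ^+ 2 + b ^+ 2) - (w1 * a + w2 * b) * a)).
    by rewrite ab mulr1.
  by apply: (etrans (y := b * (w1 * b - w2 * a))); [ring|rewrite h mulr0].
apply: (etrans (y := w2 * (a ^+ 2 + b ^+ 2) - (w1 * a + w2 * b) * b)).
  by rewrite ab mulr1.
by apply: (etrans (y := - a * (w1 * b - w2 * a))); [ring|rewrite h mulr0].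
Qed.

Let is_derive_ip_curve (p u : E) s :
  is_derive s (1 : R) (fun s => ip (curve s) p u) (v1 s * u.1 + v2 s * u.2).
Proof.
have h := is_derive_add
  (is_derive_scale u.1 (is_derive_sub (hc1 s) (is_derive_const s p.1)))
  (is_derive_scale u.2 (is_derive_sub (hc2 s) (is_derive_const s p.2))).
apply: (is_derive_eq (f := fun s => ip (curve s) p u) (f' := u.1 * (v1 s - 0) + u.2 * (v2 s - 0))).
  rewrite [X in is_derive _ _ X](_ : _ = (fun s => u.1 * (c1 s - p.1) + u.2 * (c2 s - p.2)))//.
  by apply/funext => x; rewrite /ip /=; ring.
by ring.
Qed.

(** The first-order condition leaves two candidate normals; the second-order
    condition selects the one with respect to which the curvature is positive. *)
Lemma support_normal t u : support K (curve t) u -> u = normal t.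
Proof.
move=> [_ uu su].
pose f s := ip (curve s) (curve t) u.
have ft s : f s <= f t by rewrite {2}/f /ip !subrr !mul0r addr0; exact: su.
have vu := is_derive_global_max (is_derive_ip_curve (curve t) u) ft.
have [e1 e2] : u.1 = (u.1 * n1 t + u.2 * n2 t) * n1 t /\
               u.2 = (u.1 * n1 t + u.2 * n2 t) * n2 t.
  by apply: perp; rewrite -vu; ring.
set al := u.1 * n1 t + u.2 * n2 t in e1 e2.
have : al ^+ 2 = 1.
  by move: uu; rewrite /unit_vector e1 e2 !exprMn -mulrDr n_unit mulr1.
move=> /eqP; rewrite sqrf_eq1 => /orP[/eqP al1|/eqP alN1].
  by rewrite al1 !mul1r in e1 e2; rewrite /normal -e1 -e2 -surjective_pairing.
exfalso.
have [||s] := @not_max_of_increasing_derivative R f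
  (fun s => v1 s * u.1 + v2 s * u.2) (fun=> 1)
  (fun s => v1 s * u.1 + v2 s * u.2) t (k t * (v1 t ^+ 2 + v2 t ^+ 2))
  (is_derive_ip_curve (curve t) u) (fun s => esym (mul1r _)) (fun=> ltr01) vu.
- have h := is_derive_add (is_derive_scale u.1 (hv1 t)) (is_derive_scale u.2 (hv2 t)).
  rewrite [X in is_derive _ _ X](_ : _ = (fun s => u.1 * v1 s + u.2 * v2 s)); last first.
    by apply/funext => s; ring.
  apply: (is_derive_eq h).
  by rewrite e1 e2 alN1 !mulN1r !mulNr -opprD na opprK.
- by rewrite mulr_gt0.
- by apply/negP; rewrite -leNgt; exact: ft.
Qed.

Let curve_shift (z : int) t : curve (t + z%:~R * l) = curve t.
Proof. by congr pair; exact: periodic_intmul. Qed.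

Let normal_shift (z : int) t : normal (t + z%:~R * l) = normal t.
Proof. by congr pair; exact: periodic_intmul. Qed.

Let cont_c1 : continuous c1 := is_derive_all_continuous hc1.
Let cont_c2 : continuous c2 := is_derive_all_continuous hc2.
Let cont_n1 : continuous n1 := is_derive_all_continuous hn1.
Let cont_n2 : continuous n2 := is_derive_all_continuous hn2.

(** The parameters in a period at which the normal supports K form a compact
    set, so their image is closed. By [support_normal] it contains all support
    points, which are dense in the boundary; hence it is the whole curve. *)
Lemma curve_support t : support K (curve t) (normal t).
Proof.
pose D := `[0, l] `&` [set t | forall y, K y -> ip y (curve t) (normal t) <= 0].
have clD : closed [set t | forall y, K y -> ip y (curve t) (normal t) <= 0].
  rewrite (_ : [set t | _] = \bigcap_(y in K)
     ((fun t => ip y (curve t) (normal t)) @^-1` [set z | z <= 0])); last first.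
    by apply/seteqP; split => s h y; exact: h.
  apply: closed_bigI => y _; apply: preimage_closed; last exact: closed_le.
  move=> s _; apply: cvgD; apply: cvgM; try exact: cont_n1; try exact: cont_n2;
    apply: cvgB; by [exact: cvg_cst|exact: cont_c1|exact: cont_c2].
have cD : compact D by apply: compact_closedI => //; exact: segment_compact.
have ccurve : continuous curve := continuous_pair cont_c1 cont_c2.
have cE : compact (curve @` D).
  by apply: continuous_compact => //; exact: continuous_subspaceT.
have clE : closed (curve @` D) by apply: compact_closed => //; exact: norm_hausdorff.
have [t' [_ Dt'] ett'] : (curve @` D) (curve t).
  apply: clE => A /nbhs_ballP[e /= e0 he].
  have [Kt Kit] : K (curve t) /\ ~ K° (curve t) by apply/curve_bdry; exists t.
  have e2 : 0 < e / 2 by lra.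
  have [p [u [spu dp]]] := boundary_near_support cK vK Kt Kit e2.
  have [s es] : exists s, curve s = p.
    by apply/curve_bdry; split; [case: spu|exact: support_not_interior spu].
  have us : u = normal s by apply: support_normal; rewrite es.
  have [z zs] := periodic_repr s l0.
  exists p; split; last first.
    apply: he; move: dp; rewrite /d2 => dp.
    have half (a : R) : a ^+ 2 <= (e / 2) ^+ 2 -> `|a| < e.
      move=> ha; rewrite (@le_lt_trans _ _ (e / 2))//; last lra.
      by rewrite -(@ler_pXn2r _ 2%N) ?nnegrE ?real_normK ?num_real// ltW.
    have := sqr_ge0 ((curve t).1 - p.1); have := sqr_ge0 ((curve t).2 - p.2) => h1 h2.
    by split; rewrite /ball /=; apply: half; move: h1 h2 dp => /=; lra.
  exists (s + z%:~R * l); last by rewrite curve_shift.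
  split; first by rewrite /= in_itv/=; lra.
  by rewrite /= curve_shift normal_shift es -us; case: spu.
have [z zs] := periodic_repr t l0; have [z' zs'] := periodic_repr t' l0.
have e : t' + z'%:~R * l = t + z%:~R * l.
  by apply: curve_inj => //; rewrite !curve_shift.
split; [exact: Kcurve|by rewrite /unit_vector /= n_unit|].
by rewrite -(normal_shift z) -e normal_shift -ett'.
Qed.

(** The outer rolling theorem of Blaschke. The disc of radius R0 tangent at
    curve s contains y iff f s <= 0; maximize f in s. At a maximizer y lies on
    the normal line, and if f were positive it would lie deeper than 2 R0, which
    exceeds the radius of curvature: the second-order test excludes this. *)
Lemma curve_outer_disc t y : K y ->
  d2 y (curve t) <= 2 * R0 * ip (curve t) y (normal t).
Proof.
move=> Ky; rewrite -subr_le0.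
pose f s := d2 y (curve s) - 2 * R0 * ip (curve s) y (normal s).
pose psi s := (y.1 - c1 s) * v1 s + (y.2 - c2 s) * v2 s.
pose df s := 2 * (R0 * k s - 1) * psi s.
have hf (s : R) : is_derive s 1 f (df s).
  have h1 := is_derive_sub (is_derive_const s y.1) (hc1 s).
  have h2 := is_derive_sub (is_derive_const s y.2) (hc2 s).
  have g1 := is_derive_sub (hc1 s) (is_derive_const s y.1).
  have g2 := is_derive_sub (hc2 s) (is_derive_const s y.2).
  have h := is_derive_sub (is_derive_add (is_derive_mul h1 h1) (is_derive_mul h2 h2))
    (is_derive_scale (2 * R0) (is_derive_add (is_derive_mul g1 (hn1 s)) (is_derive_mul g2 (hn2 s)))).
  apply: (is_derive_eq h); rewrite /df /psi !subr0 !sub0r.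
  have -> : (c1 s - y.1) * (k s * v1 s) + n1 s * v1 s +
            ((c2 s - y.2) * (k s * v2 s) + n2 s * v2 s) =
            - k s * ((y.1 - c1 s) * v1 s + (y.2 - c2 s) * v2 s) + (n1 s * v1 s + n2 s * v2 s).
    by ring.
  by rewrite nv; ring.
have fl s : f (s + l) = f s by rewrite /f /d2 /ip /= c1l c2l n1l n2l.
have [s0 hs0] := periodic_has_max l0 fl (is_derive_all_continuous hf).
apply: (le_trans (hs0 t)); rewrite leNgt; apply/negP => fs0.
have kk s : 0 < 2 * (R0 * k s - 1) by have := k_gt s; lra.
have psi0 : psi s0 = 0.
  have := is_derive_global_max hf hs0 => /eqP.
  by rewrite /df mulf_eq0 (gt_eqF (kk _)) => /eqP.
have [e1 e2] := perp psi0.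
have [_ _ /(_ y Ky)] := curve_support s0; rewrite /ip /= => sup.
set m := (y.1 - c1 s0) * n1 s0 + (y.2 - c2 s0) * n2 s0 in e1 e2 sup.
have fm : f s0 = m * (m + 2 * R0).
  rewrite /f /d2 /ip /=.
  have -> : (c1 s0 - y.1) * n1 s0 + (c2 s0 - y.2) * n2 s0 = - m by rewrite /m; ring.
  by rewrite {1}e1 {1}e2 !exprMn -mulrDr n_unit; ring.
have m2 : m + 2 * R0 < 0 by move: fs0; rewrite fm; nra.
have [||s] := @not_max_of_increasing_derivative R f df (fun s => 2 * (R0 * k s - 1))
  psi s0 (- (v1 s0 ^+ 2 + v2 s0 ^+ 2) + (- m) * (k s0 * (v1 s0 ^+ 2 + v2 s0 ^+ 2)))
  hf (fun=> erefl) kk psi0.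
- have h1 := is_derive_sub (is_derive_const s0 y.1) (hc1 s0).
  have h2 := is_derive_sub (is_derive_const s0 y.2) (hc2 s0).
  have h := is_derive_add (is_derive_mul h1 (hv1 s0)) (is_derive_mul h2 (hv2 s0)).
  apply: (is_derive_eq h).
  rewrite mulNr -mulrN -na [X in X * a1 _]e1 [X in X * a2 _]e2; ring.
- have := v_gt0 s0; have := k_gt s0; have := k0 s0; move: m2.
  move: (k s0) (v1 s0 ^+ 2 + v2 s0 ^+ 2) => kk0 V m2 kpos kR V0.
  have : 1 < (- m) * kk0 by nra.
  by nra.
- by apply/negP; rewrite -leNgt; exact: hs0.
Qed.

(** In other words, the disc of radius rho tangent to the curve from inside at
    s stays on the inner side of the supporting line at t. For fixed t the
    worst s is a critical one, and there the two normals are parallel because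
    rho k < 1. *)
Lemma curve_normal_dist s t :
  rho * (1 - (n1 s * n1 t + n2 s * n2 t)) <= ip (curve t) (curve s) (normal t).
Proof.
pose f s := rho * (1 - (n1 s * n1 t + n2 s * n2 t)) + ip (curve s) (curve t) (normal t).
pose df s := (1 - rho * k s) * (v1 s * n1 t + v2 s * n2 t).
have hf (x : R) : is_derive x 1 f (df x).
  have h := is_derive_add (is_derive_scale rho (is_derive_sub (is_derive_const x 1)
    (is_derive_add (is_derive_scale (n1 t) (hn1 x)) (is_derive_scale (n2 t) (hn2 x)))))
    (is_derive_ip_curve (curve t) (normal t) x).
  rewrite [X in is_derive _ _ X](_ : f = (fun s => rho * (1 - (n1 t * n1 s + n2 t * n2 s)) +
    ip (curve s) (curve t) (normal t))); last by apply/funext => z; rewrite /f; ring.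
  by apply: (is_derive_eq h); rewrite /df /=; ring.
have fl x : f (x + l) = f x by rewrite /f /d2 /ip /= c1l c2l n1l n2l.
have [s0 hs0] := periodic_has_max l0 fl (is_derive_all_continuous hf).
suff fs0 : f s0 <= 0.
  by have := le_trans (hs0 s) fs0; rewrite /f /ip /=; lra.
have kk x : 0 < 1 - rho * k x by have := k_lt x; lra.
have vn : n1 t * v1 s0 + n2 t * v2 s0 = 0.
  have := is_derive_global_max hf hs0 => /eqP.
  by rewrite /df mulf_eq0 (gt_eqF (kk _)) => /eqP; rewrite -[RHS]/0 => <-; ring.
have [e1 e2] := perp vn.
rewrite /f; set al := n1 s0 * n1 t + n2 s0 * n2 t.
have eal : n1 t * n1 s0 + n2 t * n2 s0 = al by rewrite /al; ring.
rewrite eal in e1 e2.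
have [_ ut st] := curve_support t; have [_ us ss] := curve_support s0.
have : al ^+ 2 = 1.
  by have := n_unit t; rewrite e1 e2 !exprMn -mulrDr n_unit mulr1.
move=> /eqP; rewrite sqrf_eq1 => /orP[/eqP al1|/eqP alN1].
  by rewrite al1 subrr mulr0 add0r; apply: st; exact: Kcurve.
(* the normals are opposite, so that K lies in a strip as wide as 2 * rho *)
rewrite alN1 in e1 e2 *.
have b1 : K (move z0 rho (normal t)).
  apply: ball_in; rewrite /d2 /move /=.
  rewrite !opprD !addNKr !sqrrN !exprMn -mulrDr.
  by have := n_unit t => ->; rewrite mulr1.
have b2 : K (move z0 (- rho) (normal t)).
  apply: ball_in; rewrite /d2 /move /=.
  rewrite !opprD !addNKr !sqrrN !exprMn -mulrDr sqrrN.
  by have := n_unit t => ->; rewrite mulr1.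
have := ss _ b2; have := st _ b1; rewrite /ip /move /=.
have := n_unit t; rewrite -/(normal t).
have -> : n1 s0 = - n1 t by rewrite e1; ring.
have -> : n2 s0 = - n2 t by rewrite e2; ring.
move: (n1 t) (n2 t) => a b ab.
have rab : rho * (a ^+ 2 + b ^+ 2) = rho by rewrite ab mulr1.
by nra.
Qed.

(** For the inner disc: one of its points outside K would be separated from K
    by the supporting line at its metric projection, which contradicts
    [curve_normal_dist]. *)
Theorem support_rolling x u : support K x u ->
  (forall y, K y -> d2 y x <= 2 * R0 * ip x y u) /\
  (forall y, d2 y x <= 2 * rho * ip x y u -> K y).
Proof.
have on_curve p v : support K p v -> exists2 t, p = curve t & v = normal t.
  move=> sp; have [t et] : exists t, curve t = p.
    by apply/curve_bdry; split; [case: sp|exact: support_not_interior sp].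
  by exists t => //; apply: support_normal; rewrite et.
move=> /on_curve[t -> ->]; split=> [y|y dy]; first exact: curve_outer_disc.
apply: contrapT => Ky.
have [p [v [tau [/on_curve[s -> ->] tau0 yE _]]]] :=
  nearest_support cK vK (ex_intro _ _ (Kcurve t)) Ky.
have dc : d2 y (move (curve t) (- rho) (normal t)) <= rho ^+ 2.
  have -> : d2 y (move (curve t) (- rho) (normal t)) =
     d2 y (curve t) - 2 * rho * ip (curve t) y (normal t) + rho ^+ 2 * (n1 t ^+ 2 + n2 t ^+ 2).
    by rewrite /d2 /ip /move /=; ring.
  by rewrite n_unit mulr1; lra.
have us : (normal s).1 ^+ 2 + (normal s).2 ^+ 2 <= 1 ^+ 2 by rewrite n_unit expr1n.
have := ip_le (ltW rho_gt0) ler01 dc us; rewrite mulr1 ler_norml => /andP[_ h].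
have := curve_normal_dist t s.
have : ip y (curve s) (normal s) = tau.
  rewrite yE /ip /move /= -[RHS]mulr1 -(n_unit s); ring.
move: h; rewrite /ip /move /=; lra.
Qed.

End framed_curve.

(** * Rolling discs from curvature bounds *)

Section rolling.
Context {R : realType}.
Local Notation E := (R * R)%type.
Implicit Types (K : set E) (f : R -> R).

(** The default value used in the definition of the curvature varies with the
    point, the chosen parametrization does not. *)
Lemma xget_irr (U : choiceType) (P : set U) (a b : U) : P !=set0 -> xget a P = xget b P.
Proof. by move=> [x Px]; rewrite /xget; case: pselect => // -[]; exists x; apply/asboolP. Qed.

Lemma periodic_derive1 f (l t : R) : (forall s, f (s + l) = f s) -> f^`() (t + l) = f^`() t.
Proof.
move=> fl; rewrite /derive1; suff -> : (fun h : R => h^-1 *: (f (h + (t + l)) - f (t + l))) =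
  (fun h : R => h^-1 *: (f (h + t) - f t)) by [].
by apply/funext => h; rewrite addrA !fl.
Qed.

Lemma derivable_is_derive f (t : R) : derivable f t 1 -> is_derive t 1 f (f^`() t).
Proof. by move=> df; apply: DeriveDef => //; rewrite derive1E. Qed.

Section curvature.
Variables (K : set E) (g : R -> E).
Hypotheses (cK : compact K) (gK : C2_boundary_param K g).
Hypothesis (curv_gt0 : forall x, boundary K x -> 0 < curvature K x).
Hypothesis (gE : g = xget (cst 0) [set g | C2_boundary_param K g]).

Let c1 := fst \o g.
Let c2 := snd \o g.
Let v1 := c1^`().
Let v2 := c2^`().
Let a1 := v1^`().
Let a2 := v2^`().
Let q t := v1 t ^+ 2 + v2 t ^+ 2.
Let L t := Num.sqrt (q t).
Let w t := v1 t * a2 t - a1 t * v2 t.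
Let kap t := `|w t| / L t ^+ 3.

Let hc1 (t : R) : is_derive t 1 c1 (v1 t).
Proof. by case: gK => -[[h _ _] _ _] _; exact: derivable_is_derive. Qed.

Let hc2 (t : R) : is_derive t 1 c2 (v2 t).
Proof. by case: gK => -[_ [h _ _] _] _; exact: derivable_is_derive. Qed.

Let hv1 (t : R) : is_derive t 1 v1 (a1 t).
Proof. by case: gK => -[[_ h _] _ _] _; exact: derivable_is_derive. Qed.

Let hv2 (t : R) : is_derive t 1 v2 (a2 t).
Proof. by case: gK => -[_ [_ h _] _] _; exact: derivable_is_derive. Qed.

Let q_gt0 t : 0 < q t.
Proof.
case: gK => -[_ _ /(_ t)]; rewrite -/c1 -/c2 -/v1 -/v2 => h _.
rewrite /q lt0r addr_ge0 ?sqr_ge0// andbT; apply: contra h.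
rewrite paddr_eq0 ?sqr_ge0// !sqrf_eq0 => /andP[/eqP -> /eqP ->].
exact: eqxx.
Qed.

Let L_gt0 t : 0 < L t. Proof. by rewrite sqrtr_gt0. Qed.

Let L2 t : L t ^+ 2 = q t. Proof. by rewrite sqr_sqrtr// ltW. Qed.

Let cont_q : continuous q.
Proof.
have := is_derive_all_continuous hv1; have := is_derive_all_continuous hv2.
move=> cv2 cv1 t; rewrite /q.
by apply: cvgD; (apply: (@cvg_comp _ _ _ _ (fun s : R => s ^+ 2)); last exact: exprn_continuous);
  [exact: cv1|exact: cv2].
Qed.

Let cont_w : continuous w.
Proof.
have cv1 := is_derive_all_continuous hv1; have cv2 := is_derive_all_continuous hv2.
have ca1 : continuous a1 by case: gK => -[[_ _ h] _ _] _; exact: h.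
have ca2 : continuous a2 by case: gK => -[_ [_ _ h] _] _; exact: h.
move=> t; rewrite /w; apply: cvgB; apply: cvgM.
- exact: cv1.
- exact: ca2.
- exact: ca1.
- exact: cv2.
Qed.

Let cont_kap : continuous kap.
Proof.
move=> t; rewrite /kap; apply: cvgM.
  by apply: (@cvg_comp _ _ _ w (fun s : R => `|s|)); [exact: cont_w|exact: norm_continuous].
apply: cvgV; first by rewrite expf_neq0// gt_eqF.
apply: (@cvg_comp _ _ _ _ (fun s : R => s ^+ 3)); last exact: exprn_continuous.
apply: (@cvg_comp _ _ _ q (@Num.sqrt R)); [exact: cont_q|exact: sqrt_continuous].
Qed.

Let bdryE x : boundary K x <-> exists t, g t = x.
Proof.
case: gK => _ [l [_ _ _ gb]]; rewrite -gb.
by split => [[t _ <-]|[t <-]]; exists t.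
Qed.

(** The parameter chosen for g t may differ from t by a period. *)
Let kapE t : curvature K (g t) = kap t.
Proof.
have [_ [l [l0 gl ginj gb]]] := gK.
have c1l s : c1 (s + l) = c1 s by rewrite /c1 /= gl.
have c2l s : c2 (s + l) = c2 s by rewrite /c2 /= gl.
have v1l s : v1 (s + l) = v1 s by exact: periodic_derive1.
have v2l s : v2 (s + l) = v2 s by exact: periodic_derive1.
have a1l s : a1 (s + l) = a1 s by exact: periodic_derive1.
have a2l s : a2 (s + l) = a2 s by exact: periodic_derive1.
have kl s : kap (s + l) = kap s by rewrite /kap /w /L /q !(v1l, v2l, a1l, a2l).
rewrite /curvature (@xget_irr _ _ (cst (g t)) (cst 0)); last by exists g.
rewrite -gE; set t' := xget 0 _.
have gt' : g t' = g t by apply: (@xgetPex _ 0 [set s | g s = g t]); exists t.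
rewrite (_ : curve_curvature g t' = kap t')//.
have [z zs] := periodic_repr t l0; have [z' zs'] := periodic_repr t' l0.
rewrite -(periodic_intmul z' t' kl) -(periodic_intmul z t kl); congr kap.
apply: ginj => //.
by rewrite (periodic_intmul z' t' gl) (periodic_intmul z t gl).
Qed.

Let kap_gt0 t : 0 < kap t.
Proof. by rewrite -kapE; apply: curv_gt0; apply/bdryE; exists t. Qed.

Let kap_bounds : exists m M : R, 0 < m /\ forall t, m <= kap t <= M.
Proof.
have [_ [l [l0 gl ginj gb]]] := gK.
have kl s : kap (s + l) = kap s by rewrite -!kapE gl.
have [tM hM] := periodic_has_max l0 kl cont_kap.
have cNkap : continuous (fun t => - kap t) by move=> t; apply: cvgN; exact: cont_kap.
have [tm hm] := periodic_has_max l0 (fun s => congr1 -%R (kl s)) cNkap.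
exists (kap tm), (kap tM); split => // t; rewrite hM andbT.
by rewrite -lerN2.
Qed.

Lemma min_curvature_gt0 : 0 < min_curvature K.
Proof.
have [m [M [m0 hm]]] := kap_bounds; apply: (lt_le_trans m0).
apply: lb_le_inf; first by exists (curvature K (g 0)), (g 0) => //; apply/bdryE; exists 0.
by move=> _ [x /bdryE[t <-] <-]; rewrite kapE; case/andP: (hm t).
Qed.

Let kap_ge t : min_curvature K <= kap t.
Proof.
have [m [M [m0 hm]]] := kap_bounds.
apply: ge_inf; last by exists (g t); [apply/bdryE; exists t|rewrite kapE].
by exists m => _ [x /bdryE[s <-] <-]; rewrite kapE; case/andP: (hm s).
Qed.

(** The outer normal is the unit tangent turned by a right angle, in the
    direction given by the sign of the signed curvature, which is constant
    since the curvature does not vanish. R0 is taken between r_M and r, and rho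
    below the minimal radius of curvature and the radius of some disc inside
    K. *)
Lemma C2plus_rolling (r : R) : convex_disc K -> r_max K < r ->
  exists R0 rho : R, [/\ 0 < R0 < r, 0 < rho &
   forall x u, support K x u ->
    (forall y, K y -> d2 y x <= 2 * R0 * ip x y u) /\
    (forall y, d2 y x <= 2 * rho * ip x y u -> K y)].
Proof.
move=> [_ vK [z0 Kz0]] rK.
have [m [M [m0 hm]]] := kap_bounds.
have M0 : 0 < M by have /andP[h1 h2] := hm 0; lra.
have [e e0 be] := interior_disc Kz0.
have mc0 := min_curvature_gt0.
have rM0 : 0 < r_max K by rewrite /r_max invr_gt0.
have [_ [l [l0 gl ginj gb]]] := gK.
have w0 t : w t != 0.
  by have := kap_gt0 t; rewrite /kap; apply: contraTN => /eqP ->; rewrite normr0 mul0r ltxx.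
have [sg sg2 sgw] := nonvanishing_constant_sign cont_w w0.
pose n1 t := sg * (v2 t * (L t)^-1).
pose n2 t := - (sg * (v1 t * (L t)^-1)).
have hq (t : R) : is_derive t 1 q (v1 t * a1 t + v1 t * a1 t + (v2 t * a2 t + v2 t * a2 t)).
  exact: (is_derive_add (is_derive_mul (hv1 t) (hv1 t)) (is_derive_mul (hv2 t) (hv2 t))).
have hL (t : R) := is_derive_inv (lt0r_neq0 (L_gt0 t)) (is_derive_sqrt (q_gt0 t) (hq t)).
have Li t : (L t)^-1 = q t / L t ^+ 3.
  by rewrite -L2; have := lt0r_neq0 (L_gt0 t) => h; field.
have kapw t : kap t = sg * w t / L t ^+ 3 by rewrite sgw.
have hn1 (t : R) : is_derive t 1 n1 (kap t * v1 t).
  apply: (is_derive_eq (is_derive_scale sg (is_derive_mul (hv2 t) (hL t)))).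
  rewrite -/(L t) kapw Li /q /w; have h := lt0r_neq0 (L_gt0 t); by field.
have hn2 (t : R) : is_derive t 1 n2 (kap t * v2 t).
  have h' := is_derive_scale (-1) (is_derive_scale sg (is_derive_mul (hv1 t) (hL t))).
  rewrite [X in is_derive _ _ X](_ : _ = (fun s => -1 * (sg * (v1 s * (L s)^-1)))); last first.
    by apply/funext => s; rewrite /n2 mulN1r.
  apply: (is_derive_eq h').
  rewrite -/(L t) kapw Li /q /w; have h := lt0r_neq0 (L_gt0 t); by field.
pose R0 := (r_max K + r) / 2.
pose rho := Num.min e ((2 * M)^-1).
have rho0 : 0 < rho by rewrite lt_min e0 invr_gt0 mulr_gt0.
exists R0, rho; split => //; first by rewrite /R0; lra.
have n_unit t : n1 t ^+ 2 + n2 t ^+ 2 = 1.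
  rewrite /n1 /n2 sqrrN !exprMn sg2 !mul1r -mulrDl exprVn L2 addrC -/(q t).
  by rewrite divff// gt_eqF.
have nv t : n1 t * v1 t + n2 t * v2 t = 0 by rewrite /n1 /n2; ring.
have na t : n1 t * a1 t + n2 t * a2 t = - (kap t * (v1 t ^+ 2 + v2 t ^+ 2)).
  by rewrite kapw /n1 /n2 -/(q t) -L2 /w; have h := lt0r_neq0 (L_gt0 t); field.
have c1l s : c1 (s + l) = c1 s by rewrite /c1 /= gl.
have c2l s : c2 (s + l) = c2 s by rewrite /c2 /= gl.
have v1l s : v1 (s + l) = v1 s by exact: periodic_derive1.
have v2l s : v2 (s + l) = v2 s by exact: periodic_derive1.
have n1l t : n1 (t + l) = n1 t by rewrite /n1 /L /q v1l v2l.
have n2l t : n2 (t + l) = n2 t by rewrite /n2 /L /q v1l v2l.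
have inj (s t : R) : 0 <= s < l -> 0 <= t < l -> (c1 s, c2 s) = (c1 t, c2 t) -> s = t.
  move=> hs ht e1; apply: ginj => //.
  by rewrite (surjective_pairing (g s)) (surjective_pairing (g t)).
have bdry x : (K x /\ ~ K° x) <-> exists t, (c1 t, c2 t) = x.
  rewrite (_ : (K x /\ ~ K° x) = boundary K x).
    split=> [/bdryE[t <-]|[t <-]]; first by exists t; rewrite -surjective_pairing.
    by apply/bdryE; exists t; rewrite -surjective_pairing.
  have clK : closed K by apply: compact_closed => //; exact: norm_hausdorff.
  have Kcl : closure K = K by symmetry; apply/closure_id.
  by rewrite /boundary Kcl.
have R00 : 0 < R0 by rewrite /R0; lra.
have kgt t : 1 < R0 * kap t.
  have h := kap_ge t.
  have -> : 1 = r_max K * min_curvature K by rewrite /r_max mulVf ?gt_eqF.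
  apply: (@lt_le_trans _ _ (R0 * min_curvature K)).
    by rewrite ltr_pM2r// /R0; lra.
  by rewrite ler_pM2l.
have klt t : rho * kap t < 1.
  apply: (@le_lt_trans _ _ ((2 * M)^-1 * M)).
    apply: ler_pM; [exact: ltW|exact: ltW|by rewrite ge_min lexx orbT|by case/andP: (hm t)].
  by rewrite invfM -mulrA mulVf ?gt_eqF// mulr1; lra.
have ball_in y : d2 z0 y <= rho ^+ 2 -> K y.
  move=> hy; apply: be; apply: (le_trans hy).
  rewrite ler_pXn2r ?nnegrE; [by rewrite ge_min lexx|by []|exact: ltW|exact: ltW].
exact: (support_rolling cK vK hc1 hc2 hv1 hv2 hn1 hn2 n_unit nv na q_gt0 l0 c1l c2l
  n1l n2l inj bdry R00 kgt rho0 klt ball_in).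
Qed.

End curvature.

(** Blaschke: at each boundary point K is contained in a tangent disc of radius
    R0 < r and contains a tangent disc of radius rho. This is all that the rest
    of the proof uses about the boundary. *)
Theorem rolling K (r : R) : convex_disc K -> C2plus_boundary K -> r_max K < r ->
  exists R0 rho : R, [/\ 0 < R0 < r, 0 < rho &
   forall x u, support K x u ->
    (forall y, K y -> d2 y x <= 2 * R0 * ip x y u) /\
    (forall y, d2 y x <= 2 * rho * ip x y u -> K y)].
Proof.
move=> dK [[g0 hg0] cv] rK; have [cK _ _] := dK.
pose g := xget (cst 0) [set g | C2_boundary_param K g].
have gK : C2_boundary_param K g by apply: (@xgetPex _ (cst 0)); exists g0.
exact: (C2plus_rolling cK gK cv erefl dK rK).
Qed.

End rolling.

(** * Caps and cells *)

Section caps.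
Context {R : realType}.
Local Notation E := (R * R)%type.
Implicit Types (p u v x y z c : E).

Definition flip (b : bool) y : E := if b then (y.2, y.1) else y.

(** A parallelogram two of whose sides are parallel to a coordinate axis (which
    one depends on [b]), so that its area is the integral of a constant. *)
Definition cell (b : bool) p v (a al be : R) : set E :=
  [set y | `|(flip b y).1 - (flip b p).1| <= a /\ al <= ip p y v <= be].

Definition vsub u v : E := (u.1 - v.1, u.2 - v.2).

Lemma ip_vsub_le p q u v (a b : R) : 0 <= a -> 0 <= b ->
  d2 p q <= a ^+ 2 -> d2 u v <= b ^+ 2 -> ip p q (vsub u v) <= a * b.
Proof.
move=> a0 b0 ha hb; have := @ip_le R p q (vsub u v) a b a0 b0 ha hb.
by rewrite ler_norml => /andP[].
Qed.

Variables (K : set E) (r R0 rho : R).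
Hypotheses (R0r : 0 < R0 < r) (rho0 : 0 < rho).
Hypothesis outer : forall x u, support K x u ->
  forall y, K y -> d2 y x <= 2 * R0 * ip x y u.
Hypothesis inner : forall x u, support K x u ->
  forall y, d2 y x <= 2 * rho * ip x y u -> K y.

Let d2_le_of_sq (a b e : R) : 0 <= a -> 0 <= b -> 0 < e ->
  forall t : R, e * a <= t -> t ^+ 2 <= a * b -> e ^+ 2 * a <= b.
Proof.
move=> a0 b0 e0 t ht tab.
have [a1|a1] := eqVneq a 0; first by rewrite a1 mulr0.
have a2 : 0 < a by rewrite lt0r a1.
have h : (e * a) ^+ 2 <= a * b.
  by apply: le_trans tab; rewrite ler_pXn2r ?nnegrE ?mulr_ge0// ?ltW//; nra.
by rewrite -(ler_pM2l a2); apply: le_trans h; rewrite exprMn expr2 [a ^+ 2]expr2; nra.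
Qed.

(** The point p lies in the outer disc at x, and x in the outer disc at p; add
    the two inequalities and apply Cauchy-Schwarz. *)
Lemma support_point_dist x u p v : support K x u -> support K p v ->
  d2 x p <= R0 ^+ 2 * d2 u v.
Proof.
move=> sx sp; have /andP[R00 _] := R0r.
have [Kx _ _] := sx; have [Kp _ _] := sp.
have h1 := outer sx Kp; have h2 := outer sp Kx.
have cs : ip x p (vsub u v) ^+ 2 <= d2 x p * d2 u v by exact: ip_sqr_le.
have e : ip x p (vsub u v) = ip x p u + ip p x v by rewrite /ip /vsub /=; ring.
have h : R0^-1 * d2 x p <= ip x p (vsub u v).
  by rewrite ler_pdivrMl// e; move: h1 h2; rewrite (d2C p x); lra.
have := d2_le_of_sq (d2_ge0 _ _) (d2_ge0 _ _) (e := R0^-1) _ h cs.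
rewrite invr_gt0 => /(_ R00).
by rewrite exprVn ler_pdivrMl ?exprn_gt0.
Qed.

(** The point of the inner disc at x in the direction v belongs to K, hence
    lies below the supporting line at p; add the inequality with the roles
    exchanged and apply Cauchy-Schwarz. *)
Lemma support_normal_dist x u p v : support K x u -> support K p v ->
  rho ^+ 2 * d2 u v <= d2 x p.
Proof.
have half x' u' p' v' : support K x' u' -> support K p' v' ->
    rho * d2 u' v' <= 2 * ip p' x' v'.
  move=> sx [_ uv sp]; have [_ uu _] := sx.
  pose y : E := (x'.1 - rho * u'.1 + rho * v'.1, x'.2 - rho * u'.2 + rho * v'.2).
  pose uv' := u'.1 * v'.1 + u'.2 * v'.2.
  have Ky : K y.
    apply: (inner sx); rewrite le_eqVlt; apply/orP; left; apply/eqP.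
    have -> : d2 y x' = rho ^+ 2 * ((u'.1 ^+ 2 + u'.2 ^+ 2) + (v'.1 ^+ 2 + v'.2 ^+ 2) - 2 * uv').
      by rewrite /d2 /y /uv' /=; ring.
    have -> : ip x' y u' = rho * ((u'.1 ^+ 2 + u'.2 ^+ 2) - uv').
      by rewrite /ip /y /uv' /=; ring.
    by rewrite uu uv; ring.
  have := sp y Ky; rewrite (unit_vector_dist uu uv) -/uv'.
  have -> : ip y p' v' = rho * ((v'.1 ^+ 2 + v'.2 ^+ 2) - uv') - ip p' x' v'.
    by rewrite /ip /y /uv' /=; ring.
  by rewrite uv; lra.
move=> sx sp.
have h1 := half _ _ _ _ sx sp; have h2 := half _ _ _ _ sp sx.
have cs : ip x p (vsub u v) ^+ 2 <= d2 u v * d2 x p.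
  by rewrite [leRHS]mulrC; exact: ip_sqr_le.
have e : ip x p (vsub u v) = ip x p u + ip p x v by rewrite /ip /vsub /=; ring.
apply: (@d2_le_of_sq _ _ rho (d2_ge0 _ _) (d2_ge0 _ _) rho0 (ip x p (vsub u v))) => //.
by rewrite e; move: h1 h2; rewrite (d2C v u); lra.
Qed.

Definition cap c : set E := [set y | K y /\ r ^+ 2 < d2 c y].

(** The point x of K farthest from c is the apex of the cap, and h its
    height. *)
Definition cap_frame c x u (h : R) :=
  [/\ support K x u, 0 < h & c = move x (- (r + h)) u].

Lemma exists_cap_frame c z : compact K -> cap c z -> exists x u h, cap_frame c x u h.
Proof.
move=> cK [Kz cz]; have /andP[R00 rR] := R0r.
have [x Kx hx] := exists_farthest c cK (ex_intro _ z Kz).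
pose s := Num.sqrt (d2 c x).
have s2 : s ^+ 2 = d2 c x by rewrite sqr_sqrtr ?d2_ge0.
have rs : r < s.
  rewrite -(@ltr_pXn2r _ 2%N) ?nnegrE ?sqrtr_ge0//; last lra.
  by rewrite s2 (lt_le_trans cz)// hx.
have s0 : 0 < s by lra.
exists x, ((x.1 - c.1) / s, (x.2 - c.2) / s), (s - r); split.
- split => //.
    rewrite /unit_vector /= !expr_div_n -mulrDl s2 /d2.
    by rewrite -[x.1 - _]opprB -[x.2 - _]opprB !sqrrN -/(d2 c x) -s2 divff ?gt_eqF ?exprn_gt0.
  move=> y Ky; rewrite /ip /= !mulrA -mulrDl pmulr_lle0 ?invr_gt0//.
  have : d2 c y = d2 c x + d2 y x + 2 * ((y.1 - x.1) * (x.1 - c.1) + (y.2 - x.2) * (x.2 - c.2)).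
    by rewrite /d2; ring.
  by have := hx y Ky; have := d2_ge0 y x; lra.
- by lra.
- rewrite addrC subrK /move /=; case: (c) => a b /=; congr pair;
  by rewrite mulNr mulrC mulfVK ?gt_eqF//; ring.
Qed.

(** K lies in the disc of radius R0 tangent at the apex, whose boundary falls
    away faster than a circle of radius r > R0: the two separate at a depth
    proportional to h. *)
Lemma cap_depth c x u h y : cap_frame c x u h -> cap c y ->
  ip x y u <= r / (r - R0) * h.
Proof.
move=> [sx h0 ->] [Ky]; have /andP[R00 rR] := R0r.
have := outer sx Ky; have [_ uu _] := sx.
have -> : d2 (move x (- (r + h)) u) y =
  d2 y x - 2 * (r + h) * ip x y u + (r + h) ^+ 2 * (u.1 ^+ 2 + u.2 ^+ 2).
  by rewrite /d2 /move /ip /=; ring.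
rewrite uu mulr1; move: (ip x y u) (d2 y x) => D q hq hr.
rewrite mulrAC ler_pdivlMr; last lra.
have h1 : 2 * (r + h - R0) * D <= 2 * r * h + h ^+ 2 by nra.
have h2 : (2 * r * h + h ^+ 2) * (r - R0) <= 2 * (r + h - R0) * (r * h) by nra.
have h3 : 0 < 2 * (r + h - R0) by lra.
rewrite -(ler_pM2l h3); apply: le_trans h2.
by rewrite mulrA ler_pM2r; lra.
Qed.

Lemma cap_contains c x u h y : cap_frame c x u h -> K y -> ip x y u < h / 2 -> cap c y.
Proof.
move=> [[_ uu _] h0 ->] Ky D2; have /andP[R00 rR] := R0r; split => //.
have -> : d2 (move x (- (r + h)) u) y =
  d2 y x - 2 * (r + h) * ip x y u + (r + h) ^+ 2 * (u.1 ^+ 2 + u.2 ^+ 2).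
  by rewrite /d2 /move /ip /=; ring.
by have := d2_ge0 y x; rewrite uu mulr1; nra.
Qed.

(* The width b keeps the small cells inside the inner discs; the step del makes
   the replacement of a normal u by a direction v of the net change the depths
   in a cell of scale e by a small fraction of e^2. *)
Let b : R := Num.min 1 (rho / 80).
Let del : R := (40 * b + 8 * R0 + 1)^-1.

Lemma cell_width_gt0 : 0 < b.
Proof. by rewrite lt_min ltr01 divr_gt0. Qed.

Let b_gt0 := cell_width_gt0.

Lemma net_step_gt0 : 0 < del.
Proof. by have := b_gt0; have /andP[? ?] := R0r; rewrite invr_gt0; lra. Qed.

Let del_bounds : [/\ 0 < del, del <= 1, 40 * b * del < 1 & 8 * R0 * del < 1].
Proof.
have b0 := b_gt0; have /andP[R00 _] := R0r; have d0 := net_step_gt0.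
have e : (40 * b + 8 * R0 + 1) * del = 1 by rewrite divff//; lra.
by split; nra.
Qed.

(** The cell hangs below the support point p of the direction v of the net, at
    a depth between e^2/8 and e^2/4, where the inner disc at p is wider than
    the cell. Passing from (p, v) to (x, u) adds less than e^2/4 to the
    depth. *)
Lemma small_cell_in_cap (o : bool) x u p v (e : R) y :
  support K x u -> support K p v -> 1 / 2 <= `|(flip o v).2| ->
  0 < e <= 4 * b -> d2 u v <= (del * e) ^+ 2 ->
  cell o p v (b * e) (e ^+ 2 / 8) (e ^+ 2 / 4) y -> K y /\ ip x y u < e ^+ 2 / 2.
Proof.
move=> sx sp v2 /andP[e0 eb] uv [h1 /andP[h2 h3]].
have b0 := b_gt0; have /andP[R00 _] := R0r; have [d0 d1 bd Rd] := del_bounds.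
have [Kx uu _] := sx; have [Kp uvv sp'] := sp.
(* since |v.2| >= 1/2, the other coordinate differs by at most 4 b e, and 17 = 1 + 4^2 *)
have dyp : d2 y p <= 17 * (b * e) ^+ 2.
  pose Y1 := (flip o p).1 - (flip o y).1; pose Y2 := (flip o p).2 - (flip o y).2.
  pose V1 := (flip o v).1; pose V2 := (flip o v).2.
  have eD : ip p y v = Y1 * V1 + Y2 * V2.
    by rewrite /ip /Y1 /Y2 /V1 /V2 /flip; case: (o) => //=; ring.
  have ed : d2 y p = Y1 ^+ 2 + Y2 ^+ 2.
    by rewrite /d2 /Y1 /Y2 /flip; case: (o) => /=; ring.
  have eV : V1 ^+ 2 + V2 ^+ 2 = 1.
    by rewrite -uvv /V1 /V2 /flip; case: (o) => /=; ring.
  have V1b : `|V1| <= 1.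
    rewrite -(@ler_pXn2r _ 2%N) ?nnegrE// real_normK ?num_real// expr1n.
    by have := sqr_ge0 V2; lra.
  have Y1b : `|Y1| <= b * e by rewrite /Y1 distrC.
  have eb2 : e ^+ 2 / 4 <= b * e by nra.
  have YV : `|Y1 * V1| <= b * e.
    by rewrite normrM -[leRHS]mulr1 ler_pM.
  have Y2V : `|Y2| * (1 / 2) <= 2 * (b * e).
    apply: (@le_trans _ _ (`|Y2| * `|V2|)); first by rewrite ler_wpM2l.
    have -> : `|Y2| * `|V2| = `|ip p y v - Y1 * V1|.
      by rewrite -normrM eD; congr `|_|; ring.
    apply: (le_trans (ler_normB _ _)); rewrite ger0_norm; last first.
      by apply: le_trans h2; have := sqr_ge0 e; lra.
    lra.
  have Y2b : `|Y2| <= 4 * (b * e) by lra.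
  have sq (s t : R) : `|s| <= t -> s ^+ 2 <= t ^+ 2.
    move=> st; rewrite -[s ^+ 2]real_normK ?num_real// ler_pXn2r ?nnegrE//.
    by apply: le_trans st.
  by rewrite ed; have := sq _ _ Y1b; have := sq _ _ Y2b; nra.
have Ky : K y.
  apply: (inner sp); apply: (le_trans dyp).
  have brho : 80 * b <= rho.
    have : b <= rho / 80 by rewrite ge_min lexx orbT.
    by lra.
  have b1 : b <= 1 by rewrite ge_min lexx.
  have bb : 17 * b ^+ 2 <= rho / 4 by nra.
  have e2 := sqr_ge0 e.
  apply: (@le_trans _ _ (2 * rho * (e ^+ 2 / 8))); first by rewrite exprMn; nra.
  by rewrite ler_pM2l// mulr_gt0.
split => //.
have de0 : 0 <= del * e by rewrite mulr_ge0// ltW.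
have dxp : d2 x p <= (R0 * (del * e)) ^+ 2.
  apply: (le_trans (support_point_dist sx sp)).
  by rewrite exprMn ler_wpM2l ?sqr_ge0.
have i1 : ip p y (vsub u v) <= 5 * (b * e) * (del * e).
  apply: ip_vsub_le => //; first by rewrite !mulr_ge0// ltW.
  by rewrite d2C (le_trans dyp)// exprMn; have := sqr_ge0 (b * e); lra.
have i2 : ip x p (vsub u v) <= R0 * (del * e) * (del * e).
  by apply: ip_vsub_le => //; rewrite mulr_ge0// ltW.
have := sp' x Kx.
have -> : ip x y u = ip p y v + ip p y (vsub u v) + ip x p (vsub u v) + ip x p v.
  by rewrite /ip /vsub /=; ring.
have e2 : 0 < e ^+ 2 by rewrite exprn_gt0.
have : 5 * (b * e) * (del * e) < e ^+ 2 / 8.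
  have -> : 5 * (b * e) * (del * e) = (40 * b * del) * (e ^+ 2 / 8) by field.
  by rewrite gtr_pMl// divr_gt0.
have : R0 * (del * e) * (del * e) <= e ^+ 2 / 8.
  have -> : R0 * (del * e) * (del * e) = (8 * R0 * del * del) * (e ^+ 2 / 8) by field.
  rewrite ger_pMl ?divr_gt0//; nra.
lra.
Qed.

(** Two caps of height at most 4 e^2 that share z have diameters of order e, so
    their apexes x, x' are at a distance of order e from each other and from p,
    and so are their normals by [support_normal_dist]. Hence the depths of y
    with respect to (p, v) and to (x', u') differ by a multiple of e^2. *)
Lemma cap_in_large_cell (o : bool) c c' x u h x' u' h' p v (e B : R) y z :
  1 <= B -> 8 * R0 * (r / (r - R0)) <= B ->
  cap_frame c x u h -> cap_frame c' x' u' h' -> support K p v ->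
  0 < e -> d2 u v <= (del * e) ^+ 2 -> h <= 4 * e ^+ 2 -> h' <= 4 * e ^+ 2 ->
  cap c z -> cap c' z -> cap c' y ->
  let B' := (2 * B + R0) in
  cell o p v ((B + B') * e) 0 ((4 * (r / (r - R0)) + B' ^+ 2 / rho + B * B' / rho) * e ^+ 2) y.
Proof.
move=> B1 BC fc fc' sp e0 uv hh hh' cz cz' cy B'.
have [sx _ _] := fc; have [sx' _ _] := fc'; have [Kp _ sp'] := sp.
have [Kx' uu' sup'] := sx'.
have /andP[R00 rR] := R0r; have [d0 d1 bd Rd] := del_bounds.
have B0 : 0 <= B by lra.
have B'0 : 0 <= B' by rewrite /B'; lra.
have Ky : K y by case: cy.
have C10 : 0 < r / (r - R0) by rewrite divr_gt0; lra.
have dist c1 x1 u1 h1 y1 : cap_frame c1 x1 u1 h1 -> h1 <= 4 * e ^+ 2 -> cap c1 y1 ->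
    d2 y1 x1 <= (B * e) ^+ 2.
  move=> f1 hh1 cy1; have [s1 h10 _] := f1; have [Ky1 _] := cy1.
  apply: (le_trans (outer s1 Ky1)).
  apply: (@le_trans _ _ (2 * R0 * (r / (r - R0) * (4 * e ^+ 2)))).
    rewrite ler_pM2l; last by rewrite mulr_gt0.
    by apply: (le_trans (cap_depth f1 cy1)); rewrite ler_pM2l.
  rewrite exprMn mulrA (_ : 2 * R0 * (r / (r - R0)) * (4 * e ^+ 2) = (8 * R0 * (r / (r - R0))) * e ^+ 2); last by ring.
  by rewrite ler_wpM2r ?sqr_ge0//; nra.
have zx := dist _ _ _ _ _ fc hh cz; have zx' := dist _ _ _ _ _ fc' hh' cz'.
have yx' := dist _ _ _ _ _ fc' hh' cy.
have xp : d2 x p <= (R0 * e) ^+ 2.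
  apply: (le_trans (support_point_dist sx sp)); rewrite exprMn ler_wpM2l ?sqr_ge0//.
  apply: (le_trans uv); rewrite exprMn; have := sqr_ge0 e.
  have : del ^+ 2 <= 1 by rewrite -[leRHS](expr1n _ 2) ler_pXn2r ?nnegrE// ltW.
  by nra.
have Be0 : 0 <= B * e by rewrite mulr_ge0// ltW.
have Re0 : 0 <= R0 * e by rewrite mulr_ge0// ltW.
have x'p : d2 x' p <= (B' * e) ^+ 2.
  rewrite d2C in zx'; have := d2_triangle Be0 Be0 zx' zx => h1.
  have := d2_triangle (addr_ge0 Be0 Be0) Re0 h1 xp; congr (_ <= _).
  by rewrite /B'; congr (_ ^+ 2); ring.
have B'e0 : 0 <= B' * e by rewrite mulr_ge0// ltW.
have yp : d2 y p <= ((B + B') * e) ^+ 2.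
  by have := d2_triangle Be0 B'e0 yx' x'p; rewrite -mulrDl.
have vu' : d2 v u' <= (B' * e / rho) ^+ 2.
  rewrite expr_div_n ler_pdivlMr ?exprn_gt0// mulrC d2C.
  exact: le_trans (support_normal_dist sx' sp) x'p.
have Ber0 : 0 <= B' * e / rho by rewrite divr_ge0// ltW.
have i1 : ip p x' (vsub v u') <= B' * e * (B' * e / rho).
  by apply: ip_vsub_le => //; rewrite d2C.
have i2 : ip x' y (vsub v u') <= B * e * (B' * e / rho).
  by apply: ip_vsub_le => //; rewrite d2C.
have i3 : ip x' y u' <= r / (r - R0) * (4 * e ^+ 2).
  by apply: (le_trans (cap_depth fc' cy)); rewrite ler_pM2l.
split.
  have BBe : 0 <= (B + B') * e by apply: mulr_ge0; [exact: addr_ge0|exact: ltW].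
  rewrite -(@ler_pXn2r _ 2%N) ?nnegrE//.
  rewrite real_normK ?num_real// (le_trans _ yp)// /d2 /flip.
  by case: (o) => /=; rewrite ?lerDl ?lerDr sqr_ge0.
apply/andP; split.
  by have := sp' y Ky; rewrite /ip; lra.
have -> : ip p y v = ip p x' (vsub v u') + ip p x' u' + ip x' y u' + ip x' y (vsub v u').
  by rewrite /ip /vsub /=; ring.
have := sup' _ Kp.
have -> : (4 * (r / (r - R0)) + B' ^+ 2 / rho + B * B' / rho) * e ^+ 2 =
  r / (r - R0) * (4 * e ^+ 2) + B' * e * (B' * e / rho) + B * e * (B' * e / rho).
  by ring.
by lra.
Qed.

End caps.

(** * Areas and measurability in the plane *)

Lemma product_measure_swap {R : realType} d (T : measurableType d)
    (m : {sigma_finite_measure set T -> \bar R}) (A : set (T * T)) :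
  measurable A -> (m \x m)%E ((fun y => (y.2, y.1)) @^-1` A) = (m \x m)%E A.
Proof.
move=> mA; have ms : measurable_fun setT (fun y : T * T => (y.2, y.1)).
  exact: (measurable_fun_pair (@measurable_snd _ _ _ _) (@measurable_fst _ _ _ _)).
pose m' : {measure set (T * T) -> \bar R} :=
  pushforward (m \x m)%E (fun y : T * T => (y.2, y.1)).
rewrite [RHS](@product_measure_unique _ _ _ _ _ m m (m' ms)) => //.
move=> B C mB mC; rewrite /m' /= /pushforward.
rewrite (_ : _ @^-1` (B `*` C) = C `*` B); last first.
  by apply/seteqP; split => -[a b] /= [].
by rewrite product_measure1E// muleC.
Qed.

Section areas.
Context {R : realType}.
Local Notation E := (R * R)%type.
Local Notation lambda := (@lebesgue_measure R).
Implicit Types (A : set E) (p v : E).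

Lemma measurable_ip p v : measurable_fun setT (fun y : E => ip p y v).
Proof.
apply: measurable_funD; apply: measurable_funM => //; apply: measurable_funB => //.
Qed.

Lemma measurable_flip o : measurable_fun setT (@flip R o).
Proof.
case: o => /=; last exact: measurable_id.
exact: (measurable_fun_pair (@measurable_snd _ _ _ _) (@measurable_fst _ _ _ _)).
Qed.

Lemma measurable_preimage_itv d (T : measurableType d) (f : T -> R) (i : interval R) :
  measurable_fun setT f -> measurable [set x | f x \in i].
Proof.
move=> mf; rewrite -[X in measurable X]setTI.
by apply: (mf measurableT [set` i]); exact: measurable_itv.
Qed.

Lemma measurable_cell o p v (a al be : R) : measurable (cell o p v a al be).
Proof.
rewrite (_ : cell _ _ _ _ _ _ = [set y | (flip o y).1 - (flip o p).1 \in `[- a, a]%R] `&`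
   [set y | ip p y v \in `[al, be]%R]); last first.
  by apply/seteqP; split => y; rewrite /cell /= !in_itv /= ler_norml => -[].
apply: measurableI; apply: measurable_preimage_itv; last exact: measurable_ip.
apply: measurable_funB => //.
exact: (measurableT_comp (@measurable_fst _ _ _ _) (measurable_flip o)).
Qed.

Lemma area_flip A o : measurable A -> area (flip o @^-1` A) = area A.
Proof.
case: o => //= mA; exact: (product_measure_swap lambda mA).
Qed.

Let area_cell_false p v (a al be : R) : 0 <= a -> al <= be -> 0 < v.2 ->
  area (cell false p v a al be) = (2 * a * ((be - al) / v.2))%:E.
Proof.
move=> a0 ab v0; rewrite /area /product_measure1.
pose I := `[p.1 - a, p.1 + a]%classic.
transitivity (\int[lambda]_x (((be - al) / v.2) * \1_I x)%:E)%E.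
  apply: eq_integral => x _ /=; rewrite indicE.
  have [xI|xI] := boolP (x \in I).
    rewrite mulr1.
    rewrite (_ : xsection _ _ = `[p.2 - (be - (p.1 - x) * v.1) / v.2,
                                  p.2 - (al - (p.1 - x) * v.1) / v.2]%classic).
      rewrite lebesgue_measure_itv /= lte_fin.
      case: ltP => h; first by rewrite -EFinB; congr EFin; field; rewrite gt_eqF.
      have -> : be = al; last by rewrite subrr mul0r.
      apply/eqP; rewrite eq_le ab andbT.
      by move: h; rewrite lerD2l lerN2 ler_pM2r ?invr_gt0//; lra.
    have key (y : R) : (p.2 - (be - (p.1 - x) * v.1) / v.2 <= y <=
        p.2 - (al - (p.1 - x) * v.1) / v.2) = (al <= ip p (x, y) v <= be).
      have e1 : (p.2 - (be - (p.1 - x) * v.1) / v.2 <= y) = (ip p (x, y) v <= be).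
        rewrite lerBlDr -lerBlDl ler_pdivlMr// /ip /=.
        by apply/idP/idP; lra.
      have e2 : (y <= p.2 - (al - (p.1 - x) * v.1) / v.2) = (al <= ip p (x, y) v).
        rewrite lerBrDr addrC -lerBrDr ler_pdivrMr// /ip /=.
        by apply/idP/idP; lra.
      by rewrite e1 e2 andbC.
    apply/seteqP; split => y; rewrite /xsection /= in_itv /= inE key; first by case.
    move=> h; split => //.
    by move: xI; rewrite inE /I /= in_itv /= ler_norml => /andP[? ?]; lra.
  rewrite mulr0 (_ : xsection _ _ = set0) ?measure0//.
  apply/seteqP; split => // y; rewrite /xsection /= inE => -[h _].
  by move: xI h; rewrite notin_setE /I /= in_itv /= ler_norml => /negP + ?; apply/negP; rewrite negbK; lra.
under eq_integral do rewrite EFinM.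
rewrite integralZl//; last exact: integrable_indic_itv.
rewrite integral_indic//; last exact: measurable_itv.
have -> : I `&` [set: g_sigma_algebraType (R.-ocitv.-measurable)] = I by exact: setIT.
rewrite (_ : (_ * _)%E = ((be - al) / v.2)%:E * lambda I)%E//.
rewrite lebesgue_measure_itv /= lte_fin.
case: ltP => h; first by rewrite -EFinB -EFinM; congr EFin; ring.
have -> : a = 0 by lra.
by rewrite mule0 mulr0 mul0r.
Qed.

(** By Fubini: across the slanted side each section is an interval of length
    (be - al) / |v.2|, up to the exchange of coordinates. *)
Lemma area_cell o p v (a al be : R) : 0 <= a -> al <= be -> (flip o v).2 != 0 ->
  area (cell o p v a al be) = (2 * a * ((be - al) / `|(flip o v).2|))%:E.
Proof.
move=> a0 ab v0.
have -> : cell o p v a al be = flip o @^-1` cell false (flip o p) (flip o v) a al be.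
  have e y : ip (flip o p) (flip o y) (flip o v) = ip p y v.
    by rewrite /ip /flip; case: (o) => //=; exact: addrC.
  by apply/seteqP; split => y; rewrite /cell /= e.
rewrite area_flip; last exact: measurable_cell.
have [vp|vn] := ltP 0 (flip o v).2; first by rewrite area_cell_false// gtr0_norm.
have {vn}vn : (flip o v).2 < 0 by rewrite lt_neqAle v0.
rewrite ltr0_norm// (_ : cell _ _ _ _ _ _ =
  cell false (flip o p) (- (flip o v).1, - (flip o v).2) a (- be) (- al)).
  by rewrite area_cell_false//= ?oppr_gt0 ?lerN2// opprK [- al + _]addrC.
apply/seteqP; split => y [h1 /andP[h2 h3]]; split => //; apply/andP; move: h2 h3;
  rewrite /ip /= => h2 h3; lra.
Qed.

Lemma area_set1 p : area [set p] = 0%E.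
Proof.
case: p => p1 p2; rewrite (_ : [set (p1, p2)] = [set p1] `*` [set p2]).
  by rewrite /area product_measure1E//= lebesgue_measure_set1 mul0e.
by apply/seteqP; split => -[a b] /= [-> ->].
Qed.

(** The plane is second countable, so the product sigma-algebra contains the
    open sets: an open set is the union of the rational squares inside it. *)
Lemma open_measurable_plane A : open A -> measurable A.
Proof.
move=> oA.
pose sq (c : rat * rat) (n : nat) : set E :=
  `]ratr c.1 - n.+1%:R^-1, ratr c.1 + n.+1%:R^-1[%classic `*`
  `]ratr c.2 - n.+1%:R^-1, ratr c.2 + n.+1%:R^-1[%classic.
rewrite (_ : A = \bigcup_(c in [set: rat * rat]) \bigcup_(n in [set n | sq c n `<=` A]) sq c n).
  apply: countable_bigcupT_measurable => // c; apply: bigcup_measurable => n _.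
  by apply: measurableX; exact: measurable_itv.
apply/seteqP; split => [x Ax|x [c _ [n + xs]]]; last exact.
have /nbhs_ballP[e /= e0 he] := open_nbhs_nbhs (conj oA Ax).
have [n hn] : exists n : nat, n.+1%:R^-1 < e / 2.
  exists (Num.truncn (2 / e)); rewrite -[e / 2]invrK ltf_pV2 ?posrE ?invr_gt0 ?divr_gt0//.
  by rewrite invf_div truncnS_gt.
have n0 : 0 < n.+1%:R^-1 :> R by rewrite invr_gt0.
have sqE c (y : E) : sq c n y -> [/\ `|y.1 - ratr c.1| < n.+1%:R^-1 & `|y.2 - ratr c.2| < n.+1%:R^-1].
  by rewrite /sq => -[/=]; rewrite !in_itv /= -!ltr_distl.
have sqI c (y : E) : `|y.1 - ratr c.1| < n.+1%:R^-1 -> `|y.2 - ratr c.2| < n.+1%:R^-1 -> sq c n y.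
  by move=> h1 h2; rewrite /sq; split; rewrite /= in_itv /= -ltr_distl.
move: (n.+1%:R^-1) n0 hn sqE sqI => dl dl0 hdl sqE sqI.
have rat_near (t : R) : exists q : rat, `|t - ratr q| < dl.
  have /rat_in_itvoo[q] : t - dl < t + dl by lra.
  by rewrite in_itv /= => /andP[q1 q2]; exists q; rewrite ltr_norml; lra.
have [q1 hq1] := rat_near x.1; have [q2 hq2] := rat_near x.2.
exists (q1, q2) => //; exists n; last exact: sqI.
move=> y /sqE[/= y1 y2]; apply: he; move: hq1 hq2 y1 y2; rewrite !ltr_norml => *.
by split; rewrite /ball /= ltr_norml; lra.
Qed.

Lemma closed_measurable_plane A : closed A -> measurable A.
Proof.
by move=> cA; rewrite -[A]setCK; apply: measurableC; apply: open_measurable_plane; exact: closed_openC.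
Qed.

Lemma compact_measurable_plane A : compact A -> measurable A.
Proof.
move=> cA; apply: closed_measurable_plane.
by apply: compact_closed => //; exact: norm_hausdorff.
Qed.

End areas.

(** * A net of directions *)

Section direction_net.
Context {R : realType}.
Local Notation E := (R * R)%type.

(** Truncating the abscissa at 1/sqrt 2 keeps the ordinate away from zero. *)
Definition net_abscissa N (k : 'I_N) : R :=
  if (2 * k ^ 2 <= N ^ 2)%N then k%:R / N%:R else 0.

Definition net_index N : finType := (bool * bool * bool * 'I_N)%type.

(** The points with abscissa k/N of the upper unit arc, reflected in both axes
    and in the diagonal. *)
Definition net_vector N (i : net_index N) : E :=
  let: (o, s1, s2, k) := i in
  flip o ((-1) ^+ s1 * net_abscissa k,
          (-1) ^+ s2 * Num.sqrt (1 - net_abscissa k ^+ 2)).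

Definition net_flip N (i : net_index N) : bool := i.1.1.1.

Lemma flipK (o : bool) (y : E) : flip o (flip o y) = y.
Proof. by case: o y => -[]. Qed.

Lemma d2_flip (o : bool) (x y : E) : d2 (flip o x) (flip o y) = d2 x y.
Proof. by case: o; rewrite /d2 /flip //= addrC. Qed.

Lemma unit_vector_flip (o : bool) (u : E) : unit_vector u -> unit_vector (flip o u).
Proof. by case: o; rewrite /unit_vector /flip //= addrC. Qed.

Lemma net_abscissa_sqr N (k : 'I_N) : net_abscissa k ^+ 2 <= 1 / 2.
Proof.
rewrite /net_abscissa; case: ifP => h; last by rewrite expr0n /=; lra.
have N0 : 0 < N%:R :> R by rewrite ltr0n (leq_ltn_trans _ (ltn_ord k)).
rewrite expr_div_n ler_pdivrMr ?exprn_gt0//.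
by move: h; rewrite -(ler_nat R) natrM !natrX; lra.
Qed.

Lemma net_vector_unit N (i : net_index N) : unit_vector (net_vector i).
Proof.
case: i => -[[b s1] s2] k; apply: unit_vector_flip; rewrite /unit_vector /=.
have := net_abscissa_sqr k => h.
rewrite !exprMn !sqrr_sign !mul1r sqr_sqrtr; last lra.
by ring.
Qed.

Lemma net_vector_slope N (i : net_index N) :
  1 / 2 <= `|(flip (net_flip i) (net_vector i)).2|.
Proof.
case: i => -[[b s1] s2] k; rewrite /net_vector /net_flip /= flipK /= normrMsign.
have h := net_abscissa_sqr k.
rewrite ger0_norm ?sqrtr_ge0// -(@ler_pXn2r _ 2%N) ?nnegrE ?sqrtr_ge0//.
by rewrite sqr_sqrtr; lra.
Qed.

(** Up to reflections u lies on the part of the upper arc with slope at most 1,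
    where the ordinate varies no more than the abscissa. *)
Lemma net_vector_dense N (u : E) : (0 < N)%N -> unit_vector u ->
  exists i : net_index N, d2 u (net_vector i) <= 2 / N%:R ^+ 2.
Proof.
move=> N0 uu; pose o := `|u.2| < `|u.1|; pose w := flip o u.
have uw : unit_vector w by exact: unit_vector_flip.
have Nr : 0 < N%:R :> R by rewrite ltr0n.
have w12 : `|w.1| <= `|w.2|.
  by rewrite /w /o /flip; case: ltP => //= /ltW.
pose a : R := `|w.1|; pose s : R := `|w.2|.
have as1 : a ^+ 2 + s ^+ 2 = 1 by rewrite /a /s !real_normK ?num_real.
have a0 : 0 <= a := normr_ge0 _; have s0 : 0 <= s := normr_ge0 _.
have a2 : a ^+ 2 <= 1 / 2.
  have : a ^+ 2 <= s ^+ 2 by rewrite ler_pXn2r ?nnegrE.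
  by lra.
have a1 : a < 1 by nra.
have /truncn_itv/andP[k1 k2] : 0 <= N%:R * a by rewrite mulr_ge0// ltW.
set k := Num.truncn _ in k1 k2.
have kN : (k < N)%N.
  by rewrite -(ltr_nat R) (le_lt_trans k1)// -[ltRHS]mulr1 ltr_pM2l.
pose kk := Ordinal kN; pose al := net_abscissa kk.
have alE : al = k%:R / N%:R.
  rewrite /al /net_abscissa; case: ifP => //= /negP[].
  rewrite -(ler_nat R) natrM !natrX.
  have : k%:R ^+ 2 <= (N%:R * a) ^+ 2 :> R.
    by rewrite ler_pXn2r ?nnegrE// mulr_ge0// ltW.
  have N2 : 0 < N%:R ^+ 2 :> R by rewrite exprn_gt0.
  by rewrite exprMn; nra.
have al0 : 0 <= al by rewrite alE divr_ge0.
have ala : al <= a by rewrite alE ler_pdivrMr// mulrC.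
have aal : a - al <= N%:R^-1.
  rewrite alE lerBlDl -[X in _ <= _ + X]mul1r -mulrDl ler_pdivlMr// mulrC.
  by rewrite (le_trans (ltW k2))// -natr1.
pose c := Num.sqrt (1 - al ^+ 2).
have c2 : c ^+ 2 = 1 - al ^+ 2.
  by rewrite sqr_sqrtr//; have := net_abscissa_sqr kk; rewrite -/al; lra.
have c0 : 0 <= c by rewrite sqrtr_ge0.
have sc : s <= c by rewrite -(@ler_pXn2r _ 2%N) ?nnegrE// c2; nra.
have sa : a <= s by [].
have csal : c - s <= a - al.
  have e : (c - s) * (c + s) = (a - al) * (a + al) by rewrite -!subr_sqr c2; lra.
  have cs0 : 0 < c + s.
    by rewrite lt0r addr_ge0// andbT; apply/eqP => cs; nra.
  rewrite -(ler_pM2r cs0) e ler_wpM2l//; lra.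
exists (o, w.1 < 0, w.2 < 0, kk).
rewrite /net_vector -(d2_flip o) flipK -/w -/al -/c /d2 /=.
have sgn (x y : R) : x - (-1) ^+ (x < 0)%R * y = (-1) ^+ (x < 0)%R * (`|x| - y).
  by rewrite mulrBr -numEsign.
rewrite !sgn !exprMn !sqrr_sign !mul1r -/a -/s.
have i2 : (a - al) ^+ 2 <= N%:R^-1 ^+ 2 by rewrite ler_pXn2r ?nnegrE ?invr_ge0//; lra.
have i3 : (s - c) ^+ 2 <= (a - al) ^+ 2.
  by rewrite -(sqrrN (s - c)) ler_pXn2r ?nnegrE//; lra.
by rewrite -exprVn; lra.
Qed.

End direction_net.

(** * Covering the caps by cells *)

Section cap_covering.
Context {R : realType}.
Local Notation E := (R * R)%type.
Variables (K : set E) (r : R).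

Definition uniform_prob (A : set E) : R := fine (area (K `&` A)) / fine (area K).

Lemma compact_diameter : compact K -> K !=set0 ->
  exists2 D : R, 0 <= D & forall x y, K x -> K y -> d2 x y <= D ^+ 2.
Proof.
move=> cK [z Kz]; have [x Kx hx] := exists_farthest z cK (ex_intro _ z Kz).
pose s := Num.sqrt (d2 z x); have s0 : 0 <= s by exact: sqrtr_ge0.
have s2 : s ^+ 2 = d2 z x by rewrite sqr_sqrtr ?d2_ge0.
exists (s + s); first exact: addr_ge0.
by move=> a c Ka Kc; apply: (@d2_triangle _ _ z) => //; rewrite ?[d2 a z]d2C s2 hx.
Qed.

Lemma d2_coord_le (o : bool) (x y : E) (D : R) : 0 <= D -> d2 x y <= D ^+ 2 ->
  `|(flip o x).1 - (flip o y).1| <= D.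
Proof.
move=> D0 h; rewrite -(@ler_pXn2r _ 2%N) ?nnegrE//.
rewrite real_normK ?num_real// (le_trans _ h)// /d2 /flip.
by case: o => /=; rewrite ?lerDl ?lerDr sqr_ge0.
Qed.

Let e1 : E := (0, 1).

Lemma area_compact_lty : compact K -> K !=set0 -> (area K < +oo)%E.
Proof.
move=> cK K0; have [z Kz] := K0; have [D D0 hD] := compact_diameter cK K0.
have mK : measurable K by exact: compact_measurable_plane.
apply: (@le_lt_trans _ _ (area (cell false z e1 D (- D) D))).
  apply: le_measure; rewrite ?inE//; first exact: measurable_cell.
  move=> y Ky; split; first exact: d2_coord_le (hD _ _ Ky Kz).
  have /= := d2_coord_le true D0 (hD _ _ Ky Kz).
  by rewrite /ip /= ler_norml; lra.
by rewrite area_cell ?ltry//= ?oner_neq0//; lra.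
Qed.

Lemma area_subset_fine (A B : set E) : measurable A -> measurable B -> (area B < +oo)%E ->
  A `<=` B -> fine (area A) <= fine (area B).
Proof.
move=> mA mB Boo AB.
have AleB : (area A <= area B)%E by apply: le_measure; rewrite ?inE.
apply: fine_le => //; rewrite ge0_fin_numE//; exact: (le_lt_trans AleB).
Qed.

Hypotheses (dK : convex_disc K) (hK : C2plus_boundary K) (rK : r_max K < r).

(** A cell of level j has sides of order 2^-j and 4^-j, hence probability of
    order 8^-j, and of order 2^j directions suffice to place one near the apex
    of every cap of height of order 4^-j. Given a family G of caps through a
    common point z, take the highest one: by [small_cell_in_cap] it contains
    its small cell S, and by [cap_in_large_cell] all caps of G are in the
    matching large cell S'. Caps below the height of level J are treated as
    caps of level J, for which the small cell may stick out. *)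
Theorem cap_covering :
  exists (N0 : nat) (q0 Cp : R) (S S' : forall j, net_index (N0 * 2 ^ j) -> set E),
  [/\ 0 < q0 <= 1 / 2, 0 < Cp,
   (forall j i, [/\ measurable (S j i), measurable (S' j i),
      q0 / 8 ^+ j <= uniform_prob (S j i) & uniform_prob (S' j i) <= Cp / 8 ^+ j]) &
   forall (J : nat) (G : set E) z, G !=set0 -> (forall c, G c -> cap K r c z) ->
     exists c j i, [/\ G c, (j <= J)%N, (j < J)%N -> S j i `<=` cap K r c &
       forall c', G c' -> cap K r c' `<=` S' j i]].
Proof.
have [cK vK iK] := dK.
have [R0 [rho [R0r rho0 roll]]] := rolling dK hK rK.
have outer x u : support K x u -> forall y, K y -> d2 y x <= 2 * R0 * ip x y u.
  by move=> /roll[].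
have inner x u : support K x u -> forall y, d2 y x <= 2 * rho * ip x y u -> K y.
  by move=> /roll[].
have K0 : K !=set0 by case: iK => x /interior_subset; exists x.
have mK : measurable K by exact: compact_measurable_plane.
have Koo := area_compact_lty cK K0.
have [D D0 hD] := compact_diameter cK K0.
have /andP[R00 rR] := R0r.
pose b : R := Num.min 1 (rho / 80).
have b0 : 0 < b := cell_width_gt0 rho0.
pose del : R := (40 * b + 8 * R0 + 1)^-1.
have del0 : 0 < del := net_step_gt0 R0r rho0.
pose eps (j : nat) : R := 4 * b / 2 ^+ j.
have eps0 j : 0 < eps j by rewrite divr_gt0 ?exprn_gt0// mulr_gt0.
have epsS j : eps j = 2 * eps j.+1.
  by rewrite /eps exprS; field; rewrite expf_neq0.
have eps_le j : eps j <= 4 * b.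
  rewrite /eps ler_pdivrMr ?exprn_gt0// -[leLHS]mulr1 ler_pM2l ?mulr_gt0//.
  by rewrite exprn_ege1// ler1n.
have eps3 j : eps j ^+ 3 = (4 * b) ^+ 3 / 8 ^+ j.
  rewrite /eps expr_div_n -exprM mulnC exprM; congr (_ / _ ^+ _).
  by rewrite -natrX.
pose w := del * (4 * b); have w0 : 0 < w by rewrite mulr_gt0// mulr_gt0.
pose N0 := (Num.truncn (2 / w)).+1.
have N0w : 2 <= N0%:R * w.
  by rewrite -ler_pdivrMr// ltW// /N0 truncnS_gt.
have Ngt0 j : (0 < N0 * 2 ^ j)%N by rewrite muln_gt0 expn_gt0.
have netP j u : unit_vector u ->
    exists i : net_index (N0 * 2 ^ j), d2 u (net_vector i) <= (del * eps j) ^+ 2.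
  move=> uu; have [i hi] := net_vector_dense (Ngt0 j) uu; exists i.
  apply: (le_trans hi); rewrite natrM natrX.
  have -> : del * eps j = w / 2 ^+ j by rewrite /eps /w !mulrA.
  have p2 : 0 < 2 ^+ j :> R by rewrite exprn_gt0.
  rewrite exprMn expr_div_n ler_pdivrMr ?mulr_gt0 ?exprn_gt0 ?ltr0n//.
  have -> : w ^+ 2 / (2 ^+ j) ^+ 2 * (N0%:R ^+ 2 * (2 ^+ j) ^+ 2) = (N0%:R * w) ^+ 2.
    by field; rewrite gt_eqF.
  by nra.
pose pt (u : E) := xget (0, 0) [set p | support K p u].
have ptP u : unit_vector u -> support K (pt u) u.
  by move=> uu; have [p hp] := exists_support cK K0 uu; apply: (@xgetPex _ _ [set p | support K p u]); exists p.
pose S j (i : net_index (N0 * 2 ^ j)) : set E := let v := net_vector i in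
  cell (net_flip i) (pt v) v (b * eps j) (eps j ^+ 2 / 8) (eps j ^+ 2 / 4).
pose C1 := r / (r - R0).
have C10 : 0 < C1 by rewrite divr_gt0; lra.
pose B := 8 * R0 * C1 + 1.
have B1 : 1 <= B by rewrite /B; have := mulr_gt0 R00 C10; lra.
have BC : 8 * R0 * C1 <= B by rewrite /B; lra.
pose B' := 2 * B + R0.
have B'0 : 0 < B' by rewrite /B'; lra.
(* X1 and X2 come from [cap_in_large_cell]; X3 and X4 let the large cells of level 0
   contain the whole of K, whose diameter is at most D *)
pose X1 := B + B'.
pose X2 := 4 * C1 + B' ^+ 2 / rho + B * B' / rho.
pose X3 := D / eps 0%N.
pose X4 := D / eps 0%N ^+ 2.
have X10 : 0 < X1 by rewrite /X1; lra.
have X20 : 0 < X2.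
  have := sqr_ge0 B' => h.
  have h1 : 0 <= B' ^+ 2 / rho by rewrite divr_ge0// ltW.
  have h2 : 0 <= B * B' / rho by rewrite divr_ge0 ?mulr_ge0 ?ltW//; lra.
  by rewrite /X2; lra.
have X30 : 0 <= X3 by rewrite divr_ge0// ltW.
have X40 : 0 <= X4 by rewrite divr_ge0// sqr_ge0.
pose C := X1 + X2 + X3 + X4.
have C0 : 0 < C by rewrite /C; lra.
pose S' j (i : net_index (N0 * 2 ^ j)) : set E := let v := net_vector i in
  cell (net_flip i) (pt v) v (C * eps j) 0 (C * eps j ^+ 2).
have slope j (i : net_index (N0 * 2 ^ j)) :
    1 / 2 <= `|(flip (net_flip i) (@net_vector R _ i)).2| <= 1.
  rewrite net_vector_slope /=.
  have := unit_vector_flip (net_flip i) (net_vector_unit (R := R) i).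
  rewrite /unit_vector => h.
  rewrite -(@ler_pXn2r _ 2%N) ?nnegrE// real_normK ?num_real// expr1n.
  by have := sqr_ge0 (flip (net_flip i) (@net_vector R _ i)).1; lra.
have SK j i : S j i `<=` K.
  move=> y Sy; have sp := ptP _ (net_vector_unit (R := R) i).
  have /andP[sl _] := slope j i.
  have eb : 0 < eps j <= 4 * b by rewrite eps0 eps_le.
  have := @small_cell_in_cap _ K r R0 rho R0r rho0 outer inner (net_flip i) _ _ _ _ (eps j) y sp sp sl eb.
  case => //; rewrite (_ : d2 _ _ = 0) ?sqr_ge0//.
  by rewrite /d2 !subrr expr0n /= addr0.
have areaS j i : b * eps j ^+ 3 / 4 <= fine (area (S j i)).
  have /andP[s1 s2] := slope j i.
  have e3 := exprn_gt0 3 (eps0 j).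
  have e2 := exprn_gt0 2 (eps0 j).
  rewrite /S area_cell /=; first last.
  - by rewrite -normr_gt0; lra.
  - by lra.
  - by rewrite mulr_ge0// ltW.
  move: s1 s2; set v2 := `|_| => s1 s2.
  rewrite mulrA ler_pdivlMr; last by lra.
  rewrite (_ : 2 * (b * eps j) * (eps j ^+ 2 / 4 - eps j ^+ 2 / 8) = b * eps j ^+ 3 / 4); last by field.
  by rewrite ger_pMr// divr_gt0// mulr_gt0.
have areaS' j i : fine (area (S' j i)) <= 4 * C ^+ 2 * eps j ^+ 3.
  have /andP[s1 s2] := slope j i.
  have e3 := exprn_gt0 3 (eps0 j).
  have e2 := exprn_gt0 2 (eps0 j).
  rewrite /S' area_cell /=; first last.
  - by rewrite -normr_gt0; lra.
  - by rewrite mulr_ge0// ltW.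
  - by rewrite mulr_ge0// ltW.
  move: s1 s2; set v2 := `|_| => s1 s2.
  rewrite mulrA ler_pdivrMr; last by lra.
  rewrite subr0 (_ : 2 * (C * eps j) * (C * eps j ^+ 2) = 2 * C ^+ 2 * eps j ^+ 3); last by ring.
  have c3 : 0 < C ^+ 2 * eps j ^+ 3 by rewrite mulr_gt0// exprn_gt0.
  by nra.
have mS j i : measurable (S j i) by exact: measurable_cell.
have mS' j i : measurable (S' j i) by exact: measurable_cell.
pose i0 : net_index (N0 * 2 ^ 0) := (false, false, false, Ordinal (Ngt0 0%N)).
have AK0 : 0 < fine (area K).
  apply: (@lt_le_trans _ _ (b * eps 0%N ^+ 3 / 4)).
    by rewrite divr_gt0// mulr_gt0// exprn_gt0.
  apply: (le_trans (areaS 0%N i0)); apply: area_subset_fine => //; exact: SK.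
have AKi : 0 <= (fine (area K))^-1 by rewrite invr_ge0 ltW.
pose q1 := b * (4 * b) ^+ 3 / 4 / fine (area K).
have q10 : 0 < q1 by rewrite !divr_gt0// mulr_gt0// exprn_gt0// mulr_gt0.
exists N0, (Num.min (1 / 2) q1), (4 * C ^+ 2 * (4 * b) ^+ 3 / fine (area K)), S, S'.
split.
- by rewrite lt_min q10 ge_min lexx /=; lra.
- by rewrite divr_gt0// !mulr_gt0// ?exprn_gt0// mulr_gt0.
- move=> j i; split => //.
    apply: (@le_trans _ _ (q1 / 8 ^+ j)).
      by rewrite ler_wpM2r ?invr_ge0 ?exprn_ge0// ge_min lexx orbT.
    rewrite /uniform_prob (_ : K `&` S j i = S j i); last by apply/setIidPr; exact: SK.
    rewrite /q1 mulrAC ler_wpM2r//.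
    by apply: le_trans (areaS j i); rewrite eps3 -!mulrA [4^-1 * _]mulrC.
  rewrite /uniform_prob mulrAC ler_wpM2r//.
  apply: (@le_trans _ _ (fine (area (S' j i)))).
    apply: area_subset_fine => //; first exact: measurableI.
    have /andP[s1 s2] := slope j i.
    rewrite /S' area_cell ?ltry//.
    - by rewrite mulr_ge0// ltW.
    - by rewrite mulr_ge0 ?sqr_ge0// ltW.
    - by rewrite -normr_gt0; lra.
  by apply: (le_trans (areaS' j i)); rewrite eps3 mulrA.
move=> J G z G0 Gz.
have frame c : G c -> exists x u h, cap_frame K r c x u h.
  by move=> /Gz; exact: (exists_cap_frame R0r cK).
(* the least level of a cap of G, cut off at J *)
pose lv (c : E) (j : nat) := exists x u h, cap_frame K r c x u h /\ eps j ^+ 2 <= h.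
pose P := [pred j : nat | (j == J) || `[< exists2 c, G c & lv c j >]].
have exP : exists j, P j by exists J; rewrite /= eqxx.
case: (ex_minnP exP) => j Pj jmin.
have jJ : (j <= J)%N by apply: jmin; rewrite /= eqxx.
have [c [x [u [h [Gc fc hj]]]]] : exists c x u h,
    [/\ G c, cap_frame K r c x u h & (j < J)%N -> eps j ^+ 2 <= h].
  move: Pj => /= /orP[/eqP jJ'|/asboolP[c Gc [x [u [h [fc hh]]]]]].
    case: G0 => c Gc; have [x [u [h fc]]] := frame c Gc.
    by exists c, x, u, h; split => //; rewrite jJ' ltnn.
  by exists c, x, u, h.
have [sx h0 _] := fc; have [Kx uu _] := sx.
have [i hi] := netP j u uu.
have sp := ptP _ (net_vector_unit (R := R) i).
have eb : 0 < eps j <= 4 * b by rewrite eps0 eps_le.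
have /andP[sl _] := slope j i.
exists c, j, i; split => //.
  move=> jltJ y Sy.
  have [Ky Dy] := small_cell_in_cap R0r rho0 outer inner sx sp sl eb hi Sy.
  apply: (cap_contains R0r fc Ky); apply: (lt_le_trans Dy).
  by rewrite ler_pM2r// hj.
move=> c' Gc' y cy.
have e2 := exprn_gt0 2 (eps0 j).
have enlarge (a be : R) : a <= C -> be <= C ->
    cell (net_flip i) (pt (net_vector i)) (net_vector i) (a * eps j) 0 (be * eps j ^+ 2) y ->
    S' j i y.
  move=> aC bC [h1 /andP[h2 h3]]; split.
    by apply: (le_trans h1); rewrite ler_pM2r.
  by rewrite h2 (le_trans h3)// ler_pM2r.
have Ky : K y by case: cy.
case: (posnP j) => [j0|j0].
  have [Kp uv sp'] := sp; have dyp := hD _ _ Ky Kp.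
  apply: (enlarge X3 X4); [by rewrite /C; lra|by rewrite /C; lra|].
  have ej : eps 0%N = eps j by rewrite j0.
  rewrite /X3 /X4 ej !divfK ?gt_eqF//; split; first exact: d2_coord_le.
  apply/andP; split; first by have := sp' y Ky; rewrite /ip; lra.
  have dpy := hD _ _ Kp Ky.
  have uv1 : (@net_vector R _ i).1 ^+ 2 + (@net_vector R _ i).2 ^+ 2 <= 1 ^+ 2 by rewrite uv expr1n.
  have := ip_le D0 ler01 dpy uv1.
  by rewrite mulr1 ler_norml => /andP[].
have low c1 x1 u1 h1 : G c1 -> cap_frame K r c1 x1 u1 h1 -> h1 <= 4 * eps j ^+ 2.
  move=> Gc1 f1; rewrite leNgt; apply/negP => hlt.
  have : (j <= j.-1)%N.
    apply: jmin; rewrite /= orbC; apply/orP; left; apply/asboolP; exists c1 => //.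
    exists x1, u1, h1; split => //; rewrite epsS prednK// exprMn.
    by rewrite -natrX ltW.
  by rewrite -ltnS prednK// ltnn.
have [x' [u' [h' fc']]] := frame c' Gc'.
apply: (enlarge X1 X2); [by rewrite /C; lra|by rewrite /C; lra|].
exact: (cap_in_large_cell R0r rho0 outer inner (net_flip i) B1 BC fc fc' sp (eps0 j) hi
  (low _ _ _ _ Gc fc) (low _ _ _ _ Gc' fc') (Gz _ Gc) (Gz _ Gc') cy). 
Qed.

End cap_covering.

(** * The hyperconvex hull and its vertices *)

Section hull.
Context {R : realType}.
Local Notation E := (R * R)%type.
Implicit Types (p q v x y a c : E).

Definition rat_point (c : rat * rat) : E := (ratr c.1, ratr c.2).

Lemma open_rat_point (U : set E) x : open U -> U x -> exists c : rat * rat, U (rat_point c).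
Proof.
move=> oU Ux; have /nbhs_ballP[e /= e0 he] := open_nbhs_nbhs (conj oU Ux).
have rat_near (t : R) : exists q : rat, `|t - ratr q| < e.
  have /rat_in_itvoo[q] : t - e < t + e by lra.
  by rewrite in_itv /= => /andP[q1 q2]; exists q; rewrite ltr_norml; lra.
have [q1 h1] := rat_near x.1; have [q2 h2] := rat_near x.2.
by exists (q1, q2); apply: he; split.
Qed.

Lemma open_d2_lt y (s : R) : open [set c | d2 c y < s].
Proof.
rewrite (_ : [set c | _] = d2 y @^-1` [set z | z < s]); last first.
  by apply/seteqP; split => c /=; rewrite d2C.
by apply: open_comp => // c _; exact: continuous_d2.
Qed.

Lemma open_d2_gt y (s : R) : open [set c | s < d2 c y].
Proof.
rewrite (_ : [set c | _] = d2 y @^-1` [set z | s < z]); last first.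
  by apply/seteqP; split => c /=; rewrite d2C.
by apply: open_comp => // c _; exact: continuous_d2.
Qed.

Lemma open_forall_ord n (U : 'I_n -> set E) : (forall j, open (U j)) ->
  open [set c | forall j, U j c].
Proof.
move=> oU; rewrite openE => c h.
have nU j : \forall z \near c, U j z by exact: open_nbhs_nbhs (conj (oU j) (h j)).
exact: (filter_forall _ nU).
Qed.

Lemma d2_segment_le c c' x (s A B : R) : 0 <= s <= 1 -> d2 c x <= A -> d2 c' x <= B ->
  d2 (move c s (c'.1 - c.1, c'.2 - c.2)) x <= (1 - s) * A + s * B.
Proof.
move=> /andP[s0 s1] h h'.
have -> : d2 (move c s (c'.1 - c.1, c'.2 - c.2)) x =
    (1 - s) * d2 c x + s * d2 c' x - s * (1 - s) * d2 c c'.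
  by rewrite /d2 /move /=; ring.
have : 0 <= s * (1 - s) * d2 c c' by rewrite !mulr_ge0 ?d2_ge0//; lra.
have : (1 - s) * d2 c x <= (1 - s) * A by rewrite ler_wpM2l//; lra.
have : s * d2 c' x <= s * B by rewrite ler_wpM2l.
lra.
Qed.

Lemma disc_d2E (r : R) : 0 <= r -> forall c x, disc r c x <-> d2 c x <= r ^+ 2.
Proof.
move=> r0 c x; rewrite /disc /= /euclid_dist -/(d2 c x).
by rewrite -[in X in _ <-> X](@sqr_sqrtr _ (d2 c x)) ?d2_ge0// ler_pXn2r ?nnegrE ?sqrtr_ge0.
Qed.

Lemma euclid_dist_eq (r : R) p v : 0 <= r -> euclid_dist p v = r <-> d2 p v = r ^+ 2.
Proof.
move=> r0; rewrite /euclid_dist -/(d2 p v); split=> [<-|->]; first by rewrite sqr_sqrtr ?d2_ge0.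
by rewrite sqrtr_sqr ger0_norm.
Qed.

(** The midpoint of the shorter arc of radius r around v between p and q is
    interior to every other disc of radius r containing p and q. *)
Lemma arc_midpoint (r : R) p q v : 0 < r -> p != q -> d2 p v = r ^+ 2 -> d2 q v = r ^+ 2 ->
  exists2 a, d2 a v = r ^+ 2 & forall y, y <> v -> d2 p y <= r ^+ 2 -> d2 q y <= r ^+ 2 ->
    d2 a y < r ^+ 2.
Proof.
move=> r0 pq pv qv.
pose m : E := ((p.1 + q.1) / 2, (p.2 + q.2) / 2).
have par y : d2 p y + d2 q y = 2 * d2 m y + d2 p q / 2.
  by rewrite /d2 /m /=; field.
have pq0 : 0 < d2 p q.
  by rewrite lt0r d2_ge0 andbT; apply: contra pq => /eqP/d2_eq0 ->.
have dm y : d2 p y <= r ^+ 2 -> d2 q y <= r ^+ 2 -> d2 m y <= d2 m v.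
  by have := par y; have := par v; lra.
have [mv|mv] := eqVneq (d2 m v) 0.
  exists p => // y yv h1 h2; exfalso; apply: yv.
  have mvE := d2_eq0 mv; have := dm y h1 h2; rewrite mv => my0.
  have /d2_eq0 <- : d2 m y = 0 by apply/eqP; rewrite eq_le my0 d2_ge0.
  by [].
pose d := Num.sqrt (d2 m v).
have d2E : d ^+ 2 = d2 m v by rewrite sqr_sqrtr ?d2_ge0.
have d0 : 0 < d by rewrite sqrtr_gt0 lt0r mv d2_ge0.
have dr : d < r.
  by rewrite -(@ltr_pXn2r _ 2%N) ?nnegrE ?ltW// d2E; have := par v; lra.
pose e : E := ((m.1 - v.1) / d, (m.2 - v.2) / d).
have eu : unit_vector e.
  by rewrite /unit_vector /= !expr_div_n -mulrDl d2E -/(d2 m v) divff.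
exists (move v r e).
  rewrite (_ : d2 _ _ = r ^+ 2 * (e.1 ^+ 2 + e.2 ^+ 2)); last by rewrite /d2 /move /=; ring.
  by rewrite eu mulr1.
move=> y yv h1 h2; have my := dm y h1 h2; rewrite -d2E in my.
have mE : move v d e = m.
  rewrite /move /= !(mulrC d) !divfK ?gt_eqF// /m /=.
  by congr pair; ring.
rewrite (_ : d2 (move v r e) y = (r - d) ^+ 2 * (e.1 ^+ 2 + e.2 ^+ 2) +
   2 * (r - d) * ip (move v d e) y e + d2 (move v d e) y); last first.
  by rewrite /d2 /ip /move /=; ring.
rewrite eu mulr1 mE.
have imy : ip m y e < d.
  rewrite ltNge; apply/negP => h; apply: yv.
  have : d2 y v <= 0.
    rewrite (_ : d2 y v = d2 (move v d e) y - 2 * d * ip (move v d e) y e +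
      d ^+ 2 * (e.1 ^+ 2 + e.2 ^+ 2)); last by rewrite /d2 /ip /move /=; ring.
    by rewrite mE eu mulr1; nra.
  by move=> h'; apply: d2_eq0; apply/eqP; rewrite eq_le h' d2_ge0.
nra.
Qed.

Variables (K : set E) (r R0 : R) (c0 : E).
Hypotheses (R0r : 0 < R0 < r) (Kc0 : forall x, K x -> d2 c0 x <= R0 ^+ 2).

Let r0 : 0 < r. Proof. by case/andP: R0r; lra. Qed.

Let R02 : R0 ^+ 2 < r ^+ 2.
Proof. by case/andP: R0r => h1 h2; rewrite ltr_pXn2r ?nnegrE ?ltW//; lra. Qed.

Section family.
Variable n : nat.
Implicit Types (X : 'I_n -> E) (J : {set 'I_n}).

(** The hull restricted to rational centres, hence a Borel function of the
    points; for points of K it is the hull itself, because the centres of the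
    discs that contain K leave room for an approximation. *)
Definition inhull J X y := forall c : rat * rat,
  (forall j, j \in J -> d2 (rat_point c) (X j) < r ^+ 2) -> d2 (rat_point c) y <= r ^+ 2.

Lemma inhullS J J' X y : J \subset J' -> inhull J X y -> inhull J' X y.
Proof. by move=> /fintype.subsetP JJ' h c hc; apply: h => j /JJ'; exact: hc. Qed.

(** A slight move of the centre c towards c0 makes the inequalities for the
    points of K strict, because R0 < r, and still excludes y; then a rational
    centre close by does both. *)
Lemma notin_hullP J X y : (forall j, j \in J -> K (X j)) ->
  ~ inhull J X y <-> exists2 c, (forall j, j \in J -> d2 c (X j) <= r ^+ 2) & r ^+ 2 < d2 c y.
Proof.
move=> Kx; split=> [/existsNP[c /not_implyP[h1 /negP h2]]|[c hc cy] h].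
  exists (rat_point c); last by rewrite ltNge.
  by move=> j jJ; exact/ltW/h1.
pose A := `|ip c y (c0.1 - c.1, c0.2 - c.2)|.
pose g := d2 c y - r ^+ 2; have g0 : 0 < g by rewrite subr_gt0.
have A0 : 0 <= A by exact: normr_ge0.
pose s := g / (2 * A + 1 + g).
have den : 0 < 2 * A + 1 + g by lra.
have sE : s * (2 * A + 1 + g) = g by rewrite divfK// gt_eqF.
have s0 : 0 < s by rewrite divr_gt0.
have s1 : s < 1 by rewrite ltr_pdivrMr//; lra.
pose cs := move c s (c0.1 - c.1, c0.2 - c.2).
pose U := [set z | forall j, j \in J -> d2 z (X j) < r ^+ 2] `&` [set z | r ^+ 2 < d2 z y].
have oU : open U.
  apply: openI; last exact: open_d2_gt.
  apply: (@open_forall_ord _ (fun j => [set z | j \in J -> d2 z (X j) < r ^+ 2])) => j.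
  have [jJ|jJ] := boolP (j \in J).
    rewrite (_ : [set z | _] = [set z | d2 z (X j) < r ^+ 2]); first exact: open_d2_lt.
    by apply/seteqP; split => z h' //=; exact: h'.
  rewrite (_ : [set z | _] = setT); first exact: openT.
  by apply/seteqP.
have Ucs : U cs.
  split=> [j jJ|].
    have s01 : 0 <= s <= 1 by lra.
    apply: (le_lt_trans (d2_segment_le s01 (hc j jJ) (Kc0 (Kx j jJ)))).
    by have := R02; nra.
  rewrite /= /cs (_ : d2 _ _ = d2 c y + 2 * s * ip c y (c0.1 - c.1, c0.2 - c.2) + s ^+ 2 * d2 c0 c); last first.
    by rewrite /d2 /ip /move /=; ring.
  have : 0 <= s ^+ 2 * d2 c0 c by rewrite mulr_ge0 ?sqr_ge0 ?d2_ge0.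
  have : - A <= ip c y (c0.1 - c.1, c0.2 - c.2) by rewrite lerNl /A -normrN ler_norm.
  by rewrite /g in sE; nra.
have [q [h1 h2]] := open_rat_point oU Ucs.
by have := h q h1; rewrite leNgt h2.
Qed.

Lemma inhullP J X y : (forall j, j \in J -> K (X j)) -> inhull J X y ->
  forall c, (forall j, j \in J -> d2 c (X j) <= r ^+ 2) -> d2 c y <= r ^+ 2.
Proof.
move=> Kx h c hc; rewrite leNgt; apply/negP => cy.
by apply: (proj2 (notin_hullP y Kx)) h; exists c.
Qed.

Lemma conv_rE X : (forall j, K (X j)) -> conv_r r (range X) = inhull [set: 'I_n]%SET X.
Proof.
move=> Kx; apply/seteqP; split=> y h.
  move=> c hc; apply/(disc_d2E (ltW r0)); apply: h => _ [j _ <-].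
  by apply/(disc_d2E (ltW r0)); exact/ltW/hc/finset.in_setT.
move=> c hc; apply/(disc_d2E (ltW r0)).
apply: (inhullP (fun j _ => Kx j) h) => j _.
by apply/(disc_d2E (ltW r0)); apply: hc; exists j.
Qed.

(** The centre a of [arc_midpoint] has v at distance r and the other points
    strictly nearer; a slight move away from v excludes v alone. *)
Let witness X v p q : (forall j, d2 p (X j) <= r ^+ 2) -> (forall j, d2 q (X j) <= r ^+ 2) ->
  p != q -> d2 p v = r ^+ 2 -> d2 q v = r ^+ 2 ->
  exists2 c, (forall j, X j <> v -> d2 c (X j) <= r ^+ 2) & r ^+ 2 < d2 c v.
Proof.
move=> hp hq pq pv qv; have [a av ha] := arc_midpoint r0 pq pv qv.
pose U := [set c | forall j, X j <> v -> d2 c (X j) < r ^+ 2].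
have oU : open U.
  apply: (@open_forall_ord _ (fun j => [set z | X j <> v -> d2 z (X j) < r ^+ 2])) => j.
  have [xv|xv] := pselect (X j = v).
    rewrite (_ : [set z | _] = setT); first exact: openT.
    by apply/seteqP; split => z // _ /(_ xv).
  rewrite (_ : [set z | _] = [set z | d2 z (X j) < r ^+ 2]); first exact: open_d2_lt.
  by apply/seteqP; split => z h' //=; exact: h'.
have Ua : U a by move=> j xv; exact: ha.
have iU : U° a by exact: (open_nbhs_nbhs (conj oU Ua)).
have [t t0 Ut] := interior_move (a.1 - v.1, a.2 - v.2) iU.
exists (move a t (a.1 - v.1, a.2 - v.2)).
  by move=> j xv; exact/ltW/Ut.
rewrite (_ : d2 _ v = (1 + t) ^+ 2 * d2 a v); last by rewrite /d2 /move /=; ring.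
by rewrite av; have := exprn_gt0 2 r0; nra.
Qed.

(** Move the centre from c to m and stop when X k enters the disc. *)
Let segment_crossing X k c m : (forall j, j != k -> d2 c (X j) <= r ^+ 2) ->
  r ^+ 2 < d2 c (X k) -> (forall j, d2 m (X j) <= r ^+ 2) ->
  exists s : R, [/\ 0 < s, (forall j, d2 (move c s (m.1 - c.1, m.2 - c.2)) (X j) <= r ^+ 2) &
    d2 (move c s (m.1 - c.1, m.2 - c.2)) (X k) = r ^+ 2].
Proof.
move=> hc ck hm.
pose f (s : R) := d2 (X k) (move c s (m.1 - c.1, m.2 - c.2)).
have cf : continuous f.
  have e1 : f = fun s : R => (d2 c m * s + 2 * ip c (X k) (m.1 - c.1, m.2 - c.2)) * s + d2 (X k) c.
    by apply/funext => s; rewrite /f /d2 /ip /move /=; ring.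
  rewrite e1 => s; apply: cvgD; last exact: cvg_cst.
  by apply: cvgM; [apply: cvgD; [apply: cvgM; [exact: cvg_cst|]|exact: cvg_cst]|].
have f0 : f 0 = d2 c (X k) by rewrite /f d2C /d2 /move /= !mul0r !addr0.
have f1 : f 1 = d2 m (X k) by rewrite /f d2C /d2 /move /= !mul1r ![_ + (_ - _)]addrC !subrK.
have [|s] := IVT ler01 (continuous_subspaceT cf) (v := r ^+ 2).
  by rewrite f0 f1 ge_min le_max hm (ltW ck) orbT.
rewrite in_itv /= => s01 fs.
have ds : d2 (move c s (m.1 - c.1, m.2 - c.2)) (X k) = r ^+ 2 by rewrite d2C.
exists s; split => //.
  have : s != 0 by apply/eqP => s0; rewrite s0 f0 in fs; rewrite fs ltxx in ck.
  by rewrite lt0r => ->; case/andP: s01.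
move=> j; have [->|jk] := eqVneq j k; first by rewrite ds.
apply: (le_trans (d2_segment_le s01 (hc j jk) (hm j))); lra.
Qed.

(** A vertex v lies on two circles, so [witness] excludes it from a disc with
    all the points other than v: v is therefore one of the points, and outside
    the hull of the others. Conversely, a disc that excludes X k alone is moved
    towards two different centres, and stopped each time when X k enters it. *)
Lemma verticesE X : (forall j, K (X j)) -> injective X ->
  vertices r (conv_r r (range X)) = X @` [set k | ~ inhull (~: [set k])%SET X (X k)].
Proof.
move=> Kx xinj.
have hull_disc p : conv_r r (range X) `<=` disc r p <-> forall j, d2 p (X j) <= r ^+ 2.
  split=> [h j|h y].
    apply/(disc_d2E (ltW r0)); apply: h => c; apply; by exists j.
  by apply => _ [j _ <-]; apply/(disc_d2E (ltW r0)).
apply/seteqP; split=> [v|_ [k nk <-]].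
  move=> [Pv [p [q [pq /hull_disc hp /hull_disc hq]]]].
  move=> /(euclid_dist_eq _ _ (ltW r0)) pv /(euclid_dist_eq _ _ (ltW r0)) qv.
  have [c hc cv] := witness hp hq pq pv qv.
  have [k xk] : exists k, X k = v.
    apply: contrapT => nv; have : d2 c v <= r ^+ 2.
      apply/(disc_d2E (ltW r0)); apply: Pv => _ [j _ <-].
      by apply/(disc_d2E (ltW r0)); apply: hc => xv; apply: nv; exists j.
    by rewrite leNgt cv.
  exists k => //=; apply/notin_hullP => //; exists c; last by rewrite xk.
  move=> j; rewrite !finset.inE => jk; apply: hc => xv.
  by move/eqP: jk; apply; apply: xinj; rewrite xk.
have [c hc ck] := (proj1 (notin_hullP (X k) (fun j _ => Kx j))) nk.
have {}hc j : j != k -> d2 c (X j) <= r ^+ 2 by move=> jk; apply: hc; rewrite !finset.inE.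
have m1 j : d2 c0 (X j) <= r ^+ 2 by apply: (le_trans (Kc0 (Kx j))); exact: ltW.
(* w is orthogonal to c0 - c: moved along w, c0 gives a target in another direction *)
pose w : E := (- (c0.2 - c.2), c0.1 - c.1).
have w0 : 0 < d2 c0 c.
  rewrite lt0r d2_ge0 andbT; apply/eqP => /d2_eq0 e; move: ck; rewrite -e.
  by rewrite ltNge m1.
have [tau tau0 htau] : exists2 tau : R, 0 < tau & forall j, d2 (move c0 tau w) (X j) <= r ^+ 2.
  pose U := [set c | forall j, d2 c (X j) < r ^+ 2].
  have oU : open U.
    by apply: (@open_forall_ord _ (fun j => [set z | d2 z (X j) < r ^+ 2])) => j; exact: open_d2_lt.
  have Uc0 : U c0 by move=> j; apply: (le_lt_trans (Kc0 (Kx j))).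
  have iU : U° c0 by exact: (open_nbhs_nbhs (conj oU Uc0)).
  have [t t0 Ut] := interior_move w iU.
  by exists t => // j; exact/ltW/Ut.
have [s1 [s10 p1 p1k]] := segment_crossing hc ck m1.
have [s2 [s20 p2 p2k]] := segment_crossing hc ck htau.
split; first by move=> d; apply; exists k.
exists (move c s1 (c0.1 - c.1, c0.2 - c.2)),
  (move c s2 ((move c0 tau w).1 - c.1, (move c0 tau w).2 - c.2)); split.
- apply/eqP; rewrite /move /w /= => -[/addrI e1 /addrI e2].
  have : s2 * tau * d2 c0 c = 0.
    have -> : s2 * tau * d2 c0 c =
      (c0.1 - c.1) * (s2 * (c0.2 + tau * (c0.1 - c.1) - c.2)) -
      (c0.2 - c.2) * (s2 * (c0.1 + tau * - (c0.2 - c.2) - c.1)) by rewrite /d2; ring.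
    by rewrite -e1 -e2; ring.
  by apply/eqP; rewrite gt_eqF// !mulr_gt0.
- exact/hull_disc.
- exact/hull_disc.
- exact/(euclid_dist_eq _ _ (ltW r0)).
- exact/(euclid_dist_eq _ _ (ltW r0)).
Qed.

Lemma f_0E X : (forall j, K (X j)) -> injective X ->
  f_0 r (conv_r r (range X)) =
  (\sum_(k < n) `[< ~ inhull (~: [set k])%SET X (X k) >])%N.
Proof.
move=> Kx xinj; rewrite /f_0 verticesE//.
set A := [set k | _].
rewrite fset_set_image; last exact: finite_finset.
rewrite card_imfset//=.
have -> : (\sum_(k < n) `[< ~ inhull (~: [set k])%SET X (X k) >])%N =
    #|[pred k | `[< ~ inhull (~: [set k])%SET X (X k) >]]|.
  by rewrite -sum1_card [RHS]big_mkcond /=; apply: eq_bigr => k _; rewrite !inE; case: asboolP.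
rewrite cardE; apply: perm_size; apply: uniq_perm; [exact: fset_uniq|exact: enum_uniq|].
move=> k; rewrite mem_enum inE /= in_fset_set; last exact: finite_finset.
by apply/idP/asboolP; rewrite inE.
Qed.

End family.
End hull.

(** * Measurability of the hull *)

(** The restriction of m to K is a finite measure, for which sections are
    measurable. *)
Lemma measurable_section_measure {R : realType} d0 d (T0 : measurableType d0)
    (T : measurableType d) (m : {measure set T -> \bar R}) (K : set T) (Z : set (T0 * T)) :
  measurable K -> (m K < +oo)%E -> measurable Z ->
  measurable_fun setT (fun x => m (K `&` xsection Z x)).
Proof.
move=> mK Koo mZ.
have finK : fin_num_fun (mrestr m mK).
  move=> A mA; rewrite ge0_fin_numE//; apply: le_lt_trans Koo.
  by apply: le_measure; rewrite ?inE//; exact: measurableI.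
pose mu : {finite_measure set T -> \bar R} :=
  HB.pack (mrestr m mK) (Measure_isFinite.Build _ _ _ (mrestr m mK) finK).
have := measurable_fun_xsection mu mZ.
by congr (measurable_fun _ _); apply/funext => x; rewrite /mu /= /mrestr setIC.
Qed.

Section hull_measurability.
Context {R : realType}.
Local Notation E := (R * R)%type.
Variables (r : R) (n : nat).
Implicit Type J : {set 'I_n}.

Lemma measurable_d2 (p : E) : measurable_fun setT (d2 p).
Proof.
apply: measurable_funD; apply: measurable_funX; exact: measurable_funB.
Qed.

Lemma measurable_inhull d (T : measurableType d) J (f : T -> n.-tuple E) (g : T -> E) :
  measurable_fun setT f -> measurable_fun setT g ->
  measurable [set w | inhull r J (tnth (f w)) (g w)].
Proof.
move=> mf mg.
have mj j : measurable_fun setT (fun w => tnth (f w) j).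
  exact: (measurableT_comp (measurable_tnth j) mf).
pose A c := \bigcap_(j in [set j | j \in J]) [set w | d2 (rat_point c) (tnth (f w) j) \in `]-oo, (r ^+ 2)[%R].
pose B c := [set w | d2 (rat_point c) (g w) \in `]-oo, (r ^+ 2)]%R].
rewrite (_ : [set w | _] = ~` \bigcup_c (A c `&` ~` B c)).
  apply: measurableC; apply: countable_bigcupT_measurable => // c.
  apply: measurableI; last first.
    apply: measurableC; apply: measurable_preimage_itv.
    exact: (measurableT_comp (measurable_d2 _) mg).
  apply: fin_bigcap_measurable; first exact: finite_finset.
  move=> j _; apply: measurable_preimage_itv.
  exact: (measurableT_comp (measurable_d2 _) (mj j)).
apply/seteqP; split=> [w h [c _ [hA hB]]|w h c hc].
  apply: hB; rewrite /B /= in_itv /=; apply: h => j jJ.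
  by have := hA j jJ; rewrite /= in_itv.
apply: contrapT => /negP hB; apply: h; exists c => //; split.
  by move=> j jJ; rewrite /= in_itv /=; exact: hc.
by rewrite /B /= in_itv /=; exact/negP.
Qed.

Variable K : set E.
Hypotheses (mK : measurable K) (Koo : (area K < +oo)%E).

(** Intersecting with K keeps the area finite when some point of t is outside
    K. *)
Definition hull_area J (t : n.-tuple E) : R :=
  fine (area (K `&` [set y | inhull r J (tnth t) y])).

Lemma bounded_meas_hull_area J : bounded_meas (hull_area J).
Proof.
pose Z := [set z : n.-tuple E * E | inhull r J (tnth z.1) z.2].
have mZ : measurable Z by exact: measurable_inhull.
have e t : hull_area J t = fine (area (K `&` xsection Z t)).
  congr (fine (area _)); apply/seteqP; split => y; rewrite /xsection /= inE //.
have mH t : measurable (K `&` [set y | inhull r J (tnth t) y]).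
  by apply: measurableI => //; apply: measurable_inhull.
split.
  rewrite (funext e); apply: (measurableT_comp (fine_measurable _)) => //.
  exact: (measurable_section_measure (m := (@lebesgue_measure R \x @lebesgue_measure R)%E) mK Koo mZ).
exists (fine (area K)) => t; rewrite ger0_norm ?fine_ge0//.
by apply: area_subset_fine => //; exact: subIsetl.
Qed.

Lemma bounded_meas_notin_hull J (k : 'I_n) :
  bounded_meas (fun t : n.-tuple E => `[< ~ inhull r J (tnth t) (tnth t k) >]%:R : R).
Proof.
rewrite (_ : (fun t => _) = \1_(~` [set t | inhull r J (tnth t) (tnth t k)])).
  apply: bounded_meas_indic; apply: measurableC; apply: measurable_inhull => //.
  exact: measurable_tnth.
by apply/funext => t; rewrite indicE in_setC /= asbool_neg; congr (~~ _)%:R.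
Qed.

End hull_measurability.

(** * The change caused by the deletion of a point *)

Section hull_in_body.
Context {R : realType}.
Local Notation E := (R * R)%type.
Variables (K : set E) (r : R).
Hypotheses (dK : convex_disc K) (hK : C2plus_boundary K) (rK : r_max K < r).

(** The outer disc at any boundary point; c0 is the centre towards which other
    centres are moved. *)
Lemma enclosing_center : exists R0 c0, 0 < R0 < r /\ forall x, K x -> d2 c0 x <= R0 ^+ 2.
Proof.
have [cK vK iK] := dK; have [R0 [rho [R0r _ roll]]] := rolling dK hK rK.
have K0 : K !=set0 by case: iK => x /interior_subset; exists x.
have uu : @unit_vector R (1, 0) by rewrite /unit_vector /= expr1n expr0n addr0.
have [p sp] := exists_support cK K0 uu; have [out _] := roll _ _ sp.
exists R0, (move p (- R0) (1, 0)); split => // x Kx.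
rewrite (_ : d2 _ x = d2 x p - 2 * R0 * ip p x (1, 0) + R0 ^+ 2); last first.
  by rewrite /d2 /ip /move /=; ring.
by have := out x Kx; lra.
Qed.

(** A point outside K is excluded by the disc of radius r tangent to K at its
    metric projection: this disc contains K, since R0 < r. *)
Lemma inhull_subset n (X : 'I_n -> E) (J : {set 'I_n}) y :
  (forall j, j \in J -> K (X j)) -> inhull r J X y -> K y.
Proof.
move=> KX hy; apply: contrapT => Ky.
have [cK vK iK] := dK; have [R0 [rho [R0r _ roll]]] := rolling dK hK rK.
have K0 : K !=set0 by case: iK => x /interior_subset; exists x.
have /andP[R00 rR] := R0r.
have [R1 [c0 [R1r hc0]]] := enclosing_center.
have [p [u [t [sp t0 yE _]]]] := nearest_support cK vK K0 Ky.
have [_ uu sup] := sp; have [out _] := roll _ _ sp.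
have in_disc x : K x -> d2 (move p (- r) u) x <= r ^+ 2.
  move=> Kx; rewrite (_ : d2 _ x = d2 x p - 2 * r * ip p x u + r ^+ 2 * (u.1 ^+ 2 + u.2 ^+ 2)); last first.
    by rewrite /d2 /ip /move /=; ring.
  rewrite uu mulr1; have := out x Kx; have := sup x Kx.
  rewrite (_ : ip x p u = - ip p x u); last by rewrite /ip; ring.
  by nra.
have : d2 (move p (- r) u) y <= r ^+ 2.
  by apply: (inhullP R1r hc0 KX hy) => j jJ; exact/in_disc/KX.
rewrite yE (_ : d2 _ _ = (r + t) ^+ 2 * (u.1 ^+ 2 + u.2 ^+ 2)); last first.
  by rewrite /d2 /move /=; ring.
by rewrite uu mulr1; nra.
Qed.

End hull_in_body.

Section differences.
Context {R : realType}.
Local Notation E := (R * R)%type.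
Variables (K : set E) (r : R).
Hypotheses (dK : convex_disc K) (hK : C2plus_boundary K) (rK : r_max K < r).
Variables (N0 : nat) (S S' : forall j, net_index (N0 * 2 ^ j) -> set E).
Hypothesis mS' : forall j i, measurable (@S' j i).
Hypothesis cover : forall (J : nat) (G : set E) z, G !=set0 ->
  (forall c, G c -> cap K r c z) ->
  exists c j i, [/\ G c, (j <= J)%N, (j < J)%N -> @S j i `<=` cap K r c &
    forall c', G c' -> cap K r c' `<=` @S' j i].
Variables (n J : nat).
Implicit Types (X : 'I_n -> E) (I : {set 'I_n}) (i k l m : 'I_n).

(** The last level collects all the lower caps, which need not contain the
    small cell: there the points outside I are unconstrained. *)
Definition cell_event j (a : net_index (N0 * 2 ^ j)) I X :=
  forall m, if m \in I then @S' j a (X m) else (j < J)%N -> ~ @S j a (X m).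

(** The deletion of x_i matters to x_k in two ways: k = i and x_i itself is a
    vertex, or x_k becomes a vertex. *)
Definition affected_vertex i k X := if k == i then ~ inhull r (~: [set i])%SET X (X i)
  else ~ inhull r (~: [set i; k])%SET X (X k) /\ inhull r (~: [set k])%SET X (X k).

(** Let a disc contain the points other than x_i and x_k, but not x_k. If it
    contained x_i, it would contain x_k as well, since x_k is in the hull of
    all the others. *)
Let affected_vertex_cap i k X : (forall m, K (X m)) -> affected_vertex i k X ->
  exists c, [/\ cap K r c (X i), cap K r c (X k) &
    forall m, m != i -> m != k -> ~ cap K r c (X m)].
Proof.
move=> KX; have [R0 [c0 [R0r hc0]]] := enclosing_center dK hK rK.
rewrite /affected_vertex; have [->|ki] := eqVneq k i.
  move=> /(notin_hullP R0r hc0 _ (fun j _ => KX j))[c hc ci]; exists c; split => //.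
  move=> m mi _ [_]; rewrite ltNge hc//; by rewrite !finset.inE.
move=> [/(notin_hullP R0r hc0 _ (fun j _ => KX j))[c hc ck] hk]; exists c; split => //.
  split => //; rewrite ltNge; apply/negP => ci.
  have : d2 c (X k) <= r ^+ 2.
    apply: (inhullP R0r hc0 (fun j _ => KX j) hk) => j; rewrite !finset.inE => jk.
    have [->//|ji] := eqVneq j i.
    by apply: hc; rewrite !finset.inE negb_or ji.
  by rewrite leNgt ck.
by move=> m mi mk [_]; rewrite ltNge hc// !finset.inE negb_or mi.
Qed.

(** The two caps both contain x_i, so the covering applies to the pair. *)
Lemma affected_vertices_event i k l X : (forall m, K (X m)) ->
  affected_vertex i k X -> affected_vertex i l X ->
  exists j a, (j <= J)%N /\ @cell_event j a [set i; k; l]%SET X.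
Proof.
move=> KX /(affected_vertex_cap KX)[c [ci ck hc]] /(affected_vertex_cap KX)[c' [ci' cl hc']].
have [| |d [j [a [Gd jJ Sd S'd]]]] := @cover J [set z | z = c \/ z = c'] (X i).
- by exists c; left.
- by move=> z [->|->].
exists j, a; split => // m; rewrite !finset.inE.
case: ifPn => [/orP[/orP[/eqP ->|/eqP ->]|/eqP ->]|].
- by apply: (S'd c) => //; left.
- by apply: (S'd c) => //; left.
- by apply: (S'd c') => //; right.
rewrite !negb_or => /andP[/andP[mi mk] ml] /Sd Sdm /Sdm.
by case: Gd => ->; [exact: hc|exact: hc'].
Qed.

Definition vertex_count X : R := \sum_k `[< ~ inhull r (~: [set k])%SET X (X k) >]%:R.

Definition vertex_count_without i X : R :=
  \sum_(k | k != i) `[< ~ inhull r (~: [set i; k])%SET X (X k) >]%:R.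

(** The deletion loses x_i and otherwise only creates vertices, so the change
    is at most the number of k with [affected_vertex]; the square counts
    pairs. *)
Lemma sqr_vertex_diff_le i X :
  (vertex_count X - vertex_count_without i X) ^+ 2 <=
  \sum_k \sum_l `[< affected_vertex i k X /\ affected_vertex i l X >]%:R.
Proof.
pose b k : R := `[< affected_vertex i k X >]%:R.
have b0 k : 0 <= b k by [].
have -> : \sum_k \sum_l `[< affected_vertex i k X /\ affected_vertex i l X >]%:R = (\sum_k b k) ^+ 2 :> R.
  rewrite expr2 mulr_suml; apply: eq_bigr => k _; rewrite mulr_sumr; apply: eq_bigr => l _.
  by rewrite /b -natrM mulnb asbool_and.
rewrite -real_normK ?num_real// ler_pXn2r ?nnegrE ?sumr_ge0//.
have -> : vertex_count X - vertex_count_without i X = b i - \sum_(k | k != i) b k.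
  rewrite /vertex_count (bigD1 i)//= -addrA; congr (_ + _).
    by rewrite /b /affected_vertex eqxx.
  rewrite /vertex_count_without -sumrB -sumrN; apply: eq_bigr => k ki.
  rewrite /b /affected_vertex (negbTE ki).
  set P := inhull r (~: [set k])%SET X (X k); set Q := inhull r (~: [set i; k])%SET X (X k).
  have QP : Q -> P.
    apply: inhullS; apply/fintype.subsetP => m; rewrite !finset.inE.
    by apply: contra => /eqP ->; rewrite eqxx orbT.
  have [hP|hP] := pselect P; have [hQ|hQ] := pselect Q.
  - by rewrite !asboolF ?subrr ?oppr0//; tauto.
  - by rewrite (@asboolF (~ P)) ?(@asboolT (~ Q)) ?asboolT ?sub0r//; tauto.
  - by have := hP (QP hQ).
  - by rewrite (@asboolT (~ P)) ?(@asboolT (~ Q)) ?asboolF ?subrr ?oppr0//; tauto.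
rewrite [leRHS](bigD1 i)//=; apply: (le_trans (ler_normB _ _)).
by rewrite !ger0_norm ?sumr_ge0.
Qed.

Lemma sqr_vertex_diff_cells i X : (forall m, K (X m)) ->
  (vertex_count X - vertex_count_without i X) ^+ 2 <=
  \sum_(j < J.+1) \sum_a \sum_k \sum_l `[< @cell_event j a [set i; k; l]%SET X >]%:R.
Proof.
move=> KX; apply: (le_trans (sqr_vertex_diff_le i X)).
under [leRHS]eq_bigr => j _ do rewrite exchange_big.
rewrite [leRHS]exchange_big; apply: ler_sum => k _ /=.
under [leRHS]eq_bigr => j _ do rewrite exchange_big.
rewrite [leRHS]exchange_big; apply: ler_sum => l _ /=.
case: asboolP => [[hk hl]|_]; last by rewrite !sumr_ge0// => j _; rewrite sumr_ge0.
have [j [a [jJ ev]]] := affected_vertices_event KX hk hl.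
have jJ1 : (j < J.+1)%N by [].
rewrite (bigD1 (Ordinal jJ1))//= (bigD1 a)//= asboolT// -addrA lerDl.
by rewrite addr_ge0 ?sumr_ge0// => j' _; rewrite sumr_ge0.
Qed.

(** A point lost by the deletion of x_i lies in a cap that contains x_i and no
    other point of the sample. All these caps share x_i, so the covering puts
    the lost region into a single large cell. *)
Lemma sqr_area_diff_cells i X : (forall m, K (X m)) ->
  (fine (area (K `&` [set y | inhull r [set: 'I_n]%SET X y])) -
   fine (area (K `&` [set y | inhull r (~: [set i])%SET X y]))) ^+ 2 <=
  \sum_(j < J.+1) \sum_a fine (area (K `&` @S' j a)) ^+ 2 *
     `[< @cell_event j a [set i]%SET X >]%:R.
Proof.
move=> KX; have [R0 [c0 [R0r hc0]]] := enclosing_center dK hK rK.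
have [cK vK iK] := dK.
have K0 : K !=set0 by case: iK => x /interior_subset; exists x.
have mK : measurable K by exact: compact_measurable_plane.
have Koo := area_compact_lty cK K0.
have rhs0 j a : 0 <= fine (area (K `&` @S' j a)) ^+ 2 * `[< @cell_event j a [set i]%SET X >]%:R.
  by rewrite mulr_ge0// sqr_ge0.
pose H (I : {set 'I_n}) := K `&` [set y | inhull r I X y].
rewrite -!/(H _).
have mH I : measurable (H I).
  apply: measurableI => //; pose t := [tuple X m | m < n].
  rewrite (_ : [set y | _] = [set y | inhull r I (tnth t) y]); first exact: measurable_inhull.
  by congr (fun f => [set y | inhull r I f y]); apply/funext => m; rewrite tnth_mktuple.
have Hoo I : (area (H I) < +oo)%E.
  apply: le_lt_trans Koo; apply: le_measure; rewrite ?inE//; first exact: mH.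
  exact: subIsetl.
have Hsub : H (~: [set i])%SET `<=` H [set: 'I_n]%SET.
  by move=> y [Ky hy]; split => //; apply: inhullS hy; exact: finset.subsetT.
have le1 : fine (area (H (~: [set i])%SET)) <= fine (area (H [set: 'I_n]%SET)).
  exact: area_subset_fine.
have [sub|nsub] := pselect (H [set: 'I_n]%SET `<=` H (~: [set i])%SET).
  have -> : H [set: 'I_n]%SET = H (~: [set i])%SET by apply/seteqP.
  by rewrite subrr expr0n /= sumr_ge0// => j _; rewrite sumr_ge0.
pose G := [set c | (forall m, m != i -> d2 c (X m) <= r ^+ 2) /\ cap K r c (X i)].
have Gex y : H [set: 'I_n]%SET y -> ~ H (~: [set i])%SET y -> exists2 c, G c & cap K r c y.
  move=> [Ky hy] nhy.
  have : ~ inhull r (~: [set i])%SET X y by move=> h; apply: nhy.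
  move=> /(notin_hullP R0r hc0 _ (fun j _ => KX j))[c hc cy].
  have hcm m : m != i -> d2 c (X m) <= r ^+ 2 by move=> mi; apply: hc; rewrite !finset.inE.
  exists c => //; split => //; split => //; rewrite ltNge; apply/negP => ci.
  have : d2 c y <= r ^+ 2.
    apply: (inhullP R0r hc0 (fun j _ => KX j) hy) => m _.
    by have [->//|mi] := eqVneq m i; exact: hcm.
  by rewrite leNgt cy.
have [y0 hy0 nhy0] : exists2 y, H [set: 'I_n]%SET y & ~ H (~: [set i])%SET y.
  by move: nsub => /existsNP[y /not_implyP[h1 h2]]; exists y.
have [c1 Gc1 cy1] := Gex _ hy0 nhy0.
have [| |d [j [a [Gd jJ Sd S'd]]]] := @cover J G (X i).
- by exists c1.
- by move=> c [].
have ev : @cell_event j a [set i]%SET X.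
  move=> m; rewrite !finset.inE; case: eqVneq => [->|mi]; first by apply: (S'd d) => //; case: Gd.
  by move=> /Sd SS /SS [_]; rewrite ltNge; case: Gd => -> //.
have sub : H [set: 'I_n]%SET `<=` H (~: [set i])%SET `|` (K `&` @S' j a).
  move=> y hy; have [h|h] := pselect (H (~: [set i])%SET y); first by left.
  by have [c Gc cy] := Gex y hy h; right; split; [case: hy|exact: S'd cy].
have mKS : measurable (K `&` @S' j a) by exact: measurableI.
have KSoo : (area (K `&` @S' j a) < +oo)%E.
  by apply: le_lt_trans Koo; apply: le_measure; rewrite ?inE//; exact: subIsetl.
have le2 : fine (area (H [set: 'I_n]%SET)) <=
    fine (area (H (~: [set i])%SET)) + fine (area (K `&` @S' j a)).
  rewrite -fineD ?ge0_fin_numE//; apply: fine_le.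
  - by rewrite ge0_fin_numE.
  - by rewrite fin_numD !ge0_fin_numE// Hoo KSoo.
  apply: (@le_trans _ _ (area (H (~: [set i])%SET `|` (K `&` @S' j a)))).
    by apply: le_measure; rewrite ?inE//; [exact: mH|apply: measurableU => //; exact: mH].
  by apply: measureU2 => //; exact: mH.
have jJ1 : (j < J.+1)%N by [].
rewrite (bigD1 (Ordinal jJ1))//= (bigD1 a)//= asboolT// mulr1.
apply: (@le_trans _ _ (fine (area (K `&` @S' j a)) ^+ 2)); last first.
  by rewrite -addrA lerDl addr_ge0 ?sumr_ge0// => j' _; rewrite sumr_ge0.
by rewrite ler_pXn2r ?nnegrE ?subr_ge0// ?fine_ge0// lerBlDl.
Qed.

End differences.

(** * Uniform samples *)

Lemma measurable_coincidence {R : realType} d (T : measurableType d) (f g : T -> R * R) :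
  measurable_fun setT f -> measurable_fun setT g -> measurable [set w | f w = g w].
Proof.
move=> mf mg; have m2 : measurable_fun setT (fun w => d2 (f w) (g w)).
  by apply: measurable_funD; apply: measurable_funX; apply: measurable_funB;
    exact: measurableT_comp.
rewrite (_ : [set w | _] = setT `&` (fun w => d2 (f w) (g w)) @^-1` [set 0]).
  exact: m2.
rewrite setTI; apply/seteqP; split=> w /= => [->|/d2_eq0//]; rewrite /d2; ring.
Qed.

Section uniform_sample.
Context {R : realType} {d : measure_display} {T : measurableType d}.
Local Notation E := (R * R)%type.
Variables (P : probability T R) (n : nat) (X : 'I_n -> {RV P >-> E}) (K : set E).
Hypotheses (iX : independent X) (uX : forall i, uniform_on K (X i)).
Hypothesis mK : measurable K.
Implicit Types (i k l m : 'I_n) (A B : set E).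

Let measurable_preim (x : {RV P >-> E}) A : measurable A -> measurable (x @^-1` A).
Proof. by move=> mA; rewrite -[X in measurable X]setTI; exact: (measurable_funPT x). Qed.

(** Otherwise the law would have total mass 0. *)
Lemma area_uniform_neq0 i : fine (area K) != 0.
Proof.
apply/eqP => K0; have /(_ _ measurableT) := uX i.
by rewrite preimage_setT probability_setT K0 invr0 mulr0 /= => /eqP; rewrite oner_eq0.
Qed.

Lemma uniform_null i A : measurable A -> area (K `&` A) = 0%E -> P (X i @^-1` A) = 0%E.
Proof.
move=> mA KA; rewrite -[LHS]fineK; last exact/fin_num_measure/measurable_preim.
by rewrite uX// KA /= mul0r.
Qed.

Lemma uniform_outside_null i : P (X i @^-1` ~` K) = 0%E.
Proof. by apply: uniform_null; [exact: measurableC|rewrite setICr /area measure0]. Qed.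

(** By independence the law of (X k, X l) is the product of the laws, and the
    sections of the diagonal are points, which have area 0. *)
Lemma coincidence_null k l : k != l -> P [set w | X k w = X l w] = 0%E.
Proof.
move=> kl.
have mY : measurable_fun setT (fun w => (X k w, X l w)).
  by apply/measurable_fun_pairP; split; exact: measurable_funPT.
pose Y : {RV P >-> (E * E)%type} := HB.pack (fun w => (X k w, X l w))
  (isMeasurableFun.Build _ _ _ _ (fun w => (X k w, X l w)) mY).
pose D := [set z : E * E | z.1 = z.2].
have mD : measurable D by exact: measurable_coincidence.
rewrite (_ : P _ = distribution P Y D)//.
rewrite -(@product_measure_unique _ _ _ _ _ (distribution P (X k)) (distribution P (X l))
  (distribution P Y))//.
  rewrite /product_measure1 /= integral0_eq// => x _ /=.
  rewrite (_ : xsection D x = [set x]).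
    have mx : measurable [set x].
      exact: (measurable_coincidence (f := id) (g := cst x)).
    apply: uniform_null => //.
    apply/eqP; rewrite -measure_le0 -(area_set1 x); apply: le_measure; rewrite ?inE//.
    exact: measurableI.
  by apply/seteqP; split=> y; rewrite /xsection /= inE /D /=.
move=> A B mA mB.
have mAB i : measurable (if i == k then A else B) by case: ifP.
have := iX [set k; l]%SET mAB; rewrite (big_setD1 k) ?finset.set21//= eqxx (big_setD1 l)/=; last first.
  by rewrite !finset.inE eq_sym kl eqxx orbT.
rewrite eq_sym (negbTE kl) (_ : _ :\ k :\ l = finset.set0)%SET; last first.
  by apply/setP => m; rewrite !finset.inE; case: eqP; case: eqP.
rewrite big_set0 mulr1 => e.
have mAB' : measurable (X k @^-1` A `&` X l @^-1` B).
  by apply: measurableI; exact: measurable_preim.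
rewrite /= /distribution /pushforward.
rewrite (_ : _ @^-1` _ = X k @^-1` A `&` X l @^-1` B)// -[LHS]fineK ?fin_num_measure//.
rewrite -[X in (X * _)%E]fineK; last exact/fin_num_measure/measurable_preim.
rewrite -[X in (_ * X)%E]fineK; last exact/fin_num_measure/measurable_preim.
rewrite -EFinM -e; congr (fine (P _))%:E; apply/seteqP; split=> w /=.
  by move=> [Aw Bw] i; rewrite /= !finset.inE => /orP[/eqP ->|/eqP ->]; rewrite ?eqxx// eq_sym (negbTE kl).
move=> h; split.
  by have := h k; rewrite /= !finset.inE !eqxx => /(_ isT).
by have := h l; rewrite /= !finset.inE !eqxx orbT eq_sym (negbTE kl) => /(_ isT).
Qed.

Definition degenerate : set T :=
  \bigcup_(i in setT) (X i @^-1` ~` K) `|`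
  \bigcup_(z in [set z : 'I_n * 'I_n | z.1 != z.2]) [set w | X z.1 w = X z.2 w].

Lemma measurable_degenerate : measurable degenerate.
Proof.
apply: measurableU; apply: fin_bigcup_measurable => //.
- by move=> i _; apply: measurable_preim; exact: measurableC.
- by move=> z _; exact: measurable_coincidence.
Qed.

Lemma degenerate_null : P degenerate = 0%E.
Proof.
apply/eqP; rewrite -measure_le0.
have m1 i : measurable (X i @^-1` ~` K) by apply: measurable_preim; exact: measurableC.
have m2 (z : 'I_n * 'I_n) : measurable [set w | X z.1 w = X z.2 w].
  exact: measurable_coincidence.
have [M1 M2] : measurable (\bigcup_(i in [set: 'I_n]) (X i @^-1` ~` K)) /\ measurable
    (\bigcup_(z in [set z : 'I_n * 'I_n | z.1 != z.2]) [set w | X z.1 w = X z.2 w]).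
  by split; exact: fin_bigcup_measurable.
have null (I : finType) (Q : set I) (F : I -> set T) : (forall a, measurable (F a)) ->
    (forall a, Q a -> P (F a) = 0%E) -> (P (\bigcup_(a in Q) F a) <= 0)%E.
  move=> mF F0; have mU : measurable (\bigcup_(a in Q) F a) by exact: fin_bigcup_measurable.
  have := content_sub_fsum P (@finite_finset _ Q) (fun a _ => mF a) mU (@subset_refl _ _).
  by rewrite fsbig1.
apply: le_trans (measureU2 _ M1 M2) _; rewrite -[leRHS](adde0 0) leeD// null//.
  by move=> i _; exact: uniform_outside_null.
by move=> z zz; exact: coincidence_null.
Qed.

Lemma not_degenerate w : ~ degenerate w ->
  (forall i, K (X i w)) /\ injective (fun i => X i w).
Proof.
move=> nN; split.
  by move=> i; apply: contrapT => Ki; apply: nN; left; exists i.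
move=> k l kl; apply: contrapT => /eqP ne; apply: nN; right.
by exists (k, l).
Qed.

Section occupancy.
Variables (A B : set E) (b : bool) (I : {set 'I_n}).
Hypotheses (mA : measurable A) (mB : measurable B).

Definition occupancy w := forall m, if m \in I then A (X m w) else b -> ~ B (X m w).

Let C m := if m \in I then A else if b then ~` B else setT.

Let mC m : measurable (C m).
Proof. by rewrite /C; case: ifP => // _; case: ifP => // _; exact: measurableC. Qed.

Let occupancyE : (fun w => `[< occupancy w >]%:R) = \1_[set w | forall m, C m (X m w)] :> (T -> R).
Proof.
apply/funext => w; rewrite indicE; congr (nat_of_bool _)%:R.
apply/asboolP/idP; rewrite inE /= /C => h m; have := h m; case: ifP => // _; case: ifP => //.
by move=> _; apply.
Qed.

Let measurable_occupancy : measurable [set w | forall m, C m (X m w)].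
Proof.
rewrite (_ : [set w | _] = \bigcap_(m in [set: 'I_n]) (X m @^-1` C m)).
  by apply: fin_bigcap_measurable => // m _; exact: measurable_preim.
by apply/seteqP; split=> [w h m _|w h m]; exact: h.
Qed.

Lemma bounded_meas_occupancy : bounded_meas (fun w => `[< occupancy w >]%:R : R).
Proof. by rewrite occupancyE; exact: bounded_meas_indic. Qed.

Lemma mean_occupancy_le (p q : R) : uniform_prob K A <= p -> q <= uniform_prob K B ->
  mean P (fun w => `[< occupancy w >]%:R) <=
  p ^+ #|I| * (if b then 1 - q else 1) ^+ (n - #|I|).
Proof.
move=> pA qB; rewrite occupancyE mean_indic//.
have P0 m : 0 <= fine (P (X m @^-1` C m)) by exact: fine_ge0.
rewrite (independent_product_rule iX mC) (bigID (mem I))/=.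
apply: ler_pM; [by apply: prodr_ge0|by apply: prodr_ge0| |].
  rewrite -prodr_const; apply: ler_prod => m mI; rewrite P0/= uX// /C mI; exact: pA.
rewrite (_ : (n - #|I|)%N = #|[predC I]|); last first.
  by apply/eqP; rewrite -(eqn_add2l #|I|) cardC card_ord subnKC// -[leqRHS](card_ord n) max_card.
rewrite -prodr_const; apply: ler_prod => m mI.
rewrite P0/= /C (negbTE mI); have [_|_] := boolP b.
  rewrite preimage_setC probability_setC; last exact: measurable_preim.
  rewrite fineB ?fin_num_measure//; last exact: measurable_preim.
  by rewrite /= uX// lerD2l lerN2; exact: qB.
by rewrite preimage_setT probability_setT.
Qed.

End occupancy.

End uniform_sample.

(** * Sums of occupancy probabilities *)

Section occupancy_sums.
Context {R : realType}.
Implicit Types (n j J : nat) (p q : R).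

(** Either l is one of the elements of I already, or it costs one more factor
    p. *)
Lemma sum_setU1_le n p (I : {set 'I_n}) : 0 <= p ->
  \sum_l p ^+ #|(l |: I)%SET| <= p ^+ #|I| * (#|I|%:R + n%:R * p).
Proof.
move=> p0; rewrite (bigID (mem I))/= mulrDr; apply: lerD.
  rewrite (eq_bigr (fun=> p ^+ #|I|)) ?sumr_const ?mulr_natr// => l lI.
  by rewrite (finset.setUidPr _)// finset.sub1set.
rewrite (eq_bigr (fun=> p ^+ #|I| * p)); last first.
  by move=> l lI; rewrite cardsU1 lI add1n exprSr.
rewrite sumr_const -[leLHS]mulr_natl mulrCA ler_wpM2l ?exprn_ge0// ler_wpM2r//.
by rewrite ler_nat -[leqRHS](card_ord n) max_card.
Qed.

Lemma sum_set3_le n p : 0 <= p ->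
  \sum_(i < n) \sum_(k < n) \sum_(l < n) p ^+ #|[set i; k; l]%SET| <= 2 * (1 + n%:R * p) ^+ 3.
Proof.
move=> p0; set x := n%:R * p; have x0 : 0 <= x by rewrite mulr_ge0.
apply: (@le_trans _ _ (x * (1 + x) * (2 + x))); last by nra.
apply: (@le_trans _ _ (\sum_(i < n) p * (1 + x) * (2 + x))); last first.
  by rewrite sumr_const card_ord -[leLHS]mulr_natl !mulrA.
apply: ler_sum => i _.
apply: (@le_trans _ _ (\sum_(k < n) p ^+ #|[set i; k]%SET| * (2 + x))).
  apply: ler_sum => k _.
  under eq_bigr do rewrite finset.setUC.
  apply: le_trans (sum_setU1_le _ p0) _; rewrite ler_wpM2l ?exprn_ge0// lerD2r.
  by rewrite ler_nat cards2; case: (i != k).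
rewrite -mulr_suml ler_wpM2r ?addr_ge0//.
under eq_bigr do rewrite finset.setUC.
by apply: le_trans (sum_setU1_le _ p0) _; rewrite cards1 expr1.
Qed.

Lemma bernoulli_ge n (x : R) : 0 <= x -> 1 + n%:R * x <= (1 + x) ^+ n.
Proof.
move=> x0; elim: n => [|n IH]; first by rewrite mul0r addr0 expr0.
have n0 : 0 <= n%:R :> R by [].
rewrite exprS -natr1; apply: (@le_trans _ _ ((1 + x) * (1 + n%:R * x))); first by nra.
by rewrite ler_wpM2l// addr_ge0.
Qed.

(** Since (1 - q) (1 + q/4)^3 <= 1, the Bernoulli inequality suffices. *)
Lemma cube_mul_expn_le n q : 0 <= q <= 1 -> (1 - q) ^+ n * (1 + n%:R * (q / 4)) ^+ 3 <= 1.
Proof.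
move=> /andP[q0 q1]; have q40 : 0 <= q / 4 by rewrite divr_ge0.
apply: (@le_trans _ _ ((1 - q) ^+ n * ((1 + q / 4) ^+ n) ^+ 3)).
  rewrite ler_wpM2l ?exprn_ge0 ?subr_ge0//.
  by rewrite lerXn2r ?nnegrE ?bernoulli_ge ?exprn_ge0 ?addr_ge0 ?mulr_ge0.
rewrite exprAC -exprMn exprn_ile1//; last by nra.
by rewrite mulr_ge0 ?subr_ge0 ?exprn_ge0 ?addr_ge0.
Qed.

Lemma expn_sub_le n m q : 0 <= q <= 2^-1 -> (m <= n)%N -> (m <= 3)%N ->
  (1 - q) ^+ (n - m) <= 8 * (1 - q) ^+ n.
Proof.
move=> /andP[q0 q2] mn m3; have q1 : 2^-1 <= 1 - q by lra.
have h : (2^-1) ^+ 3 <= (1 - q) ^+ m.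
  apply: (@le_trans _ _ ((2^-1) ^+ m)); last by rewrite lerXn2r ?nnegrE//; lra.
  by rewrite ler_wiXn2l//; lra.
rewrite -[in leRHS](subnK mn) exprD mulrCA ler_peMr ?exprn_ge0//; first by lra.
by move: h; rewrite (_ : 2^-1 ^+ 3 = 8^-1 :> R); [lra|field].
Qed.

Variables (q0 Cp : R).
Hypotheses (q0r : 0 < q0 <= 2^-1) (Cp0 : 0 < Cp).

Let hit j : R := Cp / 8 ^+ j.
Let miss J j : R := if (j < J)%N then 1 - q0 / 8 ^+ j else 1.

(** One term for the levels below J, the other for the level J. *)
Definition occupancy_bound : R := 16 * (1 + 4 * Cp / q0) ^+ 3 + 16 * (1 + 8 * Cp) ^+ 3.

Lemma occupancy_bound_ge0 : 0 <= occupancy_bound.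
Proof.
have [q00 _] := andP q0r.
rewrite /occupancy_bound addr_ge0// mulr_ge0// exprn_ge0// addr_ge0// ?divr_ge0 ?mulr_ge0// ltW//.
Qed.

(** Below the level J, 1 + n p is at most a multiple of 1 + n q/4, the cube of
    which is absorbed by (1 - q)^n. At the level J nothing is missed, but n p
    <= 8 Cp because n < 8^(J+1). *)
Lemma occupancy_cube_le n J j m : (j <= J)%N -> (n < 8 ^ J.+1)%N -> (m <= n)%N -> (m <= 3)%N ->
  2 * (1 + n%:R * hit j) ^+ 3 * miss J j ^+ (n - m) <= occupancy_bound.
Proof.
move=> jJ nJ mn m3; have [q00 q02] := andP q0r.
have e8 : 0 < 8 ^+ j :> R by exact: exprn_gt0.
have n0 : 0 <= n%:R :> R by [].
have h0 : 0 <= hit j by rewrite /hit divr_ge0// ltW.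
have M0 : 0 <= 4 * Cp / q0 by rewrite divr_ge0 ?mulr_ge0// ltW.
rewrite /occupancy_bound /miss; case: ifPn => jJ'.
  set q := q0 / 8 ^+ j; have q_0 : 0 <= q by rewrite /q divr_ge0// ltW.
  have q_2 : q <= 2^-1.
    apply: le_trans q02; rewrite /q ler_pdivrMr// ler_peMr ?(ltW q00)//.
    by rewrite exprn_ege1// ler1n.
  have step : 1 + n%:R * hit j <= (1 + 4 * Cp / q0) * (1 + n%:R * (q / 4)).
    have -> : hit j = 4 * Cp / q0 * (q / 4).
      by rewrite /hit /q; field; rewrite ?expf_neq0 ?gt_eqF//.
    have : 0 <= n%:R * (q / 4) by rewrite mulr_ge0// divr_ge0.
    by nra.
  have cube := @cube_mul_expn_le n q; have := @expn_sub_le n m q.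
  rewrite q_0 q_2 => /(_ isT mn m3) h1; have {}cube := cube _.
  apply: (@le_trans _ _ (16 * (1 + 4 * Cp / q0) ^+ 3)); last by rewrite lerDl mulr_ge0// exprn_ge0// addr_ge0 ?mulr_ge0// ltW.
  apply: (@le_trans _ _ (2 * ((1 + 4 * Cp / q0) * (1 + n%:R * (q / 4))) ^+ 3 * (8 * (1 - q) ^+ n))).
    have a0 : 0 <= 1 + n%:R * hit j by rewrite addr_ge0// mulr_ge0.
    apply: ler_pM h1.
    - by apply: mulr_ge0 => //; apply: exprn_ge0.
    - by apply: exprn_ge0; lra.
    by rewrite ler_wpM2l// lerXn2r// nnegrE//; exact: le_trans step.
  rewrite exprMn (_ : _ * _ = 16 * (1 + 4 * Cp / q0) ^+ 3 * ((1 - q) ^+ n * (1 + n%:R * (q / 4)) ^+ 3)); last by ring.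
  rewrite ler_piMr ?mulr_ge0 ?exprn_ge0 ?addr_ge0//; apply: cube; lra.
have {jJ'} -> : j = J by apply/eqP; rewrite eqn_leq jJ leqNgt.
rewrite expr1n mulr1.
have : n%:R * hit J <= 8 * Cp.
  rewrite /hit mulrCA mulrC ler_wpM2r ?(ltW Cp0)// ler_pdivrMr ?exprn_gt0//.
  by rewrite -exprS -natrX ler_nat ltnW.
move=> h; have : (1 + n%:R * hit J) ^+ 3 <= (1 + 8 * Cp) ^+ 3.
  by rewrite lerXn2r ?nnegrE ?addr_ge0 ?mulr_ge0 ?lerD2l// /hit ?divr_ge0 ?exprn_ge0 ?(ltW Cp0).
have : 0 <= (1 + 8 * Cp) ^+ 3 by rewrite exprn_ge0// addr_ge0// mulr_ge0// ltW.
have : 0 <= (1 + 4 * Cp / q0) ^+ 3 by rewrite exprn_ge0// addr_ge0.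
by lra.
Qed.

End occupancy_sums.

(** * The variance bounds *)

(** On N the sum of the two bounds makes up for the missing inequality, at no
    cost in the mean. *)
Lemma mean_le_null {R : realType} d (T : measurableType d) (P : probability T R) (N : set T)
    (f g : T -> R) :
  measurable N -> P N = 0%E -> bounded_meas f -> bounded_meas g ->
  (forall x, ~ N x -> f x <= g x) -> mean P f <= mean P g.
Proof.
move=> mN PN bf bg fg; have [_ [Mf hf]] := bf; have [_ [Mg hg]] := bg.
have b1 : bounded_meas (fun x => (Mf + Mg) * \1_N x).
  by apply: bounded_measM; [exact: bounded_meas_cst|exact: bounded_meas_indic].
apply: (@le_trans _ _ (mean P (fun x => g x + (Mf + Mg) * \1_N x))).
  apply: mean_le => //; first exact: bounded_measD.
  move=> x; rewrite indicE; have [xN|xN] := boolP (x \in N).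
    rewrite mulr1 addrA; have := hf x; have := hg x.
    by rewrite !ler_norml => /andP[? _] /andP[_ ?]; lra.
  by rewrite mulr0 addr0; apply: fg; rewrite notin_setE in xN.
rewrite meanD// meanZ; last exact: bounded_meas_indic.
by rewrite mean_indic// PN mulr0 addr0.
Qed.

Lemma eq_inhull {R : realType} (r : R) n (J : {set 'I_n}) (X Y : 'I_n -> R * R) :
  (forall j, j \in J -> X j = Y j) -> inhull r J X = inhull r J Y.
Proof.
move=> XY; apply/funext => y; apply/propext; split=> h c hc; apply: h => j jJ.
  by rewrite XY//; exact: hc.
by rewrite -XY//; exact: hc.
Qed.

Section variance_bounds.
Context {R : realType} {d : measure_display} {T : measurableType d}.
Local Notation E := (R * R)%type.
Variables (K : set E) (r : R).
Hypotheses (dK : convex_disc K) (hK : C2plus_boundary K) (rK : r_max K < r).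
Variables (N0 : nat) (q0 Cp : R) (S S' : forall j, net_index (N0 * 2 ^ j) -> set E).
Hypotheses (q0r : 0 < q0 <= 2^-1) (Cp0 : 0 < Cp).
Hypothesis cells : forall j i, [/\ measurable (@S j i), measurable (@S' j i),
  q0 / 8 ^+ j <= uniform_prob K (@S j i) & uniform_prob K (@S' j i) <= Cp / 8 ^+ j].
Hypothesis cover : forall (J : nat) (G : set E) z, G !=set0 ->
  (forall c, G c -> cap K r c z) ->
  exists c j i, [/\ G c, (j <= J)%N, (j < J)%N -> @S j i `<=` cap K r c &
    forall c', G c' -> cap K r c' `<=` @S' j i].
Variables (n J : nat) (P : probability T R) (X : 'I_n -> {RV P >-> E}).
Hypotheses (iX : independent X) (uX : forall i, uniform_on K (X i)).
Hypotheses (n1 : (1 <= n)%N) (nJ : (n < 8 ^ J.+1)%N).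

Let mS j i : measurable (@S j i). Proof. by have [] := cells i. Qed.
Let mS' j i : measurable (@S' j i). Proof. by have [] := cells i. Qed.

Let mK : measurable K.
Proof. by have [cK _ _] := dK; exact: compact_measurable_plane. Qed.

Let K0 : K !=set0.
Proof. by have [_ _ [x /interior_subset]] := dK; exists x. Qed.

Let Koo : (area K < +oo)%E.
Proof. by have [cK _ _] := dK; exact: area_compact_lty. Qed.

Let ev j (a : net_index (N0 * 2 ^ j)) (I : {set 'I_n}) w : R :=
  `[< cell_event S S' J a I (fun m => X m w) >]%:R.

Let bounded_ev j (a : net_index (N0 * 2 ^ j)) I : bounded_meas (ev a I).
Proof. exact: (bounded_meas_occupancy X (j < J)%N I (mS' a) (mS a)). Qed.

Let mean_ev j (a : net_index (N0 * 2 ^ j)) (I : {set 'I_n}) : mean P (ev a I) <=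
  (Cp / 8 ^+ j) ^+ #|I| * (if (j < J)%N then 1 - q0 / 8 ^+ j else 1) ^+ (n - #|I|).
Proof.
have [_ _ qS pS'] := cells a.
exact: (mean_occupancy_le iX uX (j < J)%N I (mS' a) (mS a) pS' qS).
Qed.

(** There are 8 N0 2^j cells of level j, and a geometric progression is
    dominated by its last term. *)
Let sum_cells (F : forall j, net_index (N0 * 2 ^ j) -> R) (M : R) :
  (forall j a, (j <= J)%N -> F j a <= M) -> 0 <= M ->
  \sum_(j < J.+1) \sum_a F j a <= M * (16 * N0%:R) * 2 ^+ J.
Proof.
move=> FM M0.
apply: (@le_trans _ _ (\sum_(j < J.+1) M * (8 * N0%:R) * 2 ^+ j)).
  apply: ler_sum => j _.
  apply: (@le_trans _ _ (\sum_(a : net_index (N0 * 2 ^ j)) M)).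
    by apply: ler_sum => a _; apply: FM; rewrite -ltnS.
  rewrite sumr_const /net_index !card_prod card_bool card_ord -[leLHS]mulr_natr !natrM natrX.
  by lra.
rewrite -mulr_sumr -!mulrA ler_wpM2l// [leRHS](_ : _ = 8 * (N0%:R * (2 * 2 ^+ J))); last by ring.
rewrite ler_wpM2l// ler_wpM2l// -exprS.
elim: J => [|m IH]; first by rewrite big_ord1 expr0 expr1 ler1n.
by rewrite big_ord_recr /= [2 ^+ m.+2]exprS; lra.
Qed.

Let tnth_sample w : tnth (sample X w) = fun i => X i w.
Proof. by apply/funext => i; rewrite tnth_mktuple. Qed.

Let degenerate0 := degenerate_null iX uX mK.
Let mdegenerate := measurable_degenerate X mK.

Let miss_range j : 0 <= (if (j < J)%N then 1 - q0 / 8 ^+ j else 1 : R) <= 1.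
Proof.
have [q00 q02] := andP q0r.
have e8 : 1 <= 8 ^+ j :> R by rewrite exprn_ege1// ler1n.
have : 0 <= q0 / 8 ^+ j <= 1.
  by rewrite divr_ge0 ?(ltW q00) ?(le_trans _ e8)//= ler_pdivrMr; lra.
by case: ifP => _; lra.
Qed.

(** By [efron_stein] and [sqr_vertex_diff_cells] the variance is at most the
    sum over the cells of the expected number of triples (i, k, l) that realize
    the event of the cell, and [occupancy_cube_le] bounds this number for each
    cell. *)
Lemma var_vertex_count_le :
  var P (@vertex_count R r n \o (@tnth n E) \o sample X) <=
  occupancy_bound q0 Cp * (16 * N0%:R) * 2 ^+ J.
Proof.
pose G i (t : n.-tuple E) := vertex_count_without r i (tnth t).
have bF : bounded_meas (@vertex_count R r n \o @tnth n E).
  by apply: bounded_meas_sum => k; exact: bounded_meas_notin_hull.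
have bG i : bounded_meas (G i).
  by apply: bounded_meas_sum => k; exact: bounded_meas_notin_hull.
apply: le_trans (efron_stein (G := G) (independent_product_rule iX) bF bG _) _.
  move=> i t t' tt; rewrite /G /vertex_count_without; apply: eq_bigr => k ki.
  congr (nat_of_bool _)%:R; congr asbool; congr (~ _).
  rewrite (tt _ ki) (@eq_inhull _ _ _ _ _ (tnth t'))// => m.
  by rewrite !finset.inE negb_or => /andP[/tt].
apply: (@le_trans _ _ (\sum_i mean P (fun w =>
    \sum_(j < J.+1) \sum_a \sum_k \sum_l ev a [set i; k; l]%SET w))).
  apply: ler_sum => i _; apply: (mean_le_null mdegenerate degenerate0).
  - apply: bounded_meas_sqr; apply: bounded_measB.
    + exact: (bounded_meas_comp (measurable_sample X) bF).
    + exact: (bounded_meas_comp (measurable_sample X) (bG i)).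
  - apply: bounded_meas_sum => j; apply: (@bounded_meas_sum _ _ _ (net_index (N0 * 2 ^ j))) => a /=.
    by do 2! (apply: bounded_meas_sum => ? /=); exact: bounded_ev.
  - move=> w /not_degenerate[Kw _]; rewrite /G /= tnth_sample.
    exact: (sqr_vertex_diff_cells dK hK rK cover J i (X := fun m => X m w) Kw).
apply: (@le_trans _ _ (\sum_(j < J.+1) \sum_a \sum_i \sum_k \sum_l
    mean P (ev a [set i; k; l]%SET))).
  under [leRHS]eq_bigr => j _ do rewrite exchange_big.
  rewrite [leRHS]exchange_big; apply: ler_sum => i _ /=.
  rewrite mean_sum; last first.
    move=> j; apply: (@bounded_meas_sum _ _ _ (net_index (N0 * 2 ^ j))) => a /=.
    by do 2! (apply: bounded_meas_sum => ? /=); exact: bounded_ev.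
  apply: ler_sum => j _.
  rewrite mean_sum; last by move=> a; do 2! (apply: bounded_meas_sum => ? /=); exact: bounded_ev.
  apply: ler_sum => a _.
  rewrite mean_sum; last by move=> k; apply: bounded_meas_sum => ?; exact: bounded_ev.
  apply: ler_sum => k _.
  by rewrite mean_sum// => l; exact: bounded_ev.
apply: (@sum_cells (fun j a => \sum_i \sum_k \sum_l mean P (ev a [set i; k; l]%SET))) => [j a jJ|];
  last exact: occupancy_bound_ge0.
have m3 := geq_minr n 3; have mn := geq_minl n 3.
apply: le_trans (occupancy_cube_le q0r Cp0 jJ nJ mn m3).
have p0 : 0 <= Cp / 8 ^+ j by rewrite divr_ge0// ltW.
set y := (X in _ <= _ * X); set p := Cp / 8 ^+ j.
apply: (@le_trans _ _ (\sum_(i < n) \sum_(k < n) \sum_(l < n) p ^+ #|[set i; k; l]%SET| * y)).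
  apply: ler_sum => i _; apply: ler_sum => k _; apply: ler_sum => l _.
  apply: le_trans (mean_ev _ _) _; rewrite ler_wpM2l ?exprn_ge0//; have /andP[b0 b1] := miss_range j.
  rewrite /y ler_wiXn2l// leq_sub2l//.
  rewrite leq_min -[X in (_ <= X)%N](card_ord n) max_card /=.
  rewrite finset.setUC cardsU1 cards2; by case: (_ \notin _); case: (_ != _).
have -> : \sum_(i < n) \sum_(k < n) \sum_(l < n) p ^+ #|[set i; k; l]%SET| * y =
    (\sum_(i < n) \sum_(k < n) \sum_(l < n) p ^+ #|[set i; k; l]%SET|) * y.
  by rewrite mulr_suml; apply: eq_bigr => i _; rewrite mulr_suml; apply: eq_bigr => k _;
    rewrite mulr_suml.
by rewrite ler_wpM2r ?sum_set3_le// /y exprn_ge0//; have /andP[] := miss_range j.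
Qed.

(** Here one index replaces the triple, with the square of the area of the
    large cell as weight. The factor n^2 p^2 of this weight, times the expected
    number n p (1 - q)^(n - 1) of indices, is again a cube to which
    [occupancy_cube_le] applies. *)
Lemma var_hull_area_le :
  var P (hull_area r K [set: 'I_n]%SET \o sample X) <=
  fine (area K) ^+ 2 * occupancy_bound q0 Cp * (16 * N0%:R) * 2 ^+ J / n%:R ^+ 2.
Proof.
have n0 : 0 < n%:R :> R by rewrite ltr0n.
pose G i (t : n.-tuple E) := hull_area r K (~: [set i])%SET t.
have bF := bounded_meas_hull_area r mK Koo [set: 'I_n]%SET.
have bG i : bounded_meas (G i) by exact: bounded_meas_hull_area.
apply: le_trans (efron_stein (G := G) (independent_product_rule iX) bF bG _) _.
  move=> i t t' tt; rewrite /G /hull_area (@eq_inhull _ _ _ _ _ (tnth t'))// => m.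
  by rewrite !finset.inE => /tt.
pose c j (a : net_index (N0 * 2 ^ j)) := fine (area (K `&` S' a)) ^+ 2.
have c0 j a : 0 <= @c j a by exact: sqr_ge0.
have bcev j a I : bounded_meas (fun w => @c j a * ev a I w).
  by apply: bounded_measM => //; exact: bounded_meas_cst.
apply: (@le_trans _ _ (\sum_i mean P (fun w =>
    \sum_(j < J.+1) \sum_a @c j a * ev a [set i]%SET w))).
  apply: ler_sum => i _; apply: (mean_le_null mdegenerate degenerate0).
  - apply: bounded_meas_sqr; apply: bounded_measB.
    + exact: (bounded_meas_comp (measurable_sample X) bF).
    + exact: (bounded_meas_comp (measurable_sample X) (bG i)).
  - by apply: bounded_meas_sum => j; apply: (@bounded_meas_sum _ _ _ (net_index (N0 * 2 ^ j))) => a /=; exact: bcev.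
  - move=> w /not_degenerate[Kw _]; rewrite /G /hull_area /= tnth_sample.
    exact: (sqr_area_diff_cells dK hK rK mS' cover J i (X := fun m => X m w) Kw).
rewrite ler_pdivlMr ?exprn_gt0//.
apply: (@le_trans _ _ (\sum_(j < J.+1) \sum_a \sum_i @c j a * mean P (ev a [set i]%SET) * n%:R ^+ 2)).
  under [leRHS]eq_bigr => j _ do rewrite exchange_big.
  rewrite [leRHS]exchange_big mulr_suml; apply: ler_sum => i _ /=.
  rewrite mean_sum; last first.
    by move=> j; apply: (@bounded_meas_sum _ _ _ (net_index (N0 * 2 ^ j))) => a /=; exact: bcev.
  rewrite mulr_suml; apply: ler_sum => j _.
  rewrite mean_sum// mulr_suml; apply: ler_sum => a _.
  by rewrite meanZ.
have A0 : 0 <= fine (area K) by exact: fine_ge0.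
have A1 : 0 < fine (area K).
  by rewrite lt_def A0 (area_uniform_neq0 uX (Ordinal n1)).
apply: (@sum_cells (fun j a => \sum_i @c j a * mean P (ev a [set i]%SET) * n%:R ^+ 2)) => [j a jJ|];
  last by rewrite mulr_ge0 ?sqr_ge0 ?occupancy_bound_ge0.
have m3 : (1 <= 3)%N by [].
set p := Cp / 8 ^+ j; have p0 : 0 <= p by rewrite divr_ge0// ltW.
have := occupancy_cube_le q0r Cp0 jJ nJ n1 m3.
set y := (_ ^+ (n - 1)%N) => hB.
have y0 : 0 <= y by rewrite /y exprn_ge0//; have /andP[] := miss_range j.
apply: (@le_trans _ _ (\sum_(i < n) fine (area K) ^+ 2 * p ^+ 2 * (p * y) * n%:R ^+ 2)).
  apply: ler_sum => i _; rewrite ler_wpM2r ?sqr_ge0//; apply: ler_pM => //.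
  - exact: mean_ge0.
  - have [_ _ _ pS'] := cells a.
    rewrite /c -exprMn lerXn2r ?nnegrE//; [exact: fine_ge0|exact: mulr_ge0|].
    by move: pS'; rewrite /uniform_prob ler_pdivrMr// mulrC.
  - by apply: le_trans (mean_ev _ _) _; rewrite cards1 expr1.
rewrite sumr_const card_ord -[leLHS]mulr_natl.
rewrite (_ : n%:R * _ = fine (area K) ^+ 2 * ((n%:R * p) ^+ 3 * y)); last by ring.
rewrite ler_wpM2l ?sqr_ge0//; apply: le_trans hB; rewrite ler_wpM2r//.
have : 0 <= n%:R * p by rewrite mulr_ge0.
set x := n%:R * p => x0; rewrite -[X in _ <= 2 * (1 + X) ^+ 3]/x.
have : x ^+ 3 <= (1 + x) ^+ 3 by rewrite lerXn2r ?nnegrE ?addr_ge0// lerDr.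
by have := exprn_ge0 3 x0; lra.
Qed.

End variance_bounds.

Lemma two_expn_le_cube_root {R : realType} (n J : nat) : (8 ^ J <= n)%N -> 2 ^+ J <= n%:R `^ (1 / 3) :> R.
Proof.
move=> Jn; have e0 : 0 <= 2 ^+ J :> R by [].
have -> : 2 ^+ J = ((2 ^+ J) ^+ 3) `^ (1 / 3) :> R.
  by rewrite -[(_ ^+ 3)%R]powR_mulrn// -powRrM (_ : 3%:R * (1 / 3) = 1) ?powRr1//; field.
apply: ge0_ler_powR; rewrite ?nnegrE ?exprn_ge0 ?divr_ge0//.
by rewrite -!natrX ler_nat -expnM mulnC expnM.
Qed.

Theorem theorem3 (R : realType) (K : set (R * R)) (r : R)
  (K_convex : convex_disc K) (K_C2plus : C2plus_boundary K)
  (r_gt : r_max K < r) :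
  exists gamma : R, 0 < gamma /\
    forall (n : nat), (1 <= n)%N ->
    forall (d : measure_display) (T : measurableType d) (P : probability T R)
      (X : 'I_n -> {RV P >-> (R * R)%type}),
      independent X -> (forall i, uniform_on K (X i)) ->
      ('V_P[fun w => (f_0 r (disc_polygon r X w))%:R]
         <= (gamma * n%:R `^ (1 / 3))%:E)%E /\
      ('V_P[fun w => fine (area (disc_polygon r X w))]
         <= (gamma * n%:R `^ (- (5 / 3)))%:E)%E.
Proof.
have [cK vK iK] := K_convex.
have mK : measurable K by exact: compact_measurable_plane.
have K0 : K !=set0 by case: iK => x /interior_subset; exists x.
have Koo := area_compact_lty cK K0.
have [R0 [c0 [R0r hc0]]] := enclosing_center K_convex K_C2plus r_gt.
have [N0 [q0 [Cp [S [S' [q0r Cp0 cells cover]]]]]] := cap_covering K_convex K_C2plus r_gt.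
rewrite div1r in q0r; set A := fine (area K); set B := occupancy_bound q0 Cp * (16 * N0%:R).
have B0 : 0 <= B by rewrite /B !mulr_ge0// (occupancy_bound_ge0 q0r Cp0).
exists (1 + (1 + A ^+ 2) * B).
have g0 : 0 < 1 + (1 + A ^+ 2) * B by rewrite ltr_pwDl// mulr_ge0// addr_ge0// sqr_ge0.
split => // n n1 d T P X iX uX.
have /andP[nJ nJ1] : (8 ^ trunc_log 8 n <= n < 8 ^ (trunc_log 8 n).+1)%N.
  exact: trunc_log_bounds.
set J := trunc_log 8 n in nJ nJ1.
have n0 : 0 < n%:R :> R by rewrite ltr0n.
have J0 : 0 <= 2 ^+ J :> R by rewrite exprn_ge0.
have root := @two_expn_le_cube_root R n J nJ.
have tnthE w : tnth (sample X w) = fun i => X i w.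
  by apply/funext => i; rewrite tnth_mktuple.
have mN := measurable_degenerate X mK; have PN := degenerate_null iX uX mK.
have bcount : bounded_meas ((@vertex_count R r n \o @tnth n _) \o sample X).
  apply: (bounded_meas_comp (measurable_sample X)).
  by apply: bounded_meas_sum => k; exact: bounded_meas_notin_hull.
have barea : bounded_meas (hull_area r K [set: 'I_n]%SET \o sample X).
  apply: (bounded_meas_comp (measurable_sample X)).
  exact: bounded_meas_hull_area.
split.
  rewrite (variance_ae_eq (g := (@vertex_count R r n \o @tnth n _) \o sample X) mN PN)//.
  - rewrite lee_fin; apply: le_trans (var_vertex_count_le K_convex K_C2plus r_gt q0r Cp0 cells cover iX uX nJ1) _.
    rewrite -/B; apply: ler_pM => //; have : 0 <= A ^+ 2 * B by rewrite mulr_ge0// sqr_ge0.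
    by lra.
  - by move=> w; apply: sumr_ge0.
  - move=> w /not_degenerate[Kw injw].
    by rewrite /disc_polygon (f_0E R0r hc0 Kw injw) /= tnthE natr_sum.
rewrite (variance_ae_eq (g := hull_area r K [set: 'I_n]%SET \o sample X) mN PN)//.
- rewrite lee_fin; apply: le_trans (var_hull_area_le K_convex K_C2plus r_gt q0r Cp0 cells cover iX uX n1 nJ1) _.
  have -> : n%:R `^ (- (5 / 3)) = n%:R `^ (1 / 3) / n%:R ^+ 2 :> R.
    rewrite -powR_mulrn// -powRN -powRD; last by rewrite (gt_eqF n0) implybT.
    by congr (_ `^ _); field.
  rewrite [leRHS]mulrA ler_wpM2r ?invr_ge0 ?exprn_ge0// -/A -[_ * _ * (16 * _)]mulrA -/B.
  apply: ler_pM => //; first by rewrite mulr_ge0// sqr_ge0.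
  by lra.
- by move=> w; exact: fine_ge0.
- by move=> w; exact: fine_ge0.
- move=> w /not_degenerate[Kw _].
  rewrite /disc_polygon (conv_rE R0r hc0 Kw) /hull_area /= tnthE.
  congr (fine (area _)); apply/esym/setIidPr => y; apply: inhull_subset => //.
Qed.
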